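(* $\mathsf{RCA}_0^\omega$ proves $\mathsf{NIN}\leftrightarrow(\mathsf A)$ and $(\mathsf B)\to\mathsf{NIN}$, where $(\mathsf A)$: for every countable $A\subseteq\mathbb R$ there is $y\in[0,1]$ with $y\neq_{\mathbb R}x$ for all $x\in A$; $(\mathsf B)$: if $A\subseteq[0,1]$ is countable, then $A$ is not perfect. Likewise, $\mathsf{RCA}_0^\omega$ proves $\mathsf{NBI}\leftrightarrow(\mathsf A')$ and $(\mathsf B')\to\mathsf{NBI}$, where $(\mathsf A')$ and $(\mathsf B')$ are $(\mathsf A)$ and $(\mathsf B)$ with ''countable'' replaced by ''strongly countable''.
   Context: Framework: Kohlenbach's higher-order arithmetic; $\mathsf{RCA}_0^\omega$ is the base theory (ordered semiring axioms, combinators/$\lambda$-abstraction, primitive recursion $\mathbf R_0$, extensionality at all finite types, quantifier-free induction, and $\mathsf{QF\text{-}AC}^{1,0}$). Reals are fast-converging Cauchy sequences of rationals with equality $=_{\mathbb R}$. A subset $A\subseteq\mathbb R$ is represented by an arbitrary function $A:\mathbb R\to\mathbb R$, with $x\in A$ meaning $A(x)>0$; $A$ is open if every $x\in A$ has a ball $B(x,r)\subseteq A$, closed if its complement is open, and perfect if it is closed and every point of $A$ is a limit point of $A$. $A$ is countable if there is $Y:\mathbb R\to\mathbb N$ with $(\forall x,y\in A)(Y(x)=Y(y)\to x=_{\mathbb R}y)$, strongly countable if moreover $(\forall n\in\mathbb N)(\exists x\in A)(Y(x)=n)$. $\mathsf{NIN}$: for every $Y:[0,1]\to\mathbb N$ there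 are $x,y\in[0,1]$ with $x\neq_{\mathbb R}y$ and $Y(x)=Y(y)$. $\mathsf{NBI}$: for every $Y:[0,1]\to\mathbb N$, either there are $x,y\in[0,1]$ with $x\ne_{\mathbb R}y$ and $Y(x)=Y(y)$, or there is $N\in\mathbb N$ with $(\forall x\in[0,1])(Y(x)\neq N)$. *)

(* Defs.v *)
From Stdlib Require Import List.
Import ListNotations.

Set Implicit Arguments.
Unset Strict Implicit.
Unset Printing Implicit Defensive.

Declare Scope ho_scope.
Delimit Scope ho_scope with ho.
Local Open Scope ho_scope.

Inductive ty : Set :=
| N : ty
| Arr : ty -> ty -> ty.

Notation "s ~> t" := (Arr s t) (at level 55, right associativity) : ho_scope.

Definition ty1 : ty := N ~> N.
Definition ty2 : ty := ty1 ~> N.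
Definition ty11 : ty := ty1 ~> ty1.

(** Syntax is intrinsically typed and well scoped: [V s] is the set of free
    variables of type [s], and [ext V s] adds one variable [new] of type [s].
    A sentence is a formula over [no_vars]. *)
Definition ctx : Type := ty -> Set.

Definition no_vars : ctx := fun _ => Empty_set.

Inductive ext (V : ctx) (s : ty) : ty -> Set :=
| new : ext V s s
| old (t : ty) : V t -> ext V s t.
Arguments new {V s}.
Arguments old {V s t} _.

(** [Kc] and [Sc] are the combinators written Pi and Sigma by Kohlenbach.  The
    recursor [Rc] takes the step function first; it has type 0 -> 0 -> 0, the
    unfolding of "[f] of type 1 in two numerical arguments". *)
Inductive term (V : ctx) : ty -> Set :=
| Var (t : ty) : V t -> term V t
| App (s t : ty) : term V (s ~> t) -> term V s -> term V t
| Zero : term V N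
| One : term V N
| Plus : term V (N ~> N ~> N)
| Times : term V (N ~> N ~> N)
| Kc (s t : ty) : term V (s ~> t ~> s)
| Sc (r s t : ty) : term V ((r ~> s ~> t) ~> (r ~> s) ~> r ~> t)
| Rc : term V ((N ~> N ~> N) ~> N ~> N ~> N).
Arguments Var {V t} _.
Arguments App {V s t} _ _.
Arguments Zero {V}.
Arguments One {V}.
Arguments Plus {V}.
Arguments Times {V}.
Arguments Kc {V s t}.
Arguments Sc {V r s t}.
Arguments Rc {V}.

(** Equality is primitive at type 0 only. *)
Inductive form (V : ctx) : Set :=
| Eq : term V N -> term V N -> form V
| Lt : term V N -> term V N -> form V
| Bot : form V
| Imp : form V -> form V -> form V
| And : form V -> form V -> form V
| Or : form V -> form V -> form V
| All (s : ty) : form (ext V s) -> form V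
| Ex (s : ty) : form (ext V s) -> form V.
Arguments Eq {V} _ _.
Arguments Lt {V} _ _.
Arguments Bot {V}.
Arguments Imp {V} _ _.
Arguments And {V} _ _.
Arguments Or {V} _ _.
Arguments All {V} s _.
Arguments Ex {V} s _.

Definition Neg {V} (p : form V) : form V := Imp p Bot.
Definition Iff {V} (p q : form V) : form V := And (Imp p q) (Imp q p).

Notation "f @ a" := (App f a) (at level 20, left associativity) : ho_scope.
Notation "a ⊕ b" := (Plus @ a @ b) (at level 50, left associativity) : ho_scope.
Notation "a ⊗ b" := (Times @ a @ b) (at level 40, left associativity) : ho_scope.
Notation "a == b" := (Eq a b) (at level 70, no associativity) : ho_scope.
Notation "a ≺ b" := (Lt a b) (at level 70, no associativity) : ho_scope.
Notation "¬ p" := (Neg p) (at level 75, right associativity) : ho_scope.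
Notation "p ∧ q" := (And p q) (at level 80, right associativity) : ho_scope.
Notation "p ∨ q" := (Or p q) (at level 85, right associativity) : ho_scope.
Notation "p ⇒ q" := (Imp p q) (at level 90, right associativity) : ho_scope.
Notation "p ⇔ q" := (Iff p q) (at level 95, no associativity) : ho_scope.
Notation "'∀' s , p" := (All s p) (at level 97, s at level 60, p at level 97) : ho_scope.
Notation "'∃' s , p" := (Ex s p) (at level 97, s at level 60, p at level 97) : ho_scope.

Fixpoint quantifier_free {V} (p : form V) : bool :=
  match p with
  | Eq _ _ | Lt _ _ | Bot => true
  | Imp p q | And p q | Or p q =>
      if quantifier_free p then quantifier_free q else false
  | All _ _ | Ex _ _ => false
  end.

Definition sub (V W : ctx) : Type := forall s, V s -> term W s.

Definition scons {V W s} (a : term W s) (f : sub V W) : sub (ext V s) W :=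
  fun t x =>
    match x in ext _ _ t' return term W t' with
    | new => a
    | old y => f _ y
    end.

Definition ids {V} : sub V V := fun _ x => Var x.
Definition wk1 {V s} : sub V (ext V s) := fun _ x => Var (old x).

Fixpoint tsub {V W s} (f : sub V W) (a : term V s) : term W s :=
  match a in term _ s' return term W s' with
  | Var x => f _ x
  | App a b => App (tsub f a) (tsub f b)
  | Zero => Zero
  | One => One
  | Plus => Plus
  | Times => Times
  | Kc => Kc
  | Sc => Sc
  | Rc => Rc
  end.

Definition lift {V W s} (f : sub V W) : sub (ext V s) (ext W s) :=
  scons (Var new) (fun _ x => tsub wk1 (f _ x)).

Fixpoint fsub {V W} (f : sub V W) (p : form V) : form W :=
  match p with
  | Eq a b => Eq (tsub f a) (tsub f b)
  | Lt a b => Lt (tsub f a) (tsub f b)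
  | Bot => Bot
  | Imp p q => Imp (fsub f p) (fsub f q)
  | And p q => And (fsub f p) (fsub f q)
  | Or p q => Or (fsub f p) (fsub f q)
  | All s p => All s (fsub (lift f) p)
  | Ex s p => Ex s (fsub (lift f) p)
  end.

Definition twk {V s t} (a : term V t) : term (ext V s) t := tsub wk1 a.
Definition fwk {V s} (p : form V) : form (ext V s) := fsub wk1 p.
Definition inst {V s} (a : term V s) (p : form (ext V s)) : form V :=
  fsub (scons a ids) p.

Notation "a ↑" := (twk a) (at level 1, left associativity, format "a ↑") : ho_scope.

Definition v0 {V a} : term (ext V a) a := Var new.
Definition v1 {V a b} : term (ext (ext V a) b) a := Var (old new).
Definition v2 {V a b c} : term (ext (ext (ext V a) b) c) a :=
  Var (old (old new)).

Definition theory : Type := forall V : ctx, form V -> Prop.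

Inductive prf (T : theory) (V : ctx) (G : list (form V)) : form V -> Prop :=
| Ax p : T V p -> prf T G p
| Hyp p : In p G -> prf T G p
| ImpI p q : prf T (p :: G) q -> prf T G (p ⇒ q)
| ImpE p q : prf T G (p ⇒ q) -> prf T G p -> prf T G q
| AndI p q : prf T G p -> prf T G q -> prf T G (p ∧ q)
| AndE1 p q : prf T G (p ∧ q) -> prf T G p
| AndE2 p q : prf T G (p ∧ q) -> prf T G q
| OrI1 p q : prf T G p -> prf T G (p ∨ q)
| OrI2 p q : prf T G q -> prf T G (p ∨ q)
| OrE p q r :
    prf T G (p ∨ q) -> prf T (p :: G) r -> prf T (q :: G) r -> prf T G r
| RAA p : prf T ((¬ p) :: G) Bot -> prf T G p
| AllI s (p : form (ext V s)) : prf T (map fwk G) p -> prf T G (∀ s, p)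
| AllE s (p : form (ext V s)) a : prf T G (∀ s, p) -> prf T G (inst a p)
| ExI s (p : form (ext V s)) a : prf T G (inst a p) -> prf T G (∃ s, p)
| ExE s (p : form (ext V s)) q :
    prf T G (∃ s, p) -> prf T (p :: map fwk G) (fwk q) -> prf T G q
| EqRefl a : prf T G (a == a)
| EqSubst (p : form (ext V N)) a b :
    prf T G (a == b) -> prf T G (inst a p) -> prf T G (inst b p).

Notation "T ⊢ p" := (@prf T no_vars [] p) (at level 99, no associativity) : ho_scope.

(** Equality at higher types abbreviates pointwise equality. *)
Fixpoint eqt {V} (s : ty) : term V s -> term V s -> form V :=
  match s return term V s -> term V s -> form V with
  | N => fun a b => a == b
  | s ~> t => fun a b => ∀ s, eqt (a↑ @ v0) (b↑ @ v0)
  end.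

(** Axioms are open formulas over any [V], i.e. they stand for their universal
    closures.  In [QF_AC10] the matrix [A] has [v1 : ty1] as [x] and [v0 : N]
    as [y]; the substitution replaces [y] by [F @ x] under the binders of [F]
    and [x]. *)
Inductive RCA0w : theory :=
| add_assoc V (a b c : term V N) : RCA0w (a ⊕ (b ⊕ c) == a ⊕ b ⊕ c)
| add_comm V (a b : term V N) : RCA0w (a ⊕ b == b ⊕ a)
| add_zero V (a : term V N) : RCA0w (a ⊕ Zero == a)
| mul_assoc V (a b c : term V N) : RCA0w (a ⊗ (b ⊗ c) == a ⊗ b ⊗ c)
| mul_comm V (a b : term V N) : RCA0w (a ⊗ b == b ⊗ a)
| mul_one V (a : term V N) : RCA0w (a ⊗ One == a)
| mul_zero V (a : term V N) : RCA0w (a ⊗ Zero == Zero)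
| mul_add V (a b c : term V N) : RCA0w (a ⊗ (b ⊕ c) == a ⊗ b ⊕ a ⊗ c)
| lt_irrefl V (a : term V N) : RCA0w (¬ a ≺ a)
| lt_trans V (a b c : term V N) : RCA0w (a ≺ b ⇒ b ≺ c ⇒ a ≺ c)
| lt_total V (a b : term V N) : RCA0w (a ≺ b ∨ a == b ∨ b ≺ a)
| lt_add V (a b c : term V N) : RCA0w (a ≺ b ⇒ a ⊕ c ≺ b ⊕ c)
| lt_mul V (a b c : term V N) : RCA0w (Zero ≺ c ⇒ a ≺ b ⇒ a ⊗ c ≺ b ⊗ c)
| lt_zero_one V : RCA0w (V := V) (Zero ≺ One)
| K_ax V s t (x : term V s) (y : term V t) : RCA0w (eqt (Kc @ x @ y) x)
| S_ax V r s t (x : term V (r ~> s ~> t)) (y : term V (r ~> s)) (z : term V r) :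
    RCA0w (eqt (Sc @ x @ y @ z) (x @ z @ (y @ z)))
| R_zero V (f : term V (N ~> N ~> N)) (m : term V N) :
    RCA0w (Rc @ f @ m @ Zero == m)
| R_succ V (f : term V (N ~> N ~> N)) (m n : term V N) :
    RCA0w (Rc @ f @ m @ (n ⊕ One) == f @ n @ (Rc @ f @ m @ n))
| Extensionality V s t (x y : term V s) (f : term V (s ~> t)) :
    RCA0w (eqt x y ⇒ eqt (f @ x) (f @ y))
| QF_IND V (A : form (ext V N)) :
    quantifier_free A = true ->
    RCA0w (inst Zero A
           ∧ (∀ N, A ⇒ fsub (scons (v0 ⊕ One) wk1) A)
           ⇒ ∀ N, A)
| QF_AC10 V (A : form (ext (ext V ty1) N)) :
    quantifier_free A = true ->
    RCA0w ((∀ ty1, ∃ N, A)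
           ⇒ ∃ ty2, ∀ ty1,
             fsub (scons (v1 @ v0) (scons v0 (fun _ x => Var (old (old x))))) A).

(** Bracket abstraction: [lam a] is the combinator term for [λx. a], where [x]
    is the variable [new]. *)
Fixpoint lam {V s t} (a : term (ext V s) t) : term V (s ~> t) :=
  match a in term _ t' return term V (s ~> t') with
  | Var x =>
      match x in ext _ _ t' return term V (s ~> t') with
      | new => Sc @ Kc @ Kc (t := s)
      | old y => Kc @ Var y
      end
  | App a b => Sc @ lam a @ lam b
  | Zero => Kc @ Zero
  | One => Kc @ One
  | Plus => Kc @ Plus
  | Times => Kc @ Times
  | Kc => Kc @ Kc
  | Sc => Kc @ Sc
  | Rc => Kc @ Rc
  end.

Definition two {V} : term V N := One ⊕ One.

Definition pred {V} (n : term V N) : term V N := Rc @ lam (lam v1) @ Zero @ n.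

Definition monus {V} (m n : term V N) : term V N :=
  Rc @ lam (lam (pred v0)) @ m @ n.
Notation "m ⊖ n" := (monus m n) (at level 50, left associativity) : ho_scope.

Definition pow2 {V} (n : term V N) : term V N :=
  Rc @ lam (lam (v0 ⊕ v0)) @ One @ n.

(** Integer square root: [sqrt (n+1)] is [sqrt n + 1] if
    [(sqrt n + 1)^2 <= n+1], and [sqrt n] otherwise. *)
Definition sqrt {V} (n : term V N) : term V N :=
  Rc @ lam (lam (v0 ⊕ (One ⊖ ((v0 ⊕ One) ⊗ (v0 ⊕ One) ⊖ (v1 ⊕ One))))) @ Zero @ n.

(** The pairing [(m+n)^2 + m], with total projections. *)
Definition pair {V} (m n : term V N) : term V N := (m ⊕ n) ⊗ (m ⊕ n) ⊕ m.
Definition fst {V} (q : term V N) : term V N := q ⊖ sqrt q ⊗ sqrt q.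
Definition snd {V} (q : term V N) : term V N := sqrt q ⊖ fst q.

Definition leN {V} (a b : term V N) : form V := a ≺ b ∨ a == b.
Notation "a ≼ b" := (leN a b) (at level 70, no associativity) : ho_scope.

(** Every number [q] codes the rational [(qpos q - qneg q) / qden q]. *)
Definition qpos {V} (q : term V N) : term V N := fst q.
Definition qneg {V} (q : term V N) : term V N := fst (snd q).
Definition qden {V} (q : term V N) : term V N := snd (snd q) ⊕ One.

(** Over the common denominator [qcden q r], the numerator of [max (q - r) 0]
    is [qdiff q r] and that of [|q - r|] is [qabs q r]. *)
Definition qcden {V} (q r : term V N) : term V N := qden q ⊗ qden r.
Definition qdiff {V} (q r : term V N) : term V N :=
  (qpos q ⊗ qden r ⊕ qneg r ⊗ qden q) ⊖ (qneg q ⊗ qden r ⊕ qpos r ⊗ qden q).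
Definition qabs {V} (q r : term V N) : term V N := qdiff q r ⊕ qdiff r q.
Definition qdist {V} (q r : term V N) : term V N :=
  pair (qabs q r) (pair Zero (pred (qcden q r))).

(** |x_n - x_(n+i)| < 2^-n for all n, i *)
Definition is_real {V} (x : term V ty1) : form V :=
  ∀ N, ∀ N,
    let xn := x↑↑ @ v1 in
    let xni := x↑↑ @ (v1 ⊕ v0) in
    qabs xn xni ⊗ pow2 v1 ≺ qcden xn xni.

(** |x_n - y_n| <= 2^(-n+1) for all n *)
Definition eqR {V} (x y : term V ty1) : form V :=
  ∀ N,
    let xn := x↑ @ v0 in
    let yn := y↑ @ v0 in
    qabs xn yn ⊗ pow2 v0 ≼ two ⊗ qcden xn yn.
Notation "x =R y" := (eqR x y) (at level 70, no associativity) : ho_scope.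

(** y_n - x_n > 2^(-n+1) for some n *)
Definition ltR {V} (x y : term V ty1) : form V :=
  ∃ N,
    let xn := x↑ @ v0 in
    let yn := y↑ @ v0 in
    two ⊗ qcden yn xn ≺ qdiff yn xn ⊗ pow2 v0.
Notation "x <R y" := (ltR x y) (at level 70, no associativity) : ho_scope.

Definition leR {V} (x y : term V ty1) : form V := ¬ y <R x.
Notation "x ≤R y" := (leR x y) (at level 70, no associativity) : ho_scope.

Definition zeroR {V} : term V ty1 := Kc @ Zero.
Definition oneR {V} : term V ty1 := Kc @ pair One (pair Zero Zero).

(** |x - y|, with the index shifted so that it is again fast converging *)
Definition distR {V} (x y : term V ty1) : term V ty1 :=
  lam (qdist (x↑ @ (v0 ⊕ One)) (y↑ @ (v0 ⊕ One))).

Definition in_unit {V} (x : term V ty1) : form V :=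
  is_real x ∧ zeroR ≤R x ∧ x ≤R oneR.

(** Functions on the reals are functionals respecting [=R]. *)
Definition is_fun_R_R {V} (F : term V ty11) : form V :=
  (∀ ty1, is_real v0 ⇒ is_real (F↑ @ v0))
  ∧ (∀ ty1, ∀ ty1, is_real v1 ∧ is_real v0 ∧ v1 =R v0
       ⇒ F↑↑ @ v1 =R F↑↑ @ v0).

Definition is_fun_R_N {V} (Y : term V ty2) : form V :=
  ∀ ty1, ∀ ty1, is_real v1 ∧ is_real v0 ∧ v1 =R v0
    ⇒ Y↑↑ @ v1 == Y↑↑ @ v0.

Definition is_fun_unit_N {V} (Y : term V ty2) : form V :=
  ∀ ty1, ∀ ty1, in_unit v1 ∧ in_unit v0 ∧ v1 =R v0
    ⇒ Y↑↑ @ v1 == Y↑↑ @ v0.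

(** A set of reals is any function [A] from reals to reals. *)
Definition is_set {V} (A : term V ty11) : form V := is_fun_R_R A.

Definition mem {V} (x : term V ty1) (A : term V ty11) : form V :=
  is_real x ∧ zeroR <R A @ x.
Notation "x ∈ A" := (mem x A) (at level 70, no associativity) : ho_scope.

(** [P] is a property of [v0]; openness is needed for complements, which need
    not have a characteristic function. *)
Definition is_open {V} (P : form (ext V ty1)) : form V :=
  ∀ ty1, is_real v0 ∧ P ⇒
    ∃ ty1, is_real v0 ∧ zeroR <R v0
      ∧ (∀ ty1, is_real v0 ∧ distR v2 v0 <R v1
           ⇒ fsub (scons v0 (fun _ x => Var (old (old (old x))))) P).

Definition closed {V} (A : term V ty11) : form V := is_open (¬ v0 ∈ A↑).

Definition limit_point {V} (x : term V ty1) (A : term V ty11) : form V :=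
  ∀ ty1, is_real v0 ∧ zeroR <R v0 ⇒
    ∃ ty1, v0 ∈ A↑↑ ∧ ¬ v0 =R x↑↑ ∧ distR x↑↑ v0 <R v1.

Definition perfect {V} (A : term V ty11) : form V :=
  closed A ∧ (∀ ty1, v0 ∈ A↑ ⇒ limit_point v0 A↑).

Definition inhabited {V} (A : term V ty11) : form V := ∃ ty1, v0 ∈ A↑.

Definition injective_on {V} (Y : term V ty2) (A : term V ty11) : form V :=
  ∀ ty1, ∀ ty1, v1 ∈ A↑↑ ∧ v0 ∈ A↑↑ ⇒
    Y↑↑ @ v1 == Y↑↑ @ v0 ⇒ v1 =R v0.

Definition surjective_on {V} (Y : term V ty2) (A : term V ty11) : form V :=
  ∀ N, ∃ ty1, v0 ∈ A↑↑ ∧ Y↑↑ @ v0 == v1.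

Definition countable {V} (A : term V ty11) : form V :=
  ∃ ty2, is_fun_R_N v0 ∧ injective_on v0 A↑.

Definition strongly_countable {V} (A : term V ty11) : form V :=
  ∃ ty2, is_fun_R_N v0 ∧ injective_on v0 A↑ ∧ surjective_on v0 A↑.

Definition collision {V} (Y : term V ty2) : form V :=
  ∃ ty1, ∃ ty1, in_unit v1 ∧ in_unit v0
    ∧ ¬ v1 =R v0 ∧ Y↑↑ @ v1 == Y↑↑ @ v0.

Definition NIN : form no_vars := ∀ ty2, is_fun_unit_N v0 ⇒ collision v0.

Definition NBI : form no_vars :=
  ∀ ty2, is_fun_unit_N v0 ⇒
    collision v0 ∨ (∃ N, ∀ ty1, in_unit v0 ⇒ ¬ v2 @ v0 == v1).

Definition avoids_point (C : forall V, term V ty11 -> form V) : form no_vars :=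
  ∀ ty11, is_set v0 ∧ C _ v0 ⇒
    ∃ ty1, in_unit v0 ∧ (∀ ty1, v0 ∈ v2 ⇒ ¬ v1 =R v0).

Definition not_perfect (C : forall V, term V ty11 -> form V) : form no_vars :=
  ∀ ty11, is_set v0 ∧ (∀ ty1, v0 ∈ v1 ⇒ in_unit v0) ∧ C _ v0 ⇒ ¬ perfect v0.

(** The empty set is countable and, with the above definition, perfect; so
    [not_perfect (@countable)] is refutable.  This is its restriction to
    inhabited sets; strongly countable sets are always inhabited. *)
Definition not_perfect_inh (C : forall V, term V ty11 -> form V) : form no_vars :=
  ∀ ty11, is_set v0 ∧ inhabited v0
    ∧ (∀ ty1, v0 ∈ v1 ⇒ in_unit v0) ∧ C _ v0 ⇒ ¬ perfect v0.

(* Main.v *)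
From HB Require Import structures.
From mathcomp Require Import all_boot all_order all_algebra boolp.
From mathcomp Require Import ring lra.
From Stdlib Require List Eqdep_dec.
Require Import Defs.

Set Implicit Arguments.
Unset Strict Implicit.
Unset Printing Implicit Defensive.

Local Open Scope ho_scope.

(** Derivability is reduced to truth in all models by a Henkin completeness
    theorem. Quotienting the term model by pointwise equality makes models
    extensional, so that the combinators are governed by genuine equations and
    one can argue semantically inside a model, whose numbers embed into an ordered
    field of fractions.

    If Y is injective on [0,1], then "Y (clamp x) = Y 0" decides "x <= 0". This
    gives [0,1] a characteristic function; it is a perfect set, made countable by
    x |-> Y (clamp x), and strongly countable if Y is onto. Hence everything except
    "NBI implies (A')".

    For the latter, let Y biject a set A containing [0,1] with the numbers. A
    Hilbert hotel gives a bijection of [0,1] with A: every piece (2^k, 2^(k+1)]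
    and its mirror image under b |-> 1 - b, which together cover the complement of
    [0,1], gets infinitely many scaled copies among the intervals (2^-(m+1), 2^-m].
    The copies of points of A are shifted by one level, the copy of level 0 going
    to the point itself, and all other points of [0,1] stay fixed. The index m of
    a real is found by QF-AC^{1,0}, since Y makes the relevant order relations and
    membership in A quantifier-free. *)

(** * Substitution, derivations, and a coding of formulas *)

(** If (A') fails for [A], the given [Y] is onto the numbers on [A], but on [0,1] it is only known
    to be injective, so NBI cannot be applied to it; a bijection of [0,1] with the numbers has to be
    produced. Cantor-Bernstein would iterate an injection of [A] into [0,1], but the recursor of the
    base theory works at type 0 only and cannot iterate maps of reals. The hotel avoids iteration: a
    single number m codes both level and piece, each copy is a rational affine image of its original
    with coefficients computed from m, and changing the level is multiplication by a power of two.
    What remains is a definition by finitely many cases, and composing with [Y] makes its values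
    numbers, so that the cases can be merged arithmetically. Reasoning inside a model is classical,
    but existence is not free there: induction is limited to quantifier-free formulas with
    parameters, and each functional must be exhibited as an element of the model. Order relations
    between reals become usable in an induction or a definition only once the injection decides
    them. *)

Definition scomp {U V W} (g : sub V W) (f : sub U V) : sub U W :=
  fun s x => tsub g (f s x).

Lemma sub_eq V W (f g : sub V W) : (forall s x, f s x = g s x) -> f = g.
Proof. by move=> h; apply: functional_extensionality_dep => s; apply/funext/h. Qed.

Lemma tsub_tsub U V W (f : sub U V) (g : sub V W) t (a : term U t) :
  tsub g (tsub f a) = tsub (scomp g f) a.
Proof. by elim: a => //= s u a -> b ->. Qed.

Lemma tsub_ids V t (a : term V t) : tsub ids a = a.
Proof. by elim: a => //= s u a -> b ->. Qed.

Ltac sub_ext := apply: sub_eq => ? [|? ?]; rewrite /scomp /lift /twk /= ?tsub_tsub ?tsub_ids //.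

Lemma lift_scomp U V W s (f : sub U V) (g : sub V W) :
  scomp (lift g) (@lift _ _ s f) = lift (scomp g f).
Proof. by sub_ext. Qed.

Lemma lift_ids V s : @lift V V s ids = ids.
Proof. by sub_ext. Qed.

Lemma fsub_fsub U (p : form U) V W (f : sub U V) (g : sub V W) :
  fsub g (fsub f p) = fsub (scomp g f) p.
Proof.
elim: p V W f g => //=.
- by move=> *; rewrite !tsub_tsub.
- by move=> *; rewrite !tsub_tsub.
- by move=> ? p IHp q IHq *; rewrite IHp IHq.
- by move=> ? p IHp q IHq *; rewrite IHp IHq.
- by move=> ? p IHp q IHq *; rewrite IHp IHq.
- by move=> ? s p IHp *; rewrite IHp lift_scomp.
- by move=> ? s p IHp *; rewrite IHp lift_scomp.
Qed.

Lemma fsub_ids V (p : form V) : fsub ids p = p.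
Proof.
elim: p => //=.
- by move=> *; rewrite !tsub_ids.
- by move=> *; rewrite !tsub_ids.
- by move=> ? p -> q ->.
- by move=> ? p -> q ->.
- by move=> ? p -> q ->.
- by move=> ? s p IH; rewrite lift_ids IH.
- by move=> ? s p IH; rewrite lift_ids IH.
Qed.

Lemma tsub_lift_wk V W s (f : sub V W) t (a : term V t) :
  tsub (@lift V W s f) (a↑) = (tsub f a)↑.
Proof. by rewrite /twk !tsub_tsub. Qed.

Lemma fsub_lift_wk V W s (f : sub V W) (p : form V) :
  fsub (@lift V W s f) (fwk p) = fwk (fsub f p).
Proof. by rewrite /fwk !fsub_fsub. Qed.

Lemma tsub_scons_wk V W s (a : term W s) (f : sub V W) t (b : term V t) :
  tsub (scons a f) (b↑) = tsub f b.
Proof. by rewrite /twk tsub_tsub. Qed.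

Lemma inst_fsub_lift V W s (f : sub V W) (a : term W s) (p : form (ext V s)) :
  inst a (fsub (lift f) p) = fsub (scons a f) p.
Proof. by rewrite /inst fsub_fsub; congr fsub; sub_ext. Qed.

Lemma fsub_inst V W s (f : sub V W) (a : term V s) (p : form (ext V s)) :
  fsub f (inst a p) = inst (tsub f a) (fsub (lift f) p).
Proof. by rewrite inst_fsub_lift /inst fsub_fsub; congr fsub; sub_ext. Qed.

Lemma fsub_eqt V W (f : sub V W) s (a b : term V s) :
  fsub f (eqt a b) = eqt (tsub f a) (tsub f b).
Proof.
elim: s V W f a b => //= s _ t IHt V W f a b.
by rewrite IHt /= !tsub_lift_wk.
Qed.

Lemma quantifier_free_fsub V (p : form V) W (f : sub V W) :
  quantifier_free (fsub f p) = quantifier_free p.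
Proof. by elim: p W f => //= ? p IHp q IHq W f; rewrite IHp IHq. Qed.

Lemma RCA0w_fsub V W (f : sub V W) (p : form V) : RCA0w p -> RCA0w (fsub f p).
Proof.
move=> h; case: h f; try by (intros; constructor).
- by move=> *; rewrite fsub_eqt; constructor.
- by move=> *; rewrite fsub_eqt; constructor.
- by move=> ? s t x y F f /=; rewrite !fsub_eqt; apply: Extensionality.
- move=> U A qA f /=; rewrite fsub_inst.
  have := @QF_IND W (fsub (lift f) A); rewrite quantifier_free_fsub => /(_ qA).
  by congr (RCA0w (And _ (All _ (Imp _ _)) ⇒ _)); rewrite !fsub_fsub; congr fsub; sub_ext.
- move=> U A qA f /=.
  have := @QF_AC10 W (fsub (lift (lift f)) A); rewrite quantifier_free_fsub => /(_ qA).
  congr (RCA0w (_ ⇒ Ex _ (All _ _))); rewrite !fsub_fsub; congr fsub.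
  apply: sub_eq => ? [|? [|? x]] //=; rewrite /scomp /= ?tsub_tsub //.
Qed.

Lemma map_fwk V W s (f : sub V W) (G : list (form V)) :
  List.map (fsub (@lift _ _ s f)) (List.map fwk G) = List.map fwk (List.map (fsub f) G).
Proof. by rewrite !List.map_map; apply: List.map_ext => p; apply: fsub_lift_wk. Qed.

Lemma prf_fsub V (G : list (form V)) p : prf RCA0w G p ->
  forall W (f : sub V W), prf RCA0w (List.map (fsub f) G) (fsub f p).
Proof.
elim=> {V G p} /=.
- by move=> V G p /RCA0w_fsub ax W f; apply: Ax.
- by move=> V G p h W f; apply/Hyp/List.in_map.
- by move=> V G p q _ IH W f; apply: ImpI; apply: IH.
- by move=> V G p q _ IH1 _ IH2 W f; apply: ImpE (IH1 _ _) (IH2 _ _).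
- by move=> V G p q _ IH1 _ IH2 W f; apply: AndI (IH1 _ _) (IH2 _ _).
- by move=> V G p q _ IH W f; apply: AndE1 (IH _ _).
- by move=> V G p q _ IH W f; apply: AndE2 (IH _ _).
- by move=> V G p q _ IH W f; apply: OrI1 (IH _ _).
- by move=> V G p q _ IH W f; apply: OrI2 (IH _ _).
- by move=> V G p q r _ IH1 _ IH2 _ IH3 W f; apply: OrE (IH1 _ _) (IH2 _ _) (IH3 _ _).
- by move=> V G p _ IH W f; apply: RAA (IH _ _).
- move=> V G s p _ IH W f; apply: AllI; rewrite -map_fwk; exact: IH.
- by move=> V G s p a _ IH W f; rewrite fsub_inst; apply: AllE (IH _ _).
- move=> V G s p a _ IH W f; apply: (ExI (a := tsub f a)).
  by rewrite -fsub_inst; apply: IH.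
- move=> V G s p q _ IH1 _ IH2 W f; apply: ExE (IH1 _ _) _.
  by rewrite -map_fwk -fsub_lift_wk; apply: IH2.
- by move=> V G a W f; apply: EqRefl.
- move=> V G p a b _ IH1 _ IH2 W f; rewrite fsub_inst.
  by apply: EqSubst (IH1 _ _) _; rewrite -fsub_inst; apply: IH2.
Qed.

Lemma prf_weaken V (G : list (form V)) p : prf RCA0w G p ->
  forall H, List.incl G H -> prf RCA0w H p.
Proof.
have incl_cons W (q : form W) K H : List.incl K H -> List.incl (q :: K) (q :: H).
  by move=> i r /= [->|/i]; [left|right].
elim=> {V G p} /=.
- by move=> V G p h H _; apply: Ax.
- by move=> V G p h H i; apply/Hyp/i.
- by move=> V G p q _ IH H i; apply/ImpI/IH/incl_cons.
- by move=> V G p q _ IH1 _ IH2 H i; apply: ImpE (IH1 _ i) (IH2 _ i).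
- by move=> V G p q _ IH1 _ IH2 H i; apply: AndI (IH1 _ i) (IH2 _ i).
- by move=> V G p q _ IH H i; apply: AndE1 (IH _ i).
- by move=> V G p q _ IH H i; apply: AndE2 (IH _ i).
- by move=> V G p q _ IH H i; apply: OrI1 (IH _ i).
- by move=> V G p q _ IH H i; apply: OrI2 (IH _ i).
- move=> V G p q r _ IH1 _ IH2 _ IH3 H i.
  by apply: OrE (IH1 _ i) (IH2 _ _) (IH3 _ _); apply: incl_cons.
- by move=> V G p _ IH H i; apply/RAA/IH/incl_cons.
- by move=> V G s p _ IH H i; apply/AllI/IH/List.incl_map.
- by move=> V G s p a _ IH H i; apply: AllE (IH _ i).
- by move=> V G s p a _ IH H i; apply: ExI (IH _ i).
- move=> V G s p q _ IH1 _ IH2 H i; apply: ExE (IH1 _ i) (IH2 _ _).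
  exact/incl_cons/List.incl_map.
- by move=> V G a H i; apply: EqRefl.
- by move=> V G p a b _ IH1 _ IH2 H i; apply: EqSubst (IH1 _ i) (IH2 _ i).
Qed.

(** * Coding types, terms and formulas by numbers *)

Definition tyenc : ty -> GenTree.tree nat :=
  fix enc s := match s with
  | N => GenTree.Leaf 0
  | s ~> t => GenTree.Node 0 [:: enc s; enc t]
  end.

Lemma tyenc_inj : injective tyenc.
Proof. by elim=> [|s IHs t IHt] [|s' t'] //= [/IHs -> /IHt ->]. Qed.

Definition venc (V : ctx) := forall s, V s -> GenTree.tree nat.

(** Codes must determine the type along with the term: in the induction for [tenc_inj] the two sides
    have types not yet known to agree. *)
Definition venc_inj V (c : venc V) :=
  forall s x t y, c s x = c t y -> existT V s x = existT V t y.

Definition ext_venc V (c : venc V) s : venc (ext V s) := fun t x =>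
  match x with
  | new => GenTree.Leaf 0
  | old _ y => GenTree.Node 0 [:: c _ y]
  end.

Lemma ext_venc_inj V (c : venc V) s : venc_inj c -> venc_inj (ext_venc c (s:=s)).
Proof.
move=> ci t [|{}t x] u [|{}u y] //= [/ci e].
by have /= := f_equal (fun z : sigT V => existT (ext V s) _ (old (projT2 z))) e.
Qed.

(** Applications carry no code of the argument type, since the function part already determines
    it. *)
Fixpoint tenc V (c : venc V) t (a : term V t) : GenTree.tree nat :=
  match a with
  | Var _ x => GenTree.Node 0 [:: c _ x]
  | App _ _ a b => GenTree.Node 1 [:: tenc c a; tenc c b]
  | Zero => GenTree.Node 2 [::]
  | One => GenTree.Node 3 [::]
  | Plus => GenTree.Node 4 [::]
  | Times => GenTree.Node 5 [::]
  | Kc s t => GenTree.Node 6 [:: tyenc s; tyenc t]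
  | Sc r s t => GenTree.Node 7 [:: tyenc r; tyenc s; tyenc t]
  | Rc => GenTree.Node 8 [::]
  end.

Lemma existT_inj (T : ty -> Set) s (x y : T s) : existT T s x = existT T s y -> x = y.
Proof.
apply: Eqdep_dec.inj_pair2_eq_dec => s' t'.
by case: (pselect (s' = t')); [left|right].
Qed.

Lemma tenc_inj V (c : venc V) : venc_inj c ->
  forall s (a : term V s) t (b : term V t),
  tenc c a = tenc c b -> existT (term V) s a = existT (term V) t b.
Proof.
move=> ci s; elim=> {s} [s x|s t a IHa b IHb| | | | |s t|r s t|].
all: move=> ? [s' x'|s' t' a' b'| | | | |s' t'|r' s' t'|] //=.
- by case=> /ci e; have /= := f_equal (fun z : sigT V => existT (term V) _ (Var (projT2 z))) e.
- case=> /IHa ea /IHb eb; have [es et] : s ~> t = s' ~> t' := f_equal (@projT1 _ _) ea.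
  by move: ea eb; rewrite -{}es -{}et in a' b' * => /(@existT_inj (term V)) -> /(@existT_inj (term V)) ->.
- by case=> /tyenc_inj <- /tyenc_inj <-.
- by case=> /tyenc_inj <- /tyenc_inj <- /tyenc_inj <-.
Qed.

Fixpoint fenc V (c : venc V) (p : form V) : GenTree.tree nat :=
  match p with
  | Eq a b => GenTree.Node 0 [:: tenc c a; tenc c b]
  | Lt a b => GenTree.Node 1 [:: tenc c a; tenc c b]
  | Bot => GenTree.Node 2 [::]
  | Imp p q => GenTree.Node 3 [:: fenc c p; fenc c q]
  | And p q => GenTree.Node 4 [:: fenc c p; fenc c q]
  | Or p q => GenTree.Node 5 [:: fenc c p; fenc c q]
  | All s p => GenTree.Node 6 [:: tyenc s; fenc (ext_venc c (s:=s)) p]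
  | Ex s p => GenTree.Node 7 [:: tyenc s; fenc (ext_venc c (s:=s)) p]
  end.

Lemma fenc_inj V (p q : form V) (c : venc V) : venc_inj c -> fenc c p = fenc c q -> p = q.
Proof.
move=> ci; elim: p q c ci => {V} [V a b|V a b|V|V p IHp p' IHp'|V p IHp p' IHp'|V p IHp p' IHp'|V s p IHp|V s p IHp].
all: case=> [a1 b1|a1 b1| |q q'|q q'|q q'|t q|t q] //= c ci.
- by case=> /(tenc_inj ci)/(@existT_inj (term V)) -> /(tenc_inj ci)/(@existT_inj (term V)) ->.
- by case=> /(tenc_inj ci)/(@existT_inj (term V)) -> /(tenc_inj ci)/(@existT_inj (term V)) ->.
- by case=> /(IHp _ _ ci) -> /(IHp' _ _ ci) ->.
- by case=> /(IHp _ _ ci) -> /(IHp' _ _ ci) ->.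
- by case=> /(IHp _ _ ci) -> /(IHp' _ _ ci) ->.
- by case=> /tyenc_inj est; rewrite -{}est in q * => /(IHp _ _ (ext_venc_inj (s:=s) ci)) ->.
- by case=> /tyenc_inj est; rewrite -{}est in q * => /(IHp _ _ (ext_venc_inj (s:=s) ci)) ->.
Qed.

(** Infinitely many variables of every type leave room for a witness at each stage, while the
    formulas stay countable. *)
Definition nat_vars : ctx := fun _ => nat.

Definition nat_venc : venc nat_vars := fun s x => GenTree.Node x [:: tyenc s].

Lemma nat_venc_inj : venc_inj nat_venc.
Proof. by move=> s x t y [-> /tyenc_inj ->]. Qed.

Definition fcode (p : form nat_vars) : nat := pickle (fenc nat_venc p).

Lemma fcode_inj : injective fcode.
Proof. by move=> p q /(pcan_inj pickleK)/(fenc_inj nat_venc_inj). Qed.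

(** * Henkin completeness *)

Lemma tsub_local (V : ctx) (lv : forall s, V s -> nat) t (a : term V t) :
  exists n, forall W (f g : sub V W),
    (forall s x, lv s x < n -> f s x = g s x) -> tsub f a = tsub g a.
Proof.
elim: a => [s x|s u a [n IHa] b [m IHb]| | | | | | | ]; try by exists 0.
  by exists (lv s x).+1 => W f g h /=; apply: h.
exists (maxn n m) => W f g h /=.
by rewrite (IHa _ f g) 1?(IHb _ f g) // => u' x lx; apply: h; rewrite leq_max lx ?orbT.
Qed.

(** A formula has finitely many free variables; [lv] ranks the variables so that this becomes a
    bound on the rank. Below a binder the new variable may get any rank, because lifted
    substitutions agree on it. *)
Lemma fsub_local V (p : form V) (lv : forall s, V s -> nat) :
  exists n, forall W (f g : sub V W),
    (forall s x, lv s x < n -> f s x = g s x) -> fsub f p = fsub g p.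
Proof.
have bin (A B C : Type) (a a' : A) (b b' : B) (c : A -> B -> C) :
  a = a' -> b = b' -> c a b = c a' b' by move=> -> ->.
elim: p lv => {V} [V a b|V a b|V|V p IHp q IHq|V p IHp q IHq|V p IHp q IHq|V s p IHp|V s p IHp] lv.
1,2: have [[n ha] [m hb]] := (tsub_local lv a, tsub_local lv b).
4,5,6: have [[n ha] [m hb]] := (IHp lv, IHq lv).
1,2,4,5,6: exists (maxn n m) => W f g h /=; apply: bin;
  [apply: ha|apply: hb] => u x lx; apply: h; by rewrite leq_max lx ?orbT.
- by exists 0.
all: have [n h] := IHp (fun t x => match x with new => 0 | old _ y => lv _ y end).
all: exists n => W f g hfg /=; congr (_ _ _); apply: h => t [|{}t x] //= lx.
all: by rewrite hfg.
Qed.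

(** A substitute for saying that the free variables of [p] have index below [n], which spares a
    notion of occurrence. *)
Definition bounds n (p : form nat_vars) : Prop :=
  forall W (f g : sub nat_vars W), (forall s x, x < n -> f s x = g s x) -> fsub f p = fsub g p.

Lemma bounds_ex p : exists n, bounds n p.
Proof. exact: (fsub_local p (fun s x => x)). Qed.

Lemma bounds_le m n p : m <= n -> bounds m p -> bounds n p.
Proof. by move=> mn b W f g h; apply: b => s x xm; apply: h; apply: leq_trans mn. Qed.

Lemma bounds_list G : exists n, forall p, List.In p G -> bounds n p.
Proof.
elim: G => [|p G [n IH]]; first by exists 0.
have [m hm] := bounds_ex p.
exists (maxn m n) => q /= [<-|/IH].
  exact: bounds_le (leq_maxl m n) hm.
exact: bounds_le (leq_maxr m n).
Qed.

Definition consistent V (G : list (form V)) : Prop := ~ prf RCA0w G Bot.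

(** Turns the variable [n] of type [s] into the eigenvariable of [ExE]; variables of index [n] at
    other types are only weakened. *)
Definition to_new n s : sub nat_vars (ext nat_vars s) := fun t x =>
  if x == n then
    match pselect (s = t) with
    | left e => match e in _ = t return term _ t with erefl => Var new end
    | right _ => Var (old (x : nat_vars t))
    end
  else Var (old (x : nat_vars t)).

Lemma to_new_eq n s : to_new n s (n : nat_vars s) = Var new.
Proof.
rewrite /to_new eqxx; case: pselect => // e.
by rewrite (Prop_irrelevance e erefl).
Qed.

Lemma to_new_lt n s t x : x < n -> to_new n s (x : nat_vars t) = Var (old (x : nat_vars t)).
Proof. by move=> h; rewrite /to_new ltn_eqF. Qed.

Lemma fsub_to_new n s p : bounds n p -> fsub (to_new n s) p = fwk p.
Proof. by apply=> t x; apply: to_new_lt. Qed.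

(** Renaming the fresh variable [n] to [new] turns a refutation of the instance into the side
    derivation of [ExE]. *)
Lemma henkin n s (p : form (ext nat_vars s)) G :
  (forall q, List.In q G -> bounds n q) -> bounds n (∃ s, p) ->
  prf RCA0w G (∃ s, p) -> consistent G -> consistent (inst (Var (n : nat_vars s)) p :: G).
Proof.
move=> bG bp hp cG hB; apply: cG; apply: (ExE hp).
have /= := prf_fsub hB (to_new n s).
have -> : List.map (fsub (to_new n s)) G = List.map fwk G.
  by apply: List.map_ext_in => q /bG; apply: fsub_to_new.
suff -> : fsub (to_new n s) (inst (Var (n : nat_vars s)) p) = p by [].
(* [bp] concerns the quantified formula; removing the quantifier shows that under the binder the
   renaming acts on [p] like weakening. *)
have /= := fsub_to_new s bp; rewrite /fwk /= => -[] /(@existT_inj (fun u => form (ext (ext nat_vars s) u))) e.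
rewrite fsub_inst /= to_new_eq e inst_fsub_lift -[RHS]fsub_ids; congr fsub.
by sub_ext.
Qed.

(** Deciding [p] and naming a witness happen in one stage, so a single enumeration of all formulas
    yields a set that is both complete and Henkin. *)
Lemma consistent_step (G : list (form nat_vars)) p : consistent G ->
  exists H, [/\ consistent H, List.incl G H,
    List.In p H \/ ~ consistent (p :: G) &
    forall s q, p = (∃ s, q) -> List.In p H -> exists x : nat_vars s, List.In (inst (Var x) q) H].
Proof.
move=> cG; case: (pselect (consistent (p :: G))) => [cp|ncp]; last first.
  exists G; split => //; first by right.
  move=> s q _ pG; case: ncp => h; apply: cG; apply: (prf_weaken h) => r /= [<-|] //.
have pG : List.incl G (p :: G) by move=> r; right.
case: (pselect (exists s q, p = (∃ s, q))) => [[s [q pq]]|nex]; last first.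
  exists (p :: G); split => //; first by left; left.
  by move=> s q pq; case: nex; exists s, q.
have [n hn] := bounds_list (p :: G).
exists (inst (Var (n : nat_vars s)) q :: p :: G); split.
- apply: henkin => //; rewrite -pq; first by apply: hn; left.
  by apply: Hyp; left.
- by move=> r rG; right; right.
- by left; right; left.
- move=> s' q'; rewrite pq => -[ss]; move: q'; rewrite -{}ss => q' /(@existT_inj (fun u => form (ext nat_vars u))) <- _.
  by exists n; left.
Qed.

Section Lindenbaum.
Variables (G0 : list (form nat_vars)) (cG0 : consistent G0).

Let cset := {G : list (form nat_vars) | consistent G}.

Let next (G : cset) p : cset :=
  let h := cid (@consistent_step (sval G) p (svalP G)) in
  exist _ (sval h) (let: And4 c _ _ _ := svalP h in c).

(** [Bot] fills the numbers that code no formula; a stage preserves consistency whatever formula it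
    treats. *)
Let dec n : form nat_vars :=
  match pselect (exists p, fcode p = n) with left h => sval (cid h) | right _ => Bot end.

Let dec_code p : dec (fcode p) = p.
Proof.
rewrite /dec; case: pselect => [h|[]]; last by exists p.
exact/fcode_inj/(svalP (cid h)).
Qed.

Fixpoint lind n : cset :=
  match n with 0 => exist _ G0 cG0 | n'.+1 => next (lind n') (dec n') end.

(** Derivability from a stage, instead of membership in one, makes closure under the rules
    immediate. *)
Definition Delta (p : form nat_vars) : Prop := exists n, prf RCA0w (sval (lind n)) p.

Let lind_le m n : m <= n -> List.incl (sval (lind m)) (sval (lind n)).
Proof.
move=> /subnK <-; elim: (n - m)%N => [|k IH] p //= /IH.
by rewrite /next /=; case: cid => /= H [_ i _ _]; apply: i.
Qed.

Let prf_le m n p : m <= n -> prf RCA0w (sval (lind m)) p -> prf RCA0w (sval (lind n)) p.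
Proof. by move=> mn h; apply: (prf_weaken h); apply: lind_le. Qed.

Let lind_step p :
  let G := sval (lind (fcode p)) in let H := sval (lind (fcode p).+1) in
  (List.In p H \/ ~ consistent (p :: G)) /\
  forall s q, p = (∃ s, q) -> List.In p H -> exists x : nat_vars s, List.In (inst (Var x) q) H.
Proof.
rewrite /= /next /= dec_code; case: cid => /= H [_ _ ? ?] //.
Qed.

Lemma Delta_prf p : prf RCA0w G0 p -> Delta p.
Proof. by exists 0. Qed.

Lemma Delta_bot : ~ Delta Bot.
Proof. by case=> n; apply: (svalP (lind n)). Qed.

Lemma Delta_map p q : (forall G, prf RCA0w G p -> prf RCA0w G q) -> Delta p -> Delta q.
Proof. by move=> h [n /h]; exists n. Qed.

Lemma Delta_map2 p q r : (forall G, prf RCA0w G p -> prf RCA0w G q -> prf RCA0w G r) ->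
  Delta p -> Delta q -> Delta r.
Proof.
move=> h [m hp] [n hq]; exists (maxn m n); apply: h.
  exact: prf_le (leq_maxl _ _) hp.
exact: prf_le (leq_maxr _ _) hq.
Qed.

Lemma Delta_mp p q : Delta (p ⇒ q) -> Delta p -> Delta q.
Proof. by apply: Delta_map2 => G; apply: ImpE. Qed.

Lemma Delta_neg p : Delta (¬ p) <-> ~ Delta p.
Proof.
split=> [h hp|h]; first exact: Delta_bot (Delta_mp h hp).
have [[pH|nc] _] := lind_step p.
  by case: h; exists (fcode p).+1; apply: Hyp.
exists (fcode p); apply: ImpI.
by case: (pselect (prf RCA0w (p :: sval (lind (fcode p))) Bot)).
Qed.

(** Witnesses are attached to members of a stage, so an existential formula that is merely derivable
    must be shown to have been accepted. *)
Lemma Delta_stage p : Delta p -> List.In p (sval (lind (fcode p).+1)).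
Proof.
move=> hp; have [[//|nc] _] := lind_step p; case: ((Delta_neg p).1 _ hp).
exists (fcode p); apply: ImpI.
by case: (pselect (prf RCA0w (p :: sval (lind (fcode p))) Bot)).
Qed.

Lemma Delta_imp p q : Delta (p ⇒ q) <-> (Delta p -> Delta q).
Proof.
split=> [|h]; first exact: Delta_mp.
case: (pselect (Delta p)) => [/h|/Delta_neg].
  apply: Delta_map => G hq; apply: ImpI; apply: (prf_weaken hq); exact: List.incl_tl (@List.incl_refl _ _).
apply: Delta_map => G np; apply/ImpI/RAA/(@ImpE _ _ _ p); last by apply: Hyp; right; left.
apply: (prf_weaken np); exact: List.incl_tl (List.incl_tl _ (@List.incl_refl _ _)).
Qed.

Lemma Delta_and p q : Delta (p ∧ q) <-> Delta p /\ Delta q.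
Proof.
split=> [h|[]]; last by apply: Delta_map2 => G; apply: AndI.
split; move: h; apply: Delta_map => G; [exact: AndE1|exact: AndE2].
Qed.

Lemma Delta_or p q : Delta (p ∨ q) <-> Delta p \/ Delta q.
Proof.
split=> [h|[]]; last 2 first.
- by apply: Delta_map => G; apply: OrI1.
- by apply: Delta_map => G; apply: OrI2.
case: (pselect (Delta p)) => [|np]; [by left|right].
move: np; rewrite -Delta_neg; apply: (Delta_map2 _ h) => G {}h np.
apply: (OrE h); last by apply: Hyp; left.
apply/RAA/(@ImpE _ _ _ p); last by apply: Hyp; right; left.
apply: (prf_weaken np); exact: List.incl_tl (List.incl_tl _ (@List.incl_refl _ _)).
Qed.

Lemma Delta_ex s (p : form (ext nat_vars s)) : Delta (∃ s, p) <-> exists a, Delta (inst a p).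
Proof.
split=> [h|[a]]; last by apply: Delta_map => G; apply: ExI.
have hs := Delta_stage h.
have [_ /(_ _ _ erefl hs) [x xH]] := lind_step (∃ s, p).
by exists (Var x), (fcode (∃ s, p)).+1; apply: Hyp.
Qed.

(** A counterexample is the Henkin witness of [∃ s, ¬ p], which follows classically from the negated
    universal formula. *)
Lemma Delta_all s (p : form (ext nat_vars s)) : Delta (∀ s, p) <-> forall a, Delta (inst a p).
Proof.
split=> [h a|h]; first by move: h; apply: Delta_map => G; apply: AllE.
apply: contrapT; rewrite -Delta_neg => np.
have : Delta (∃ s, ¬ p).
  move: np; apply: Delta_map => G np; apply: RAA; apply: (@ImpE _ _ _ (∀ s, p)).
    by apply: (prf_weaken np); apply: List.incl_tl (@List.incl_refl _ _).
  apply: AllI; apply: RAA; apply: (@ImpE _ _ _ (∃ s, fsub (lift wk1) (¬ p))).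
    by apply: Hyp; right; left.
  apply: (ExI (a := v0)); rewrite /inst /= !fsub_fsub.
  have -> : scomp (scons v0 ids) (lift wk1) = @ids (ext nat_vars s) by sub_ext.
  by rewrite fsub_ids; apply: Hyp; left.
by case/Delta_ex => a; rewrite /inst /= -/(inst a p) => /Delta_neg; apply.
Qed.

Lemma Delta_ax p : RCA0w p -> Delta p.
Proof. by move=> h; exists 0; apply: Ax. Qed.

Lemma Delta_refl a : Delta (a == a).
Proof. by exists 0; apply: EqRefl. Qed.

Lemma Delta_eqsubst (p : form (ext nat_vars N)) a b :
  Delta (a == b) -> Delta (inst a p) -> Delta (inst b p).
Proof. by apply: Delta_map2 => G; apply: EqSubst. Qed.

End Lindenbaum.

Lemma sval_inj (T : Type) (P : T -> Prop) (a b : {x : T | P x}) : sval a = sval b -> a = b.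
Proof.
case: a b => [a pa] [b pb] /= e; rewrite -{}e in pb *.
by rewrite (Prop_irrelevance pa pb).
Qed.

(** * Quotients by chosen representatives *)

Section Quotient.
Variables (T : Set) (t0 : T) (R : T -> T -> Prop).
Hypothesis Rrefl : forall a, R a a.
Hypothesis Rsym : forall a b, R a b -> R b a.
Hypothesis Rtrans : forall a b c, R a b -> R b c -> R a c.

Definition rep (a : T) : T :=
  match pselect (exists b, R a b) with left h => sval (cid h) | right _ => t0 end.

Lemma repP a : R a (rep a).
Proof.
by rewrite /rep; case: pselect => [h|[]]; [exact: svalP (cid h)|exists a].
Qed.

Lemma rep_eq a b : R a b -> rep a = rep b.
Proof.
move=> ab; suff e : R a = R b by rewrite /rep e.
apply/funext => c; apply/propext; split; apply: Rtrans => //; exact: Rsym.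
Qed.

(** Chosen representatives stand for the classes, as predicates would leave [Set]; domains lie in
    [Set] so that the elements of a model can serve as the variables of a context. *)
Definition quot : Set := {a : T | rep a = a}.

Definition cls (a : T) : quot := exist _ (rep a) (esym (rep_eq (repP a))).

Lemma cls_eqP a b : cls a = cls b <-> R a b.
Proof.
split=> [/(congr1 sval) /= e|ab].
  by apply: (Rtrans (repP a)); rewrite e; apply/Rsym/repP.
by apply: sval_inj; apply: rep_eq.
Qed.

Lemma sval_cls a : R a (sval (cls a)). Proof. exact: repP. Qed.

Lemma clsK (q : quot) : cls (sval q) = q.
Proof. by apply: sval_inj; exact: svalP q. Qed.

End Quotient.

(** * Structures, truth and extensional models *)

Record structure := Structure {
  dom : ty -> Set;
  app : forall s t, dom (s ~> t) -> dom s -> dom t;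
  zero : dom N;
  one : dom N;
  plus : dom (N ~> N ~> N);
  times : dom (N ~> N ~> N);
  kcomb : forall s t, dom (s ~> t ~> s);
  scomb : forall r s t, dom ((r ~> s ~> t) ~> (r ~> s) ~> r ~> t);
  recur : dom ((N ~> N ~> N) ~> N ~> N ~> N);
  lt : dom N -> dom N -> Prop }.

Definition env (M : structure) (V : ctx) := forall s, V s -> dom M s.

Definition econs (M : structure) V s (d : dom M s) (r : env M V) : env M (ext V s) :=
  fun t x => match x in ext _ _ t' return dom M t' with new => d | old _ y => r _ y end.

Fixpoint eval (M : structure) V (r : env M V) t (a : term V t) : dom M t :=
  match a in term _ t' return dom M t' with
  | Var _ x => r _ x
  | App _ _ a b => app (eval r a) (eval r b)
  | Zero => zero M
  | One => one M
  | Plus => plus M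
  | Times => times M
  | Kc s t => kcomb M s t
  | Sc r s t => scomb M r s t
  | Rc => recur M
  end.

Fixpoint sat (M : structure) V (r : env M V) (p : form V) : Prop :=
  match p with
  | Eq a b => eval r a = eval r b
  | Lt a b => lt (eval r a) (eval r b)
  | Bot => False
  | Imp p q => sat r p -> sat r q
  | And p q => sat r p /\ sat r q
  | Or p q => sat r p \/ sat r q
  | All s p => forall d : dom M s, sat (econs d r) p
  | Ex s p => exists d : dom M s, sat (econs d r) p
  end.

Record model := Model {
  model_structure :> structure;
  app_ext : forall s t (f g : dom model_structure (s ~> t)),
    (forall a, app f a = app g a) -> f = g;
  axioms_hold : forall V (r : env model_structure V) p, RCA0w p -> sat r p }.

Definition empty_env M : env M no_vars := fun _ x => match x with end.

(** Serves twice: as default element in forming the quotient, and to eliminate the free variables of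
    a derivation in [completeness]. *)
Fixpoint closed_term V t : term V t :=
  match t with N => Zero | s ~> t => Kc @ closed_term V t end.

(** * The term model *)

Section TermModel.
Variables (G0 : list (form nat_vars)) (cG0 : consistent G0).
Let Del := Delta cG0.

Definition Req s (a b : term nat_vars s) : Prop := Del (eqt a b).

Lemma Req_arr s t (f g : term nat_vars (s ~> t)) :
  Req f g <-> forall a, Req (f @ a) (g @ a).
Proof.
rewrite /Req /=; apply: iff_trans; first exact: Delta_all.
by split=> h a; move: (h a); rewrite /inst fsub_eqt /= !tsub_scons_wk !tsub_ids.
Qed.

Lemma Req_refl s (a : term nat_vars s) : Req a a.
Proof. elim: s a => [|s _ t IH] a; [exact: Delta_refl|by apply/Req_arr]. Qed.

Lemma Req_sym s (a b : term nat_vars s) : Req a b -> Req b a.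
Proof.
elim: s a b => [|s _ t IH] a b; last by move=> /Req_arr h; apply/Req_arr => c; apply/IH/h.
move=> h; have := @Delta_eqsubst _ cG0 (v0 == a↑) a b h.
by rewrite /inst /= !tsub_scons_wk !tsub_ids; apply; exact: Delta_refl.
Qed.

Lemma Req_trans s (a b c : term nat_vars s) : Req a b -> Req b c -> Req a c.
Proof.
elim: s a b c => [|s _ t IH] a b c; last first.
  by move=> /Req_arr h /Req_arr k; apply/Req_arr => d; apply: IH (h d) (k d).
move=> ab h; have := @Delta_eqsubst _ cG0 (a↑ == v0) b c h.
by rewrite /inst /= !tsub_scons_wk !tsub_ids; apply.
Qed.

(** Replacing the argument is the extensionality axiom; pointwise equality only allows replacing the
    function. *)
Lemma Req_app s t (f g : term nat_vars (s ~> t)) a b :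
  Req f g -> Req a b -> Req (f @ a) (g @ b).
Proof.
move=> /Req_arr fg ab; apply: Req_trans (fg b).
exact: Delta_mp (Delta_ax cG0 (Extensionality a b f)) ab.
Qed.

Definition tdom s : Set := quot (closed_term nat_vars s) (@Req s).

Definition tcls s (a : term nat_vars s) : tdom s :=
  cls (closed_term nat_vars s) (@Req_refl s) (@Req_sym s) (@Req_trans s) a.

Lemma tcls_eq s (a b : term nat_vars s) : tcls a = tcls b <-> Req a b.
Proof. exact: cls_eqP. Qed.

Lemma tclsK s (d : tdom s) : tcls (sval d) = d.
Proof. exact: clsK. Qed.

Lemma Req_sval s (a : term nat_vars s) : Req (sval (tcls a)) a.
Proof. apply: Req_sym; apply: sval_cls. Qed.

Definition tstruct : structure := {|
  dom := tdom;
  app := fun s t f a => tcls (sval f @ sval a);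
  zero := tcls Zero;
  one := tcls One;
  plus := tcls Plus;
  times := tcls Times;
  kcomb := fun s t => tcls Kc;
  scomb := fun r s t => tcls Sc;
  recur := tcls Rc;
  lt := fun a b => Del (sval a ≺ sval b) |}.

Definition cenv V (f : sub V nat_vars) : env tstruct V := fun s x => tcls (f s x).

Lemma eval_cenv V (f : sub V nat_vars) t (a : term V t) :
  eval (cenv f) a = tcls (tsub f a).
Proof.
elim: a => //= s u a -> b ->.
by apply/tcls_eq/Req_app; exact: Req_sval.
Qed.

Lemma Del_lt a b a' b' : Req a a' -> Req b b' -> Del (a ≺ b) -> Del (a' ≺ b').
Proof.
move=> aa base h; have := @Delta_eqsubst _ cG0 (v0 ≺ b'↑) a a' aa.
rewrite /inst /= !tsub_scons_wk !tsub_ids; apply.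
have := @Delta_eqsubst _ cG0 (a↑ ≺ v0) b b' base.
by rewrite /inst /= !tsub_scons_wk !tsub_ids; apply.
Qed.

Lemma cenv_scons V s (f : sub V nat_vars) (a : term nat_vars s) :
  econs (tcls a : dom tstruct s) (cenv f) = cenv (scons a f).
Proof. by apply: functional_extensionality_dep => t; apply/funext => -[]. Qed.

(** The truth lemma. Terms exhaust the classes, so the quantifier clauses match the instance
    properties of [Delta]. *)
Lemma sat_cenv V (p : form V) (f : sub V nat_vars) : sat (cenv f) p <-> Del (fsub f p).
Proof.
elim: p f => {V} /=.
- by move=> V a b f; rewrite !eval_cenv; exact: tcls_eq.
- move=> V a b f; rewrite !eval_cenv /=; split; apply: Del_lt; try exact: Req_sval.
    exact/Req_sym/Req_sval.
  exact/Req_sym/Req_sval.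
- by move=> V f; split=> // /Delta_bot.
- move=> V p IHp q IHq f; apply: iff_trans (iff_sym (Delta_imp _ _ _)).
  by rewrite IHp IHq.
- move=> V p IHp q IHq f; apply: iff_trans (iff_sym (Delta_and _ _ _)).
  by rewrite IHp IHq.
- move=> V p IHp q IHq f; apply: iff_trans (iff_sym (Delta_or _ _ _)).
  by rewrite IHp IHq.
- move=> V s p IH f; apply: iff_trans (iff_sym (Delta_all _ _)).
  split=> h.
    by move=> a; rewrite inst_fsub_lift; apply/IH; rewrite -cenv_scons; apply: h.
  by move=> d; rewrite -(tclsK d) cenv_scons; apply/IH; rewrite -inst_fsub_lift; apply: h.
- move=> V s p IH f; apply: iff_trans (iff_sym (Delta_ex _ _)).
  split=> -[a h].
    by exists (sval a); rewrite inst_fsub_lift; apply/IH; rewrite -cenv_scons tclsK.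
  by exists (tcls a); rewrite cenv_scons; apply/IH; rewrite -inst_fsub_lift; apply: h.
Qed.

Lemma cenv_sval V (r : env tstruct V) : r = cenv (fun s x => sval (r s x)).
Proof. by apply: functional_extensionality_dep => s; apply/funext => x; rewrite /cenv tclsK. Qed.

Lemma tstruct_ext s t (f g : dom tstruct (s ~> t)) :
  (forall a, app f a = app g a) -> f = g.
Proof.
move=> h; rewrite -(tclsK f) -(tclsK g); apply/tcls_eq/Req_arr => a.
have /tcls_eq e := h (tcls a).
have ea := Req_sval a.
apply: Req_trans (Req_trans e (Req_app (Req_refl _) ea)).
exact/Req_app/Req_sym/ea/Req_refl.
Qed.

Lemma tstruct_axioms V (r : env tstruct V) p : RCA0w p -> sat r p.
Proof. by move=> h; rewrite (cenv_sval r); apply/sat_cenv/Delta_ax/RCA0w_fsub. Qed.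

Definition tmodel : model := Model tstruct_ext tstruct_axioms.

End TermModel.

Theorem completeness (p : form no_vars) :
  (forall M : model, sat (empty_env M) p) -> RCA0w ⊢ p.
Proof.
move=> h; pose f : sub no_vars nat_vars := fun _ x => match x with end.
(* Closed terms put for the variables lead from countably many variables back to none. *)
have back (q : form no_vars) : fsub (fun s (_ : nat_vars s) => closed_term no_vars s) (fsub f q) = q.
  by rewrite fsub_fsub -[RHS]fsub_ids; congr fsub; apply: sub_eq => s [].
suff hp : prf RCA0w [::] (fsub f p).
  by have := prf_fsub hp (fun s (_ : nat_vars s) => closed_term no_vars s); rewrite /= back.
apply: contrapT => np.
have cG : consistent [:: ¬ fsub f p] by move=> /RAA.
have : ~ Delta cG (fsub f p) by apply/Delta_neg/Delta_prf/Hyp; left.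
apply; apply/sat_cenv; have := h (tmodel cG).
by congr (sat _ _); apply: functional_extensionality_dep => s; apply/funext => -[].
Qed.

(** * Combinators and axioms in a model *)

Notation "f ∙ a" := (app f a) (at level 20, left associativity) : ho_scope.

Section Semantics.
Variable M : model.

Lemma env_eq V (r r' : env M V) : (forall s x, r s x = r' s x) -> r = r'.
Proof. by move=> h; apply: functional_extensionality_dep => s; apply/funext/h. Qed.

Lemma eval_tsub V W (f : sub V W) (r : env M W) t (a : term V t) :
  eval r (tsub f a) = eval (fun s x => eval r (f s x)) a.
Proof. by elim: a => //= s u a -> b ->. Qed.

Lemma eval_wk V s (d : dom M s) (r : env M V) t (a : term V t) :
  eval (econs d r) (a↑) = eval r a.
Proof. by rewrite /twk eval_tsub. Qed.

Lemma sat_fsub V (p : form V) W (f : sub V W) (r : env M W) :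
  sat r (fsub f p) <-> sat (fun s x => eval r (f s x)) p.
Proof.
have h U s (g : sub V U) (r' : env M U) d :
    (fun t (x : ext V s t) => eval (econs d r') (lift g x)) =
    econs d (fun t x => eval r' (g t x)).
  by apply: env_eq => t [|{}t x] //=; exact: eval_wk.
elim: p W f r {h} => {V} /=.
- by move=> V a b W f r; rewrite !eval_tsub.
- by move=> V a b W f r; rewrite !eval_tsub.
- by [].
- by move=> V p IHp q IHq W f r; rewrite IHp IHq.
- by move=> V p IHp q IHq W f r; rewrite IHp IHq.
- by move=> V p IHp q IHq W f r; rewrite IHp IHq.
all: move=> V s p IH W f r.
all: have h d : (fun t (x : ext V s t) => eval (econs d r) (lift f x)) =
    econs d (fun t x => eval r (f t x))
  by apply: env_eq => t [|{}t x] //=; exact: eval_wk.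
- by split=> k d; [rewrite -h; apply/IH|apply/IH; rewrite h].
- by split=> -[d k]; exists d; [rewrite -h; apply/IH|apply/IH; rewrite h].
Qed.

Lemma sat_eqt V (r : env M V) s (a b : term V s) : sat r (eqt a b) <-> eval r a = eval r b.
Proof.
elim: s V r a b => [|s _ t IH] V r a b //=.
split=> [h|e d]; last by apply/IH; rewrite /= !eval_wk e.
by apply: app_ext => d; move/IH: (h d); rewrite /= !eval_wk.
Qed.

(** With the elements of the model as variables, the axiom schemes apply with arbitrary parameters
    from the model. *)
Definition own_env : env M (dom M) := fun _ d => d.

Lemma kcombE s t (a : dom M s) (b : dom M t) : kcomb M s t ∙ a ∙ b = a.
Proof.
exact: (sat_eqt own_env (Kc @ Var a @ Var b) (Var a)).1 (axioms_hold own_env (K_ax _ _)).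
Qed.

Lemma scombE r s t (f : dom M (r ~> s ~> t)) (g : dom M (r ~> s)) a :
  scomb M r s t ∙ f ∙ g ∙ a = f ∙ a ∙ (g ∙ a).
Proof.
exact: (sat_eqt own_env (Sc @ Var f @ Var g @ Var a) (Var f @ Var a @ (Var g @ Var a))).1
  (axioms_hold own_env (S_ax _ _ _)).
Qed.

Lemma eval_lam V (r : env M V) s t (a : term (ext V s) t) d :
  eval r (lam a) ∙ d = eval (econs d r) a.
Proof.
suff h U (b : term U t) (e : U = ext V s) :
    eval r (lam (match e in _ = U return term U t with erefl => b end)) ∙ d =
    eval (econs d r) (match e in _ = U return term U t with erefl => b end).
  exact: (h _ a erefl).
clear a; elim: b e => {t} [t x|u t b IHb c IHc| | | | |u t|u t q|] e; subst U => /=.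
- by case: x => [|? x] /=; rewrite ?scombE !kcombE.
- by rewrite scombE (IHb erefl) (IHc erefl).
all: by rewrite kcombE.
Qed.

Lemma qf_ind (P : dom M N -> Prop) (A : form (ext (dom M) N)) :
  quantifier_free A = true ->
  (forall n, sat (econs n own_env) A <-> P n) ->
  P (zero M) -> (forall n, P n -> P (plus M ∙ n ∙ one M)) -> forall n, P n.
Proof.
move=> qA AP P0 PS n; have := axioms_hold own_env (QF_IND qA).
move=> /= h; apply/AP; apply: h; split=> [|{}n].
  apply/sat_fsub; set r := fun _ => _.
  by rewrite (_ : r = econs (zero M) own_env) ?AP //; apply: env_eq => t [].
move=> /AP /PS /AP h; apply/sat_fsub; set r := fun _ => _.
by rewrite (_ : r = econs (plus M ∙ n ∙ one M) own_env) //; apply: env_eq => t [].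
Qed.

Lemma qf_choice (P : dom M ty1 -> dom M N -> Prop) (A : form (ext (ext (dom M) ty1) N)) :
  quantifier_free A = true ->
  (forall x n, sat (econs n (econs x own_env)) A <-> P x n) ->
  (forall x, exists n, P x n) -> exists F : dom M ty2, forall x, P x (F ∙ x).
Proof.
move=> qA AP h; have := axioms_hold own_env (QF_AC10 qA) => /= -[|F hF].
  by move=> x; have [n /AP] := h x; exists n.
exists F => x; move/sat_fsub: (hF x); set r := fun _ => _.
rewrite (_ : r = econs (F ∙ x) (econs x own_env)) ?AP //.
by apply: env_eq => t [|? []].
Qed.

End Semantics.

Import Order.TTheory GRing.Theory Num.Theory.
Local Open Scope ring_scope.

(* [sealed x] equals [x] but does not compute: unification must not unfold the
   combinator terms behind the arithmetical operations. *)
Fact seal (T : Type) (x : T) : {y | y = x}. Proof. by exists x. Qed.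
Definition sealed (T : Type) (x : T) : T := sval (seal x).
Lemma sealedE (T : Type) (x : T) : sealed x = x. Proof. exact: svalP (seal x). Qed.

(** * The numbers of a model: order, recursion, truncated subtraction *)

Section Numbers.
Variable M : model.

Definition nn : Set := dom M N.

Let ax := @axioms_hold M _ (@own_env M).

Fact nn_addA : associative (fun a b : nn => plus M ∙ a ∙ b : nn).
Proof. by move=> a b c; apply: (ax (add_assoc (Var a) (Var b) (Var c))). Qed.
Fact nn_addC : commutative (fun a b : nn => plus M ∙ a ∙ b : nn).
Proof. by move=> a b; apply: (ax (add_comm (Var a) (Var b))). Qed.
Fact nn_add0 : left_id (zero M : nn) (fun a b : nn => plus M ∙ a ∙ b : nn).
Proof. by move=> a; rewrite nn_addC; apply: (ax (add_zero (Var a))). Qed.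
Fact nn_mulA : associative (fun a b : nn => times M ∙ a ∙ b : nn).
Proof. by move=> a b c; apply: (ax (mul_assoc (Var a) (Var b) (Var c))). Qed.
Fact nn_mulC : commutative (fun a b : nn => times M ∙ a ∙ b : nn).
Proof. by move=> a b; apply: (ax (mul_comm (Var a) (Var b))). Qed.
Fact nn_mul1 : left_id (one M : nn) (fun a b : nn => times M ∙ a ∙ b : nn).
Proof. by move=> a; rewrite nn_mulC; apply: (ax (mul_one (Var a))). Qed.
Fact nn_mulDl : left_distributive (fun a b : nn => times M ∙ a ∙ b : nn)
  (fun a b : nn => plus M ∙ a ∙ b : nn).
Proof.
move=> a b c; rewrite nn_mulC; transitivity (plus M ∙ (times M ∙ c ∙ a) ∙ (times M ∙ c ∙ b)).
  exact (ax (mul_add (Var c) (Var a) (Var b))).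
by rewrite nn_mulC [in X in _ ∙ X]nn_mulC.
Qed.
Fact nn_mul0 : left_zero (zero M : nn) (fun a b : nn => times M ∙ a ∙ b : nn).
Proof. by move=> a; rewrite nn_mulC; apply: (ax (mul_zero (Var a))). Qed.

HB.instance Definition _ := gen_eqMixin nn.
HB.instance Definition _ := gen_choiceMixin nn.
HB.instance Definition _ := GRing.isNmodule.Build nn nn_addA nn_addC nn_add0.
HB.instance Definition _ := GRing.Nmodule_isComPzSemiRing.Build nn
  nn_mulA nn_mulC nn_mul1 nn_mulDl nn_mul0.

Implicit Types a b c d n m : nn.

Definition nlt a b : Prop := @lt M a b.

Lemma nlt_irr a : ~ nlt a a.
Proof. exact (ax (Defs.lt_irrefl (Var a))). Qed.
Lemma nlt_trans a b c : nlt a b -> nlt b c -> nlt a c.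
Proof. exact (ax (Defs.lt_trans (Var a) (Var b) (Var c))). Qed.
Lemma nlt_total a b : nlt a b \/ a = b \/ nlt b a.
Proof. exact (ax (Defs.lt_total (Var a) (Var b))). Qed.
Lemma nlt_add a b c : nlt a b -> nlt (a + c) (b + c).
Proof. exact (ax (Defs.lt_add (Var a) (Var b) (Var c))). Qed.
Lemma nlt_mul a b c : nlt 0 c -> nlt a b -> nlt (a * c) (b * c).
Proof. exact (ax (Defs.lt_mul (Var a) (Var b) (Var c))). Qed.
Lemma nlt01 : nlt 0 1.
Proof. exact (ax (Defs.lt_zero_one _)). Qed.

Lemma nn_ind (A : form (ext (dom M) N)) (P : nn -> Prop) :
  quantifier_free A = true -> (forall n, sat (econs (n : dom M N) (@own_env M)) A <-> P n) ->
  P 0 -> (forall n, P n -> P (n + 1)) -> forall n, P n.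
Proof. exact: qf_ind. Qed.

Lemma n0_or_pos n : n = 0 \/ nlt 0 n.
Proof.
move: n; apply: (nn_ind (A := v0 == Zero ∨ Zero ≺ v0)) => //; first by left.
move=> n [->|h]; right; first by rewrite add0r; exact: nlt01.
by apply: nlt_trans h _; rewrite -[X in nlt X _]add0r [n + 1]addrC; exact: nlt_add nlt01.
Qed.

Lemma nlt_addr a c : nlt 0 c -> nlt a (a + c).
Proof. by move=> h; rewrite -[X in nlt X _]add0r [a + c]addrC; apply: nlt_add. Qed.

Lemma nlt0S n : nlt 0 (n + 1).
Proof.
have [->|h] := n0_or_pos n; first by rewrite add0r; exact: nlt01.
by apply: nlt_trans nlt01 _; rewrite -[X in nlt X _]add0r; apply: nlt_add.
Qed.

Lemma n_addI a b c : a + c = b + c -> a = b.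
Proof.
by move=> e; have [h|[//|h]] := nlt_total a b; have := nlt_add c h; rewrite e => /nlt_irr.
Qed.

Lemma n_mulSI a b c : a * (c + 1) = b * (c + 1) -> a = b.
Proof.
by move=> e; have [h|[//|h]] := nlt_total a b; have := nlt_mul (nlt0S c) h; rewrite e => /nlt_irr.
Qed.

Lemma recur0 (f : dom M (N ~> N ~> N)) n : recur M ∙ f ∙ n ∙ zero M = n.
Proof. exact (ax (R_zero (Var f) (Var n))). Qed.

Lemma recurS (f : dom M (N ~> N ~> N)) n m :
  recur M ∙ f ∙ n ∙ (m + 1) = f ∙ m ∙ (recur M ∙ f ∙ n ∙ m).
Proof. exact (ax (R_succ (Var f) (Var n) (Var m))). Qed.

Lemma recur_lam (a : term (ext (ext (dom M) N) N) N) n m :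
  let f := eval (@own_env M) (lam (lam a)) in
  recur M ∙ f ∙ n ∙ (m + 1) = eval (econs (recur M ∙ f ∙ n ∙ m) (econs (m : dom M N) (@own_env M))) a.
Proof. by rewrite /= recurS; set d := recur M ∙ _ ∙ _ ∙ _; rewrite !eval_lam. Qed.

Definition npred : nn -> nn := sealed (fun n => eval (@own_env M) (pred (Var n))).
Definition nmonus : nn -> nn -> nn := sealed (fun a b => eval (@own_env M) (Var a ⊖ Var b)).

Lemma npredE n : npred n = eval (@own_env M) (pred (Var n)).
Proof. by rewrite /npred sealedE. Qed.
Lemma nmonusE a b : nmonus a b = eval (@own_env M) (Var a ⊖ Var b).
Proof. by rewrite /nmonus sealedE. Qed.

Lemma npred0 : npred 0 = 0.
Proof. rewrite npredE; exact: recur0. Qed.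

Lemma npredS n : npred (n + 1) = n.
Proof. rewrite npredE; exact: (recur_lam v1). Qed.

Lemma nmonus0 a : nmonus a 0 = a.
Proof. rewrite nmonusE; exact: recur0. Qed.

Lemma nmonusS a b : nmonus a (b + 1) = npred (nmonus a b).
Proof. rewrite !nmonusE npredE; exact: (recur_lam (pred v0)). Qed.

Lemma npredK n : n = 0 \/ n = npred n + 1.
Proof.
move: n; apply: (nn_ind (A := v0 == Zero ∨ v0 == pred v0 ⊕ One)) => [//|n| |]; [by rewrite npredE|by left|].
by move=> n _; right; rewrite npredS.
Qed.

(** The order axioms do not by themselves provide differences; these are obtained from the recursor
    by this induction, whose formula stays quantifier-free because the difference is named by a
    term. *)
Lemma nmonusP m n : (nlt n m /\ n + nmonus m n = m) \/
  ((nlt m n \/ m = n) /\ nmonus m n = 0).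
Proof.
move: n; pose c : term (ext (dom M) N) N := Var (old (m : dom M N)).
apply: (nn_ind (A := (v0 ≺ c ∧ v0 ⊕ (c ⊖ v0) == c) ∨ ((c ≺ v0 ∨ c == v0) ∧ c ⊖ v0 == Zero))) => [//|n| |].
- by rewrite nmonusE.
- rewrite nmonus0 add0r; have [->|] := n0_or_pos m; [right|left] => //.
  by split => //; right.
move=> n; have ltS : nlt n (n + 1) := nlt_addr n nlt01; move=> [[nm e]|[h e]]; rewrite nmonusS; last first.
  right; rewrite e npred0; split => //; left.
  by case: h => [h|->//]; apply: nlt_trans h _.
have [e0|ep] := npredK (nmonus m n).
  by move: nm; rewrite -e e0 addr0 => /nlt_irr.
rewrite ep addrA in e; have e' : n + 1 + npred (nmonus m n) = m by rewrite addrAC.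
have [z|h] := n0_or_pos (npred (nmonus m n)); [right|left]; split => //.
  by right; rewrite z addr0 in e'.
by move: (nlt_addr (n + 1) h); rewrite e'.
Qed.

Lemma nlt_ex a b : nlt a b -> exists c, b = a + (c + 1).
Proof.
move=> h; have [[_ e]|[[k|k] _]] := nmonusP b a.
- have [e0|ep] := npredK (nmonus b a); last by exists (npred (nmonus b a)); rewrite -ep.
  by move: h; rewrite -e e0 addr0 => /nlt_irr.
- by case: (nlt_irr (nlt_trans h k)).
- by move: h; rewrite k => /nlt_irr.
Qed.

Lemma n_add0 a b : a + b = 0 -> a = 0.
Proof.
move=> e; have [//|/nlt_add h] := n0_or_pos a; move: (h b); rewrite e add0r.
by have [->/nlt_irr|h' /(nlt_trans h')/nlt_irr] := n0_or_pos b.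
Qed.

Lemma nS_neq0 a : a + 1 <> 0.
Proof. by move=> e; have := nlt0S a; rewrite e => /nlt_irr. Qed.

Definition nle a b : Prop := exists c, b = a + c.

Lemma nle_or_lt a b : nle a b \/ nlt b a.
Proof.
have [/nlt_ex [c ->]|[->|]] := nlt_total a b; last by right.
  by left; exists (c + 1).
by left; exists 0; rewrite addr0.
Qed.

Lemma nlt_nle a b : nlt a b <-> ~ nle b a.
Proof.
split=> [h [c e]|h]; last by have [] := nle_or_lt b a.
move: h; rewrite e; have [->|h] := n0_or_pos c; first by rewrite addr0 => /nlt_irr.
by move=> k; apply: (nlt_irr (nlt_trans k (nlt_addr b h))).
Qed.

End Numbers.

(** * The ordered field of fractions *)

Record frac (M : model) : Set := Frac { fpos : nn M; fneg : nn M; fden : nn M }.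

Section Fractions.
Variable M : model.
Implicit Types s t u : frac M.

(* [Frac a b c] stands for (a - b) / (c + 1). *)
Local Notation P s := (fpos s).
Local Notation Q s := (fneg s).
Local Notation C s := (fden s + 1).

Definition frac_eq s t : Prop := P s * C t + Q t * C s = P t * C s + Q s * C t.

Fact frac_eq_refl s : frac_eq s s. Proof. by []. Qed.
Fact frac_eq_sym s t : frac_eq s t -> frac_eq t s. Proof. by []. Qed.
(** The equations are scaled by the outer denominators and added; then the terms and the denominator
    of the middle fraction cancel. *)
Fact frac_eq_trans s t u : frac_eq s t -> frac_eq t u -> frac_eq s u.
Proof.
rewrite /frac_eq => h k; apply: (@n_mulSI M _ _ (fden t)).
apply: (@n_addI M _ _ ((P t + Q t) * C s * C u)).
transitivity ((P s * C t + Q t * C s) * C u + (P t * C u + Q u * C t) * C s); first by ring.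
by rewrite h k; ring.
Qed.

Definition ffld : Type := quot (Frac (0 : nn M) 0 0) frac_eq.
Definition fcls s : ffld := cls (Frac (0 : nn M) 0 0) frac_eq_refl frac_eq_sym frac_eq_trans s.

Lemma fcls_eq s t : fcls s = fcls t <-> frac_eq s t.
Proof. exact: cls_eqP. Qed.

Lemma fclsW (A : ffld -> Prop) : (forall s, A (fcls s)) -> forall x, A x.
Proof.
by move=> h x; rewrite -(clsK frac_eq_refl frac_eq_sym frac_eq_trans x); apply: h.
Qed.

Lemma frac_rep s : frac_eq (sval (fcls s)) s.
Proof. by apply: frac_eq_sym; apply: sval_cls. Qed.

Definition frac_add s t : frac M :=
  Frac (P s * C t + P t * C s) (Q s * C t + Q t * C s) (fden s * C t + fden t).
Definition frac_opp s : frac M := Frac (Q s) (P s) (fden s).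
Definition frac_mul s t : frac M :=
  Frac (P s * P t + Q s * Q t) (P s * Q t + Q s * P t) (fden s * C t + fden t).

Definition fld_add (x y : ffld) : ffld := fcls (frac_add (sval x) (sval y)).
Definition fld_opp (x : ffld) : ffld := fcls (frac_opp (sval x)).
Definition fld_mul (x y : ffld) : ffld := fcls (frac_mul (sval x) (sval y)).

Lemma fld_addE s t : fld_add (fcls s) (fcls t) = fcls (frac_add s t).
Proof.
apply/fcls_eq; have := frac_rep s; move: (sval (fcls s)) => s'.
have := frac_rep t; move: (sval (fcls t)) => t'; rewrite /frac_eq /= => ht hs.
transitivity ((P s' * C s + Q s * C s') * (C t * C t') + (P t' * C t + Q t * C t') * (C s * C s')).
  by ring.
by rewrite hs ht; ring.
Qed.

Lemma fld_oppE s : fld_opp (fcls s) = fcls (frac_opp s).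
Proof.
apply/fcls_eq; have := frac_rep s.
by move: (sval _) => s'; rewrite /frac_eq /= addrC => ->; rewrite addrC.
Qed.

Lemma fld_mulE s t : fld_mul (fcls s) (fcls t) = fcls (frac_mul s t).
Proof.
have compat (s1 s2 t1 : frac M) : frac_eq s1 s2 -> frac_eq (frac_mul s1 t1) (frac_mul s2 t1).
  rewrite /frac_eq /= => h.
  transitivity (P t1 * C t1 * (P s1 * C s2 + Q s2 * C s1) + Q t1 * C t1 * (P s2 * C s1 + Q s1 * C s2)).
    by ring.
  transitivity (P t1 * C t1 * (P s2 * C s1 + Q s1 * C s2) + Q t1 * C t1 * (P s1 * C s2 + Q s2 * C s1)).
    by rewrite h.
  by ring.
have comm (s1 t1 : frac M) : frac_mul s1 t1 = frac_mul t1 s1.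
  by rewrite /frac_mul; congr Frac; ring.
apply/fcls_eq; apply: frac_eq_trans (compat _ _ _ (frac_rep s)) _.
by rewrite comm [frac_mul s t]comm; apply/compat/frac_rep.
Qed.

Ltac fld_elim := repeat (match goal with |- forall _ : ffld, _ => apply: fclsW => ? end);
  rewrite ?fld_oppE ?(fld_addE, fld_mulE) ?(fld_addE, fld_mulE); apply/fcls_eq;
  rewrite /frac_eq /=; ring.

Fact fld_addA : associative fld_add. Proof. rewrite /associative; fld_elim. Qed.
Fact fld_addC : commutative fld_add. Proof. rewrite /commutative; fld_elim. Qed.
Fact fld_add0 : left_id (fcls (Frac (0 : nn M) 0 0)) fld_add.
Proof. rewrite /left_id; fld_elim. Qed.
Fact fld_addN : left_inverse (fcls (Frac (0 : nn M) 0 0)) fld_opp fld_add.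
Proof. rewrite /left_inverse; fld_elim. Qed.
Fact fld_mulA : associative fld_mul. Proof. rewrite /associative; fld_elim. Qed.
Fact fld_mulC : commutative fld_mul. Proof. rewrite /commutative; fld_elim. Qed.
Fact fld_mul1 : left_id (fcls (Frac (1 : nn M) 0 0)) fld_mul.
Proof. rewrite /left_id; fld_elim. Qed.
Fact fld_mulDl : left_distributive fld_mul fld_add.
Proof. rewrite /left_distributive; fld_elim. Qed.

HB.instance Definition _ := gen_eqMixin ffld.
HB.instance Definition _ := gen_choiceMixin ffld.
HB.instance Definition _ := GRing.isZmodule.Build ffld fld_addA fld_addC fld_add0 fld_addN.

Fact fld_1neq0 : fcls (Frac (1 : nn M) 0 0) != 0 :> ffld.
Proof.
apply/eqP => /fcls_eq; rewrite /frac_eq /= !(mul0r, add0r, addr0, mulr1) => e.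
by apply: (@nlt_irr M 0); have := nlt01 M; rewrite e.
Qed.

HB.instance Definition _ := GRing.Zmodule_isComNzRing.Build ffld
  fld_mulA fld_mulC fld_mul1 fld_mulDl fld_1neq0.

Lemma fadd_cls s t : fcls s + fcls t = fcls (frac_add s t). Proof. exact: fld_addE. Qed.
Lemma fopp_cls s : - fcls s = fcls (frac_opp s). Proof. exact: fld_oppE. Qed.
Lemma fmul_cls s t : fcls s * fcls t = fcls (frac_mul s t). Proof. exact: fld_mulE. Qed.

Lemma fld_inv_ex (x : ffld) : x != 0 -> exists y, y * x = 1.
Proof.
move: x; apply: fclsW => -[p q c] /eqP /fcls_eq; rewrite /frac_eq /=.
rewrite !(mul0r, add0r, addr0, mulr1) => pq.
have [/nlt_ex [d e]|[/pq//|/nlt_ex [d e]]] := nlt_total p q; subst.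
  exists (fcls (Frac (0 : nn M) (c + 1) d)); rewrite fmul_cls; apply/fcls_eq.
  by rewrite /frac_eq /=; ring.
exists (fcls (Frac (c + 1) (0 : nn M) d)); rewrite fmul_cls; apply/fcls_eq.
by rewrite /frac_eq /=; ring.
Qed.

Definition fld_inv (x : ffld) : ffld :=
  match pselect (exists y, y * x = 1) with left h => sval (cid h) | right _ => 0 end.

Fact fld_mulVf x : x != 0 -> fld_inv x * x = 1.
Proof. by rewrite /fld_inv => /fld_inv_ex; case: pselect => // h _; exact: svalP (cid h). Qed.

Fact fld_inv0 : fld_inv 0 = 0.
Proof.
rewrite /fld_inv; case: pselect => // h; exfalso; have [y e] := h.
by have := oner_neq0 ffld; rewrite -e mulr0 eqxx.
Qed.

HB.instance Definition _ := GRing.ComNzRing_isField.Build ffld fld_mulVf fld_inv0.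

Definition nonneg (x : ffld) : bool := `[< nle (fneg (sval x)) (fpos (sval x)) >].

Lemma nonneg_cls s : nonneg (fcls s) = `[< nle (Q s) (P s) >].
Proof.
have compat s1 s2 : frac_eq s1 s2 -> nle (Q s1) (P s1) -> nle (Q s2) (P s2).
  case: s1 s2 => [p q c] [p' q' c'] /[swap] -[d /= ->]; rewrite /frac_eq /= => e.
  have [//|/nlt_ex [f ef]] := nle_or_lt q' p'; subst.
  (* If p' were below q', cross multiplication would force a sum ending in [+ 1] to be 0. *)
  have : d * (c' + 1) + (f * c + f + c) + 1 = 0.
    apply: (@n_addI M _ _ (q * (c' + 1) + p' * (c + 1))); rewrite add0r addrC [RHS]addrC -e.
    by ring.
  by move/nS_neq0.
by apply/asboolP/asboolP; apply: compat; [|apply: frac_eq_sym]; exact: frac_rep.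
Qed.

Definition fle (x y : ffld) : bool := nonneg (y - x).
Definition flt (x y : ffld) : bool := (y != x) && fle x y.
Definition fnorm (x : ffld) : ffld := if nonneg x then x else - x.

Lemma fle0 x : fle 0 x = nonneg x. Proof. by rewrite /fle subr0. Qed.
Lemma fge0 x : fle x 0 = nonneg (- x). Proof. by rewrite /fle sub0r. Qed.

Fact fle0_add x y : fle 0 x -> fle 0 y -> fle 0 (x + y).
Proof.
rewrite !fle0; move: x y; apply: fclsW => s; apply: fclsW => t.
rewrite fadd_cls !nonneg_cls => /asboolP [c h] /asboolP [d k]; apply/asboolP => /=.
by rewrite h k; exists (c * C t + d * C s); ring.
Qed.

Fact fle0_mul x y : fle 0 x -> fle 0 y -> fle 0 (x * y).
Proof.
rewrite !fle0; move: x y; apply: fclsW => s; apply: fclsW => t.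
rewrite fmul_cls !nonneg_cls => /asboolP [c h] /asboolP [d k]; apply/asboolP => /=.
by rewrite h k; exists (c * d); ring.
Qed.

Fact fle0_anti x : fle 0 x -> fle x 0 -> x = 0.
Proof.
rewrite fle0 fge0; move: x; apply: fclsW => s.
rewrite fopp_cls !nonneg_cls => /asboolP [c h] /asboolP [d /= k]; apply/fcls_eq.
have cd : c + d = 0.
  by apply: (@n_addI M _ _ (Q s)); rewrite add0r [in RHS]k h; ring.
by rewrite /frac_eq /= h (n_add0 cd); ring.
Qed.

Fact fsub_ge0 x y : fle 0 (y - x) = fle x y. Proof. exact: fle0. Qed.

Fact fle0_total x : fle 0 x || fle x 0.
Proof.
rewrite fle0 fge0; move: x; apply: fclsW => s; rewrite fopp_cls !nonneg_cls /=.
have [h|/nlt_ex [c h]] := nle_or_lt (Q s) (P s); apply/orP; [left|right]; apply/asboolP => //.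
by exists (c + 1).
Qed.

Fact fnormN x : fnorm (- x) = fnorm x.
Proof.
rewrite /fnorm opprK; have := @fle0_anti x; have := fle0_total x; rewrite fle0 fge0.
case: ifP; case: ifP => // _ _ _ /(_ isT isT) ->; exact: oppr0.
Qed.

Fact fge0_norm x : fle 0 x -> fnorm x = x.
Proof. by rewrite fle0 /fnorm => ->. Qed.

Fact flt_def x y : flt x y = (y != x) && fle x y. Proof. by []. Qed.

HB.instance Definition _ := Num.IntegralDomain_isLeReal.Build ffld
  fle0_add fle0_mul fle0_anti fsub_ge0 fle0_total fnormN fge0_norm flt_def.

Definition fiota (n : nn M) : ffld := fcls (Frac n 0 0).

Lemma fiota0 : fiota 0 = 0. Proof. by []. Qed.
Lemma fiota1 : fiota 1 = 1. Proof. by []. Qed.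

Lemma fiotaD m n : fiota (m + n) = fiota m + fiota n.
Proof. by rewrite fadd_cls; apply/fcls_eq; rewrite /frac_eq /=; ring. Qed.

Lemma fiotaM m n : fiota (m * n) = fiota m * fiota n.
Proof. by rewrite fmul_cls; apply/fcls_eq; rewrite /frac_eq /=; ring. Qed.

Lemma fiota_le m n : fiota m <= fiota n <-> nle m n.
Proof.
change (fle (fiota m) (fiota n) <-> nle m n).
rewrite /fle fopp_cls fadd_cls nonneg_cls asboolE /= !(mul0r, add0r, addr0, mulr1); split=> -[c].
  by move=> ->; exists c.
by move=> ->; exists c.
Qed.

Lemma fiota_inj : injective fiota.
Proof. by move=> m n /fcls_eq; rewrite /frac_eq /= !(mul0r, add0r, addr0, mulr1). Qed.

Lemma ffld_split (x : ffld) : exists a b c, x * (fiota c + 1) = fiota a - fiota b.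
Proof.
move: x; apply: fclsW => -[a b c]; exists a, b, c; rewrite -fiota1.
by rewrite fopp_cls -fiotaD fadd_cls fmul_cls; apply/fcls_eq; rewrite /frac_eq /=; ring.
Qed.

End Fractions.

(* From here on only the properties below of the field of fractions are used;
   keeping its construction opaque makes unification fast. *)
Lemma fld_seal (M : model) : {F : realFieldType & {i : nn M -> F |
  [/\ i 0 = 0 /\ i 1 = 1, {morph i : m n / m + n}, {morph i : m n / m * n},
      injective i /\ forall m n, i m <= i n <-> nle m n &
      forall x, exists a b c, x * (i c + 1) = i a - i b]}}.
Proof.
exists (ffld M : realFieldType), (@fiota M); split.
- by split; [exact: fiota0|exact: fiota1].
- exact: fiotaD.
- exact: fiotaM.
- by split; [exact: fiota_inj|exact: fiota_le].
- exact: ffld_split.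
Qed.

Definition fld (M : model) : realFieldType := projT1 (fld_seal M).
Definition iota (M : model) : nn M -> fld M := sval (projT2 (fld_seal M)).

Section Embedding.
Variable M : model.
Implicit Types m n : nn M.

Let iotaP := svalP (projT2 (fld_seal M)).

Lemma iota0 : iota (0 : nn M) = 0. Proof. by case: iotaP => -[]. Qed.
Lemma iota1 : iota (1 : nn M) = 1. Proof. by case: iotaP => -[]. Qed.
Lemma iotaD m n : iota (m + n) = iota m + iota n. Proof. by case: iotaP => _ h _ _ _; apply: h. Qed.
Lemma iotaM m n : iota (m * n) = iota m * iota n. Proof. by case: iotaP => _ _ h _ _; apply: h. Qed.
Lemma iota_inj : injective (@iota M). Proof. by case: iotaP => _ _ _ []. Qed.
Lemma iota_le m n : iota m <= iota n <-> nle m n.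
Proof. by case: iotaP => _ _ _ [_ h] _; apply: h. Qed.

Lemma iota_lt m n : iota m < iota n <-> nlt m n.
Proof. by rewrite nlt_nle -iota_le real_ltNge ?num_real //; split=> /negP. Qed.

Lemma iota_ge0 n : 0 <= iota n.
Proof. by rewrite -iota0; apply/iota_le; exists n; rewrite add0r. Qed.

Lemma fld_split (x : fld M) : exists a b c, x * (iota c + 1) = iota a - iota b.
Proof. by case: iotaP => _ _ _ _ h; apply: h. Qed.

End Embedding.

(** * Arithmetic through the embedding into the field *)

Section Arithmetic.
Variable M : model.
Implicit Types a b c d n m k q r : nn M.
Local Notation own := (@own_env M).
Local Notation ι := (@iota M).
Local Notation ct d := (Var (old (d : dom M N))).

Definition npow2 : nn M -> nn M := sealed (fun n => eval own (pow2 (Var n))).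
Lemma npow2E n : npow2 n = eval own (pow2 (Var n)).
Proof. by rewrite /npow2 sealedE. Qed.
Definition nsqrt : nn M -> nn M := sealed (fun n => eval own (sqrt (Var n))).
Lemma nsqrtE n : nsqrt n = eval own (sqrt (Var n)).
Proof. by rewrite /nsqrt sealedE. Qed.
Definition npair : nn M -> nn M -> nn M := sealed (fun a b => eval own (pair (Var a) (Var b))).
Lemma npairE a b : npair a b = eval own (pair (Var a) (Var b)).
Proof. by rewrite /npair sealedE. Qed.
Definition nfst : nn M -> nn M := sealed (fun q => eval own (fst (Var q))).
Lemma nfstE q : nfst q = eval own (fst (Var q)).
Proof. by rewrite /nfst sealedE. Qed.
Definition nsnd : nn M -> nn M := sealed (fun q => eval own (snd (Var q))).
Lemma nsndE q : nsnd q = eval own (snd (Var q)).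
Proof. by rewrite /nsnd sealedE. Qed.
Definition nqpos : nn M -> nn M := sealed (fun q => eval own (qpos (Var q))).
Lemma nqposE q : nqpos q = eval own (qpos (Var q)).
Proof. by rewrite /nqpos sealedE. Qed.
Definition nqneg : nn M -> nn M := sealed (fun q => eval own (qneg (Var q))).
Lemma nqnegE q : nqneg q = eval own (qneg (Var q)).
Proof. by rewrite /nqneg sealedE. Qed.
Definition nqden : nn M -> nn M := sealed (fun q => eval own (qden (Var q))).
Lemma nqdenE q : nqden q = eval own (qden (Var q)).
Proof. by rewrite /nqden sealedE. Qed.
Definition nqcden q r : nn M := nqden q * nqden r.
Definition nqdiff q r : nn M :=
  nmonus (nqpos q * nqden r + nqneg r * nqden q) (nqneg q * nqden r + nqpos r * nqden q).
Definition nqabs q r : nn M := nqdiff q r + nqdiff r q.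

Lemma iotaS n : ι (n + 1) = ι n + 1.
Proof. by rewrite iotaD iota1. Qed.

Lemma iota_monus a b : ι (nmonus a b) = Num.max (ι a - ι b) 0.
Proof.
have [[/iota_lt h e]|[h ->]] := nmonusP a b.
  have {}e : ι b + ι (nmonus a b) = ι a by rewrite -iotaD e.
  by rewrite max_l; lra.
have {}h : ι a <= ι b by case: h => [/iota_lt/ltW|->].
by rewrite iota0 max_r //; lra.
Qed.

Lemma npow2_0 : npow2 0 = 1.
Proof. rewrite npow2E; exact: recur0. Qed.

Lemma npow2S n : npow2 (n + 1) = npow2 n + npow2 n.
Proof. rewrite !npow2E; exact: (recur_lam (v0 ⊕ v0)). Qed.

Lemma npow2D n m : npow2 (n + m) = npow2 n * npow2 m.
Proof.
move: m; apply: (nn_ind (A := pow2 (ct n ⊕ v0) == pow2 (ct n) ⊗ pow2 v0)) => [//|m| |].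
- by rewrite !npow2E.
- by rewrite addr0 npow2_0 mulr1.
- by move=> m e; rewrite addrA !npow2S e mulrDr.
Qed.

Lemma npow2_gt n : nlt n (npow2 n).
Proof.
move: n; apply: (nn_ind (A := v0 ≺ pow2 v0)) => [//|n| |]; first by rewrite npow2E.
  by rewrite npow2_0; exact: nlt01.
move=> n /iota_lt h; apply/iota_lt; rewrite npow2S iotaS iotaD.
suff : 1 <= ι (npow2 n) by lra.
rewrite -iota1; apply/iota_le; have [//|k] := nle_or_lt 1 (npow2 n).
have [c e] := nlt_ex k.
have [e0|ep] := npredK (npow2 n); last by exists (npred (npow2 n)); rewrite addrC.
by exfalso; move: h; rewrite e0 iota0; have := iota_ge0 n; lra.
Qed.

(** The value 2^-n, where [n] may be a nonstandard number of the model. *)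
Definition ee n : fld M := (ι (npow2 n))^-1.

Lemma pow2_gt0 n : 0 < ι (npow2 n).
Proof. by apply: le_lt_trans (iota_ge0 n) _; apply/iota_lt/npow2_gt. Qed.

Lemma pow2_ee n : ι (npow2 n) * ee n = 1.
Proof. by rewrite /ee mulfV //; have := pow2_gt0 n; lra. Qed.

Lemma ee_gt0 n : 0 < ee n.
Proof. by rewrite invr_gt0 pow2_gt0. Qed.

Lemma ee0 : ee 0 = 1.
Proof. by rewrite /ee npow2_0 iota1 invr1. Qed.

Lemma eeD n m : ee (n + m) = ee n * ee m.
Proof. by rewrite /ee npow2D iotaM invfM. Qed.

Lemma eeS n : ee (n + 1) = ee n / 2.
Proof.
rewrite eeD; congr (_ * _).
by rewrite /ee -[X in npow2 X]add0r npow2S npow2_0 iotaD iota1.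
Qed.

Lemma ee_le1 n : ee n <= 1.
Proof.
rewrite /ee invf_le1 ?pow2_gt0 // -iota1; apply/iota_le.
have [//|/nlt_ex [c e]] := nle_or_lt 1 (npow2 n).
have [c' e'] := nlt_ex (npow2_gt n).
by exists (n + c'); rewrite e'; ring.
Qed.

Lemma ee_leD n m : ee (n + m) <= ee n.
Proof. by rewrite eeD; have := ee_le1 m; have := ee_gt0 n; nra. Qed.

Lemma fld_bound (x : fld M) : exists n, x <= ι n.
Proof.
have [a [b [c e]]] := fld_split x; exists a.
have [ha hb hc] := And3 (iota_ge0 a) (iota_ge0 b) (iota_ge0 c).
by case: (lerP x 0) => h; nra.
Qed.

(** Archimedean relative to the numbers of the model only: field elements are fractions of such
    numbers, and [npow2 n] exceeds [n]. *)
Lemma ee_arch (C d : fld M) : 0 < d -> exists n, C * ee n < d.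
Proof.
move=> d0; have [n h] := fld_bound (C / d); exists n.
have h2 : ι n < ι (npow2 n) by apply/iota_lt/npow2_gt.
have e := pow2_ee n; have e0 := ee_gt0 n.
have : C / d * d < ι (npow2 n) * d by rewrite ltr_pM2r //; lra.
rewrite divfK; last by lra.
by move=> k; have := k; rewrite -(ltr_pM2r e0); suff -> : ι (npow2 n) * d * ee n = d by []; rewrite mulrAC e mul1r.
Qed.

(** Plays the part of letting [m] tend to infinity; error terms are removed through it. *)
Lemma ee_lim (a b C : fld M) : (forall m, a <= b + C * ee m) -> a <= b.
Proof.
move=> h; rewrite real_leNgt ?num_real //; apply/negP => ab.
by have [|n k] := @ee_arch C (a - b); [lra|have := h n; lra].
Qed.

(** * Pairing and rational codes *)

Lemma nsqrtS n : nsqrt (n + 1) =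
  nsqrt n + nmonus 1 (nmonus ((nsqrt n + 1) * (nsqrt n + 1)) (n + 1)).
Proof. rewrite !nsqrtE !nmonusE; exact: (recur_lam (v0 ⊕ (One ⊖ ((v0 ⊕ One) ⊗ (v0 ⊕ One) ⊖ (v1 ⊕ One))))). Qed.

Lemma nmonus_eq0 a b : nmonus a b = 0 <-> ι a <= ι b.
Proof.
have e := iota_monus a b; split=> h.
  by move: e; rewrite h iota0; case: (lerP (ι a - ι b) 0) => ?; lra.
by apply: iota_inj; rewrite e iota0 max_r; lra.
Qed.

Lemma iota_discrete a b : ι a < ι b -> ι a + 1 <= ι b.
Proof. by move/iota_lt/nlt_ex => [c ->]; rewrite !iotaD iota1; have := iota_ge0 c; lra. Qed.

Lemma nsqrtP n : ι (nsqrt n * nsqrt n) <= ι n < ι ((nsqrt n + 1) * (nsqrt n + 1)).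
Proof.
suff : (nlt (nsqrt n * nsqrt n) n \/ nsqrt n * nsqrt n = n) /\
    nlt n ((nsqrt n + 1) * (nsqrt n + 1)).
  by case=> h /iota_lt ->; rewrite andbT; case: h => [/iota_lt/ltW|->].
move: n; apply: (nn_ind (A := (sqrt v0 ⊗ sqrt v0 ≼ v0) ∧ v0 ≺ (sqrt v0 ⊕ One) ⊗ (sqrt v0 ⊕ One))) => [//|n| |].
- by rewrite !nsqrtE.
- have -> : nsqrt 0 = 0 by rewrite nsqrtE; exact: recur0.
  by rewrite mul0r add0r mulr1; split; [right|exact: nlt01].
move=> n [h1 h2]; have {}h1 : ι (nsqrt n * nsqrt n) <= ι n by case: h1 => [/iota_lt/ltW|->].
move/iota_lt: h2 => h2.
suff : ι (nsqrt (n + 1) * nsqrt (n + 1)) <= ι (n + 1) < ι ((nsqrt (n + 1) + 1) * (nsqrt (n + 1) + 1)).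
  case/andP=> h3 /iota_lt h4; split=> //; move: h3; rewrite le_eqVlt => /orP [/eqP/iota_inj|/iota_lt].
    by right.
  by left.
move: h1 h2; rewrite nsqrtS; set s := nsqrt n; have s0 := iota_ge0 s => h1 h2.
have [e|/nmonus_eq0 e] := pselect (nmonus ((s + 1) * (s + 1)) (n + 1) = 0).
  rewrite e nmonus0; move/nmonus_eq0: e => ->.
  by move: h2; rewrite !(iotaM, iotaS) => h2; nra.
have {}e : ι n + 1 < ι ((s + 1) * (s + 1)).
  by rewrite -iotaS real_ltNge ?num_real //; apply/negP.
have -> : nmonus 1 (nmonus ((s + 1) * (s + 1)) (n + 1)) = 0.
  apply/nmonus_eq0; rewrite iota_monus iotaS iota1.
  by rewrite max_l; have := iota_discrete (a := n + 1) (b := (s + 1) * (s + 1)); rewrite iotaS; lra.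
by rewrite addr0 iotaS; lra.
Qed.

Lemma npair_def a b : npair a b = (a + b) * (a + b) + a.
Proof. by rewrite !(npairE, nqdenE, nqnegE, nqposE, nfstE, nsndE). Qed.

(** The code [(a + b)^2 + a] lies at or above the square of [a + b] and below the next square. *)
Lemma nsqrt_pair a b : nsqrt (npair a b) = a + b.
Proof.
have /andP [] := nsqrtP (npair a b).
have -> := npair_def a b.
set s := nsqrt _; rewrite !(iotaM, iotaD, iota1) => h1 h2.
have [ha hb hs] := And3 (iota_ge0 a) (iota_ge0 b) (iota_ge0 s).
apply: iota_inj; rewrite iotaD; apply/eqP; rewrite eq_le; apply/andP; split.
  rewrite real_leNgt ?num_real //; apply/negP; rewrite -iotaD => /iota_discrete.
  by rewrite iotaD => k; nra.
rewrite real_leNgt ?num_real //; apply/negP; rewrite -iotaD => /iota_discrete.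
by rewrite iotaD => k; nra.
Qed.

Lemma nfst_pair a b : nfst (npair a b) = a.
Proof.
have -> : nfst (npair a b) = nmonus (npair a b) (nsqrt (npair a b) * nsqrt (npair a b)).
  by rewrite nfstE nmonusE nsqrtE.
apply: iota_inj; rewrite nsqrt_pair iota_monus.
have -> := npair_def a b.
by rewrite iotaD max_l; have := iota_ge0 a; lra.
Qed.

Lemma nsnd_pair a b : nsnd (npair a b) = b.
Proof.
have -> : nsnd (npair a b) = nmonus (nsqrt (npair a b)) (nfst (npair a b)).
  by rewrite nsndE nmonusE nsqrtE nfstE.
apply: iota_inj; rewrite nsqrt_pair nfst_pair iota_monus iotaD max_l; have := iota_ge0 b; lra.
Qed.

(** The code of (a - b) / d for nonzero [d]; codes store the predecessor of the denominator. *)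
Definition mkq : nn M -> nn M -> nn M -> nn M := sealed (fun a b d => npair a (npair b (npred d))).

Lemma nqden_def q : nqden q = nsnd (nsnd q) + 1.
Proof. by rewrite !(npairE, nqdenE, nqnegE, nqposE, nfstE, nsndE). Qed.
Lemma nqneg_def q : nqneg q = nfst (nsnd q).
Proof. by rewrite !(npairE, nqdenE, nqnegE, nqposE, nfstE, nsndE). Qed.
Lemma nqpos_def q : nqpos q = nfst q.
Proof. by rewrite !(npairE, nqdenE, nqnegE, nqposE, nfstE, nsndE). Qed.

Lemma eval_pair V (e : env M V) (a b : term V N) : eval e (pair a b) = npair (eval e a) (eval e b).
Proof. by rewrite npairE. Qed.
Lemma eval_fst V (e : env M V) (a : term V N) : eval e (fst a) = nfst (eval e a).
Proof. by rewrite nfstE. Qed.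
Lemma eval_snd V (e : env M V) (a : term V N) : eval e (snd a) = nsnd (eval e a).
Proof. by rewrite nsndE. Qed.
Lemma eval_qpos V (e : env M V) (a : term V N) : eval e (qpos a) = nqpos (eval e a).
Proof. by rewrite nqposE. Qed.
Lemma eval_qneg V (e : env M V) (a : term V N) : eval e (qneg a) = nqneg (eval e a).
Proof. by rewrite nqnegE. Qed.
Lemma eval_qden V (e : env M V) (a : term V N) : eval e (qden a) = nqden (eval e a).
Proof. by rewrite nqdenE. Qed.
Lemma eval_pred V (e : env M V) (a : term V N) : eval e (pred a) = npred (eval e a).
Proof. by rewrite npredE. Qed.
Lemma eval_pow2 V (e : env M V) (a : term V N) : eval e (pow2 a) = npow2 (eval e a).
Proof. by rewrite npow2E. Qed.
Lemma eval_monus V (e : env M V) (a b : term V N) : eval e (a ⊖ b) = nmonus (eval e a) (eval e b).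
Proof. by rewrite nmonusE. Qed.
Lemma eval_plus V (e : env M V) (a b : term V N) : eval e (a ⊕ b) = (eval e a : nn M) + eval e b.
Proof. by []. Qed.
Lemma eval_times V (e : env M V) (a b : term V N) : eval e (a ⊗ b) = (eval e a : nn M) * eval e b.
Proof. by []. Qed.
Lemma mkq_def a b d : mkq a b d = npair a (npair b (npred d)).
Proof. by rewrite /mkq sealedE. Qed.

Definition evalE := (eval_lam, eval_pair, eval_fst, eval_snd, eval_qpos, eval_qneg, eval_qden,
  eval_pred, eval_pow2, eval_monus, eval_plus, eval_times).

Definition nqdist q r : nn M := mkq (nqabs q r) 0 (nqcden q r).

Lemma eval_qcden V (e : env M V) (a b : term V N) :
  eval e (qcden a b) = nqcden (eval e a) (eval e b).
Proof. by rewrite /qcden !evalE. Qed.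

Lemma eval_qdiff V (e : env M V) (a b : term V N) :
  eval e (qdiff a b) = nqdiff (eval e a) (eval e b).
Proof. by rewrite /qdiff !evalE. Qed.

Lemma eval_qabs V (e : env M V) (a b : term V N) :
  eval e (qabs a b) = nqabs (eval e a) (eval e b).
Proof. by rewrite /qabs !evalE. Qed.

Lemma eval_qdist V (e : env M V) (a b : term V N) :
  eval e (qdist a b) = nqdist (eval e a) (eval e b).
Proof. by rewrite /qdist /nqdist mkq_def !evalE. Qed.

(** Operations on codes are needed as elements of the model too, since functionals are assembled
    from such elements by application. *)
Definition qadd_el : dom M (N ~> N ~> N) := sealed (eval own (lam (lam
  (pair (qpos v1 ⊗ qden v0 ⊕ qpos v0 ⊗ qden v1)
    (pair (qneg v1 ⊗ qden v0 ⊕ qneg v0 ⊗ qden v1) (pred (qden v1 ⊗ qden v0))))))).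

Definition qmul_el : dom M (N ~> N ~> N) := sealed (eval own (lam (lam
  (pair (qpos v1 ⊗ qpos v0 ⊕ qneg v1 ⊗ qneg v0)
    (pair (qpos v1 ⊗ qneg v0 ⊕ qneg v1 ⊗ qpos v0) (pred (qden v1 ⊗ qden v0))))))).

(** With [a] the truncated numerator and d the denominator, [a ⊖ (a ⊖ d)] is their minimum, so the
    value is cut off at 0 and at 1. *)
Definition qclamp_el : dom M (N ~> N) := sealed (eval own (lam
  (let a := qpos v0 ⊖ qneg v0 in
   pair (a ⊖ (a ⊖ qden v0)) (pair Zero (pred (qden v0)))))).

Definition mkq_el : dom M (N ~> N ~> N ~> N) := sealed (eval own (lam (lam (lam (pair v2 (pair v1 (pred v0))))))).
Definition pow2_el : dom M (N ~> N) := sealed (eval own (lam (pow2 v0))).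
Definition monus_el : dom M (N ~> N ~> N) := sealed (eval own (lam (lam (v1 ⊖ v0)))).
Definition pair_el : dom M (N ~> N ~> N) := sealed (eval own (lam (lam (pair v1 v0)))).
Definition fst_el : dom M (N ~> N) := sealed (eval own (lam (fst v0))).
Definition snd_el : dom M (N ~> N) := sealed (eval own (lam (snd v0))).

Lemma qadd_elE (p q : dom M N) : qadd_el ∙ p ∙ q =
  mkq (nqpos p * nqden q + nqpos q * nqden p) (nqneg p * nqden q + nqneg q * nqden p)
    (nqden p * nqden q).
Proof. by rewrite /qadd_el sealedE ?mkq_def !evalE. Qed.

Lemma qmul_elE (p q : dom M N) : qmul_el ∙ p ∙ q =
  mkq (nqpos p * nqpos q + nqneg p * nqneg q) (nqpos p * nqneg q + nqneg p * nqpos q)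
    (nqden p * nqden q).
Proof. by rewrite /qmul_el sealedE ?mkq_def !evalE. Qed.

Lemma qclamp_elE (q : dom M N) : qclamp_el ∙ q =
  mkq (nmonus (nmonus (nqpos q) (nqneg q)) (nmonus (nmonus (nqpos q) (nqneg q)) (nqden q))) 0
   (nqden q).
Proof. by rewrite /qclamp_el sealedE ?mkq_def !evalE. Qed.

Lemma mkq_elE (a b c : dom M N) : mkq_el ∙ a ∙ b ∙ c = mkq a b c.
Proof. by rewrite /mkq_el sealedE ?mkq_def !evalE. Qed.
Lemma pow2_elE (a : dom M N) : pow2_el ∙ a = npow2 a.
Proof. by rewrite /pow2_el sealedE ?mkq_def !evalE. Qed.
Lemma monus_elE (a b : dom M N) : monus_el ∙ a ∙ b = nmonus a b.
Proof. by rewrite /monus_el sealedE ?mkq_def !evalE. Qed.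
Lemma pair_elE (a b : dom M N) : pair_el ∙ a ∙ b = npair a b.
Proof. by rewrite /pair_el sealedE ?mkq_def !evalE. Qed.
Lemma fst_elE (a : dom M N) : fst_el ∙ a = nfst a.
Proof. by rewrite /fst_el sealedE ?mkq_def !evalE. Qed.
Lemma snd_elE (a : dom M N) : snd_el ∙ a = nsnd a.
Proof. by rewrite /snd_el sealedE ?mkq_def !evalE. Qed.

Definition val : nn M -> fld M := sealed (fun q => (ι (nqpos q) - ι (nqneg q)) / ι (nqden q)).

Lemma val_def q : val q = (ι (nqpos q) - ι (nqneg q)) / ι (nqden q).
Proof. by rewrite /val sealedE. Qed.

Lemma iotaS_gt0 n : 0 < ι (n + 1).
Proof. by rewrite iotaS; have := iota_ge0 n; lra. Qed.

Lemma nqden_gt0 q : 0 < ι (nqden q).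
Proof. by rewrite nqden_def iotaS_gt0. Qed.

Lemma valE q : val q * ι (nqden q) = ι (nqpos q) - ι (nqneg q).
Proof. by rewrite val_def divfK //; have := nqden_gt0 q; lra. Qed.

Lemma nqpos_mkq a b d : nqpos (mkq a b d) = a.
Proof. by rewrite nqpos_def mkq_def nfst_pair. Qed.

Lemma nqneg_mkq a b d : nqneg (mkq a b d) = b.
Proof.
by rewrite nqneg_def mkq_def nsnd_pair nfst_pair.
Qed.

Lemma nqden_mkq a b d : ι d != 0 -> nqden (mkq a b d) = d.
Proof.
by rewrite nqden_def mkq_def !nsnd_pair; have [->|<-//] := npredK d; rewrite iota0 eqxx.
Qed.

Lemma val_mkq a b d : ι d != 0 -> val (mkq a b d) = (ι a - ι b) / ι d.
Proof. by move=> d0; rewrite val_def nqpos_mkq nqneg_mkq nqden_mkq. Qed.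

Lemma val0 : val 0 = 0.
Proof.
have e : npair 0 0 = 0 by rewrite npair_def; ring.
have e1 : npred 1 = 0 :> nn M by rewrite -[X in npred X]add0r npredS.
have -> : (0 : nn M) = mkq 0 0 1 by rewrite mkq_def e1 !e.
by rewrite val_mkq iota1 ?oner_neq0 // iota0; lra.
Qed.

Lemma iota_qcden q r : ι (nqcden q r) = ι (nqden q) * ι (nqden r).
Proof. by rewrite /nqcden iotaM. Qed.

Lemma iota_qcden_gt0 q r : 0 < ι (nqcden q r).
Proof. by rewrite iota_qcden mulr_gt0 // nqden_gt0. Qed.

Lemma iota_qdiff q r : ι (nqdiff q r) = Num.max (val q - val r) 0 * ι (nqcden q r).
Proof.
rewrite /nqdiff iota_monus iota_qcden maxr_pMl ?mul0r ?mulr_ge0 ?iota_ge0 //; congr Num.max.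
transitivity (val q * ι (nqden q) * ι (nqden r) - val r * ι (nqden r) * ι (nqden q)); last by ring.
rewrite (valE q).
rewrite (valE r).
rewrite !iotaD.
rewrite !iotaM.
ring.
Qed.

Lemma iota_qabs q r : ι (nqabs q r) = `|val q - val r| * ι (nqcden q r).
Proof.
rewrite /nqabs iotaD !iota_qdiff !iota_qcden [ι (nqden r) * _]mulrC -mulrDl; congr (_ * _).
by move: (val q) (val r) => u w; case: (lerP (u - w) 0) => h; [rewrite ler0_norm ?max_l|rewrite gtr0_norm ?max_r]; lra.
Qed.

Lemma val_qdist q r : val (nqdist q r) = `|val q - val r|.
Proof.
have h := iota_qcden_gt0 q r.
by rewrite /nqdist val_mkq ?iota_qabs ?iota0 ?subr0 ?mulfK //; lra.
Qed.

End Arithmetic.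

(** * Reals *)

Section Reals.
Variable M : model.
Implicit Types (a b c d n m k i j p q : nn M) (x y z : dom M ty1) (r s : fld M).
Local Notation own := (@own_env M).
Local Notation ι := (@iota M).
Local Notation ee := (@ee M).

Definition apx x n : fld M := val (x ∙ n : nn M).

Definition isreal x := forall n i, `|apx x n - apx x (n + i)| < ee n.
Definition req x y := forall n, `|apx x n - apx y n| <= 2 * ee n.
Definition rlt x y := exists n, apx x n + 2 * ee n < apx y n.
(** Bounds by field elements, with the tolerance of [eqR] and [ltR]. Comparisons with rational
    constants reduce to them by [rlt_rcst_l] and [rlt_rcst_r]. *)
Definition ub x r := forall n, apx x n <= r + 2 * ee n.
Definition lb x r := forall n, r <= apx x n + 2 * ee n.

(** Both terms are compared with the term of index [n + m]. *)
Lemma isreal2 x n m : isreal x -> `|apx x n - apx x m| < ee n + ee m.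
Proof.
move=> h; have := h n m; have := h m n; rewrite [m + n]addrC !ltr_norml.
by move=> /andP [? ?] /andP [? ?]; apply/andP; split; lra.
Qed.

Lemma mul_norm_le (C e e' : fld M) : 0 <= e <= e' -> C * e <= `|C| * e'.
Proof.
move=> /andP [e0 ee']; apply: le_trans (ler_wpM2l (normr_ge0 C) ee').
by apply: ler_wpM2r => //; exact: ler_norm.
Qed.

(** The term at [n] is within [ee n + ee m] of the term at [m + k]; as [m] grows, both the error
    constant [C] and the index shift [k] disappear. *)
Lemma ub_tail x r k C : isreal x -> (forall n, apx x (n + k) <= r + C * ee n) ->
  forall n, apx x n <= r + ee n.
Proof.
move=> hx h n; apply: (@ee_lim M _ _ (`|C| + 1)) => m.
have := isreal2 n (m + k) hx; have := h m; rewrite ltr_norml mulrDl mul1r.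
have := ee_leD m k; have := ee_gt0 m => e0 ek hm /andP [h1 h2].
have := @mul_norm_le C (ee m) (ee m); rewrite lexx ltW // => /(_ isT); lra.
Qed.

Lemma lb_tail x r k C : isreal x -> (forall n, r <= apx x (n + k) + C * ee n) ->
  forall n, r <= apx x n + ee n.
Proof.
move=> hx h n; apply: (@ee_lim M _ _ (`|C| + 1)) => m.
have := isreal2 n (m + k) hx; have := h m; rewrite ltr_norml mulrDl mul1r.
have := ee_leD m k; have := ee_gt0 m => e0 ek hm /andP [h1 h2].
have := @mul_norm_le C (ee m) (ee m); rewrite lexx ltW // => /(_ isT); lra.
Qed.

Lemma ub_of_tail x r k C : isreal x -> (forall n, apx x (n + k) <= r + C * ee n) -> ub x r.
Proof. by move=> hx h n; have := ub_tail hx h n; have := ee_gt0 n; lra. Qed.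

Lemma lb_of_tail x r k C : isreal x -> (forall n, r <= apx x (n + k) + C * ee n) -> lb x r.
Proof. by move=> hx h n; have := lb_tail hx h n; have := ee_gt0 n; lra. Qed.

Lemma req_tail x y k C : isreal x -> isreal y ->
  (forall n, `|apx x (n + k) - apx y (n + k)| <= C * ee n) -> req x y.
Proof.
move=> hx hy h n; apply: (@ee_lim M _ _ (`|C| + 2)) => m.
have := isreal2 n (m + k) hx; have := isreal2 n (m + k) hy; have := h m.
have := ee_leD m k; have := ee_gt0 m => e0 ek.
have := @mul_norm_le C (ee m) (ee m); rewrite lexx ltW // mulrDl => /(_ isT).
rewrite !ltr_norml !ler_norml => ? /andP [? ?] /andP [? ?] /andP [? ?].
by apply/andP; split; lra.
Qed.

Lemma req_refl x : req x x.
Proof. by move=> n; rewrite subrr normr0; have := ee_gt0 n; lra. Qed.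

Lemma req_sym x y : req x y -> req y x.
Proof. by move=> h n; rewrite distrC. Qed.

Lemma req_trans x y z : isreal x -> isreal z -> req x y -> req y z -> req x z.
Proof.
move=> hx hz h1 h2; apply: (req_tail (k := 0) (C := 4)) => // n; rewrite addr0.
have := h1 n; have := h2 n; rewrite !ler_norml => /andP [? ?] /andP [? ?].
by apply/andP; split; lra.
Qed.

Lemma ub_req x y r : isreal y -> req x y -> ub x r -> ub y r.
Proof.
move=> hy xy h; apply: (ub_of_tail (k := 0) (C := 4)) => // n; rewrite addr0.
have := h n; have := xy n; rewrite ler_norml => /andP []; lra.
Qed.

Lemma lb_req x y r : isreal y -> req x y -> lb x r -> lb y r.
Proof.
move=> hy xy h; apply: (lb_of_tail (k := 0) (C := 4)) => // n; rewrite addr0.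
have := h n; have := xy n; rewrite ler_norml => /andP []; lra.
Qed.

Lemma ub_le x r s : r <= s -> ub x r -> ub x s.
Proof. by move=> rs h n; have := h n; lra. Qed.

Lemma lb_ub_le x r s : lb x r -> ub x s -> r <= s.
Proof. by move=> l u; apply: (@ee_lim M _ _ 4) => n; have := l n; have := u n; lra. Qed.

Lemma not_ub x r : ~ ub x r <-> exists n, r + 2 * ee n < apx x n.
Proof.
rewrite -existsNE; split=> -[n h]; exists n; last by rewrite lt_geF.
by move/negP: h; rewrite -real_ltNge ?num_real.
Qed.

Lemma not_lb x r : ~ lb x r <-> exists n, apx x n + 2 * ee n < r.
Proof.
rewrite -existsNE; split=> -[n h]; exists n; last by rewrite lt_geF.
by move/negP: h; rewrite -real_ltNge ?num_real.
Qed.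

Lemma not_ub_lb x r : isreal x -> ~ ub x r -> lb x r.
Proof.
move=> hx /not_ub [k hk]; apply: (lb_of_tail (k := k) (C := 1)) => // n.
have := isreal2 k (n + k) hx; rewrite ltr_norml => /andP [_].
by have := ee_leD k n; rewrite [k + n]addrC; have := ee_gt0 k; have := ee_gt0 n; lra.
Qed.

Definition rcst q : dom M ty1 := kcomb M N N ∙ (q : dom M N).

Lemma v_rcst q n : apx (rcst q) n = val q.
Proof. by rewrite /apx /rcst kcombE. Qed.

Lemma rlt_rcst_l x q : rlt (rcst q) x <-> ~ ub x (val q).
Proof. by rewrite not_ub; split=> -[n h]; exists n; rewrite v_rcst in h *. Qed.

Lemma rlt_rcst_r x q : rlt x (rcst q) <-> ~ lb x (val q).
Proof. by rewrite not_lb; split=> -[n h]; exists n; rewrite v_rcst in h *. Qed.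

Definition qone : nn M := mkq 1 0 1.

Lemma val_mkq1 a b : val (mkq a b 1) = ι a - ι b.
Proof. by rewrite val_mkq iota1 ?oner_neq0 // divr1. Qed.

Lemma val_qone : val qone = 1.
Proof. by rewrite val_mkq1 iota1 iota0 subr0. Qed.

Lemma isreal_rcst q : isreal (rcst q).
Proof. by move=> n i; rewrite !v_rcst subrr normr0 ee_gt0. Qed.

Lemma ub_rcst q r : ub (rcst q) r <-> val q <= r.
Proof.
split=> [h|h n]; last by rewrite v_rcst; have := ee_gt0 n; lra.
by apply: (@ee_lim M _ _ 2) => n; have := h n; rewrite v_rcst.
Qed.

Lemma lb_rcst q r : lb (rcst q) r <-> r <= val q.
Proof.
split=> [h|h n]; last by rewrite v_rcst; have := ee_gt0 n; lra.
by apply: (@ee_lim M _ _ 2) => n; have := h n; rewrite v_rcst.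
Qed.

Definition unit x := [/\ isreal x, lb x 0 & ub x 1].

Lemma unit0 : unit (rcst 0).
Proof.
by split; [exact: isreal_rcst|apply/lb_rcst|apply/ub_rcst]; rewrite val0 ?ler01.
Qed.

Lemma val_qadd (p q : dom M N) : val (qadd_el M ∙ p ∙ q : nn M) = val p + val q.
Proof.
have [dp dq] := conj (nqden_gt0 p) (nqden_gt0 q).
rewrite qadd_elE val_mkq !iotaM ?mulf_neq0 ?lt0r_neq0 // !iotaD !iotaM !val_def; field.
by rewrite !lt0r_neq0.
Qed.

Lemma val_qmul (p q : dom M N) : val (qmul_el M ∙ p ∙ q : nn M) = val p * val q.
Proof.
have [dp dq] := conj (nqden_gt0 p) (nqden_gt0 q).
rewrite qmul_elE val_mkq !iotaM ?mulf_neq0 ?lt0r_neq0 // !iotaD !iotaM !val_def; field.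
by rewrite !lt0r_neq0.
Qed.

Definition clampF r : fld M := if r <= 0 then 0 else if 1 <= r then 1 else r.

Lemma val_qclamp (q : dom M N) : val (qclamp_el M ∙ q : nn M) = clampF (val q).
Proof.
have dq := nqden_gt0 q.
rewrite qclamp_elE val_mkq ?lt0r_neq0 // iota0 subr0 !iota_monus -valE.
move: (val q) (ι _) dq => w t dq; have w0 : (w * t) / t = w by rewrite mulfK ?lt0r_neq0.
rewrite /clampF; case: (lerP w 0) => h1; last case: (lerP 1 w) => h2.
- have h : w * t <= 0 by rewrite pmulr_lle0.
  rewrite (max_r h) (max_r (x := 0 - t)); last by lra.
  by rewrite subr0 maxxx mul0r.
- have h : t <= w * t by rewrite ler_peMl // ltW.
  rewrite (max_l (x := w * t)); last by lra.
  rewrite (max_l (x := w * t - t)); last by lra.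
  by rewrite max_l; [rewrite (_ : _ - _ = t) ?mulfV ?lt0r_neq0 //; ring|lra].
- have h : w * t <= t by rewrite ger_pMl // ltW.
  have h' : 0 <= w * t by rewrite mulr_ge0 // ltW.
  rewrite (max_l (x := w * t)); last by lra.
  rewrite (max_r (x := w * t - t)); last by lra.
  by rewrite subr0 max_l.
Qed.

(** The Lipschitz constant 1 allows cutting off a real term by term without shifting indices. *)
Lemma clampF_lip r s : `|clampF r - clampF s| <= `|r - s|.
Proof.
rewrite ler_norml; have := ler_norm (r - s); have := ler_norm (s - r); rewrite [`|s - r|]distrC.
have := normr_ge0 (r - s); move: `|r - s| => w.
rewrite /clampF; case: (lerP r 0) => ?; case: (lerP s 0) => ?;
  try (case: (lerP 1 r) => ?); try (case: (lerP 1 s) => ?);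
  by move=> *; apply/andP; split; lra.
Qed.

Definition clamp_el : dom M (ty1 ~> ty1) :=
  sealed (eval own (lam (lam (Var (old (old (qclamp_el M))) @ (v1 @ v0))))).
Definition clamp x : dom M ty1 := clamp_el ∙ x.

Lemma v_clamp x n : apx (clamp x) n = clampF (apx x n).
Proof. by rewrite /apx /clamp /clamp_el sealedE !eval_lam /= val_qclamp. Qed.

(* [aff p c d x] is the real c x + d for rationals c and d; the index shift by p
   keeps it fast converging as long as |c| <= 2^p. *)
Definition aff_el : dom M (N ~> N ~> N ~> ty1 ~> ty1) := sealed (eval own (lam (lam (lam (lam (lam
  (Var (old (old (old (old (old (qadd_el M)))))) @
    (Var (old (old (old (old (old (qmul_el M)))))) @ Var (old (old (old new))) @
       (v1 @ (v0 ⊕ Var (old (old (old (old new)))))))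
    @ v2))))))).
Definition aff p c d x : dom M ty1 :=
  aff_el ∙ (p : dom M N) ∙ (c : dom M N) ∙ (d : dom M N) ∙ x.

Lemma v_aff p c d x n : apx (aff p c d x) n = val c * apx x (n + p) + val d.
Proof. by rewrite /apx /aff /aff_el sealedE !eval_lam /= val_qadd val_qmul. Qed.

Lemma isreal_clamp x : isreal x -> isreal (clamp x).
Proof. by move=> h n i; rewrite !v_clamp; apply: le_lt_trans (clampF_lip _ _) (h n i). Qed.

Lemma req_clamp x y : req x y -> req (clamp x) (clamp y).
Proof. by move=> h n; rewrite !v_clamp; apply: le_trans (clampF_lip _ _) (h n). Qed.

Lemma clampF_bounds r : 0 <= clampF r <= 1.
Proof. by rewrite /clampF; case: (lerP r 0) => ?; [|case: (lerP 1 r) => ?]; lra. Qed.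

Lemma unit_clamp x : isreal x -> unit (clamp x).
Proof.
move=> h; split; first exact: isreal_clamp.
  by move=> n; rewrite v_clamp; have := clampF_bounds (apx x n); have := ee_gt0 n; lra.
by move=> n; rewrite v_clamp; have := clampF_bounds (apx x n); have := ee_gt0 n; lra.
Qed.

Lemma clamp_unit x : unit x -> req (clamp x) x.
Proof.
move=> [h l u] n; rewrite v_clamp; have := l n; have := u n; have := ee_gt0 n.
move: (apx x n) (ee n) => w e.
by rewrite /clampF ler_norml; case: (lerP w 0) => ?; [|case: (lerP 1 w) => ?];
  move=> *; apply/andP; split; lra.
Qed.

Lemma clamp_eq0 x : isreal x -> req (clamp x) (rcst 0) <-> ub x 0.
Proof.
move=> hx; split=> [h|h n].
  (* At index [n + 2] the error is at most 1/2, which rules out that the term was cut off at 1. *)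
  apply: (ub_of_tail (k := 1 + 1) (C := 1)) => // n; have := h (n + (1 + 1)).
  rewrite v_clamp v_rcst val0 subr0 addrA !eeS ler_norml /clampF.
  have := ee_gt0 n; have := ee_le1 n; move: (apx x _) (ee n) => w e.
  by case: (lerP w 0) => ?; [|case: (lerP 1 w) => ?]; move=> ? ? /andP [_]; lra.
rewrite v_clamp v_rcst val0 subr0 ger0_norm; last by have /andP [] := clampF_bounds (apx x n).
have := h n; have := ee_gt0 n; rewrite /clampF; move: (apx x _) (ee n) => w e.
by case: (lerP w 0) => ?; [|case: (lerP 1 w) => ?]; lra.
Qed.

Lemma isreal_aff p c d x : `|val c| * ee p <= 1 -> isreal x -> isreal (aff p c d x).
Proof.
move=> h hx n i; rewrite !v_aff.
have -> : val c * apx x (n + p) + val d - (val c * apx x (n + i + p) + val d) =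
  val c * (apx x (n + p) - apx x (n + p + i)) by rewrite [n + i + p]addrAC; ring.
have := hx (n + p) i; rewrite normrM eeD.
have [->|c0] := eqVneq (val c) 0; first by rewrite normr0 mul0r ee_gt0.
rewrite -(ltr_pM2l (x := `|val c|)) ?normr_gt0 // => /lt_le_trans; apply.
by rewrite mulrCA ger_pMr ?ee_gt0.
Qed.

Lemma req_aff p c d x y : `|val c| * ee p <= 1 -> req x y -> req (aff p c d x) (aff p c d y).
Proof.
move=> h hx n; rewrite !v_aff.
have -> : val c * apx x (n + p) + val d - (val c * apx y (n + p) + val d) =
  val c * (apx x (n + p) - apx y (n + p)) by ring.
have := hx (n + p); rewrite normrM eeD.
move=> /(ler_wpM2l (normr_ge0 (val c)))/le_trans; apply.
rewrite (_ : `|val c| * _ = 2 * ee n * (`|val c| * ee p)); last by ring.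
by rewrite ger_pMr // mulr_gt0 ?ee_gt0.
Qed.

Lemma ub_aff p c d x r : `|val c| * ee p <= 1 -> 0 < val c -> isreal x ->
  ub (aff p c d x) r <-> ub x ((r - val d) / val c).
Proof.
move=> h c0 hx; have hy := isreal_aff d h hx; split=> u.
  apply: (ub_of_tail (k := p) (C := 2 / val c)) => // n.
  have := u n; rewrite v_aff => k; rewrite mulrAC -mulrDl ler_pdivlMr // mulrC; lra.
apply: (ub_of_tail (k := 0) (C := 2 * val c * ee p)) => // n; rewrite addr0 v_aff.
have := u (n + p); rewrite eeD => /(ler_wpM2l (ltW c0)).
rewrite mulrDr mulrCA mulfV ?lt0r_neq0 //.
have -> : 2 * val c * ee p * ee n = val c * (2 * (ee n * ee p)) by ring.
lra.
Qed.

Lemma ub_aff_neg p c d x r : `|val c| * ee p <= 1 -> val c < 0 -> isreal x ->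
  ub (aff p c d x) r <-> lb x ((r - val d) / val c).
Proof.
move=> h c0 hx; have hy := isreal_aff d h hx; split=> u.
  apply: (lb_of_tail (k := p) (C := - 2 / val c)) => // n.
  have := u n; rewrite v_aff => k; rewrite mulrAC -lerBlDr -mulrBl ler_ndivrMr // mulrC; lra.
apply: (ub_of_tail (k := 0) (C := - 2 * val c * ee p)) => // n; rewrite addr0 v_aff.
have := u (n + p); rewrite eeD => /(ler_wnM2l (ltW c0)).
rewrite mulrDr [val c * (_ / _)]mulrCA mulfV ?ltr0_neq0 //.
have -> : - 2 * val c * ee p * ee n = - (val c * (2 * (ee n * ee p))) by ring.
lra.
Qed.

End Reals.

(** * Meaning of the formulas in a model *)

Lemma all_iff (T : Type) (P Q : T -> Prop) :
  (forall x, P x <-> Q x) -> (forall x, P x) <-> (forall x, Q x).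
Proof. by move=> h; split=> k x; apply/h. Qed.

Lemma ex_iff (T : Type) (P Q : T -> Prop) :
  (forall x, P x <-> Q x) -> (exists x, P x) <-> (exists x, Q x).
Proof. by move=> h; split=> -[x /h]; exists x. Qed.

Lemma imp_iff (P P' Q Q' : Prop) : (P <-> P') -> (Q <-> Q') -> (P -> Q) <-> (P' -> Q').
Proof. by move=> -> ->. Qed.

Lemma and_iff (P P' Q Q' : Prop) : (P <-> P') -> (Q <-> Q') -> P /\ Q <-> P' /\ Q'.
Proof. by move=> -> ->. Qed.

Section Meaning.
Variable M : model.
Implicit Types (n : nn M) (x y z r : dom M ty1) (Y : dom M ty2) (A : dom M ty11).

Definition mem_of A x := isreal x /\ rlt (rcst 0) (A ∙ x).
Definition distr x y : dom M ty1 :=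
  eval (@own_env M) (distR (Var x) (Var y)).
Definition ufun Y := forall x y, unit x /\ unit y /\ req x y -> Y ∙ x = Y ∙ y.
Definition rfun Y := forall x y, isreal x /\ isreal y /\ req x y -> Y ∙ x = Y ∙ y.
Definition collides Y := exists x y, unit x /\ unit y /\ ~ req x y /\ Y ∙ x = Y ∙ y.
Definition omits Y := exists n, forall x, unit x -> ~ Y ∙ x = n.
Definition rset A := (forall x, isreal x -> isreal (A ∙ x)) /\
  (forall x y, isreal x /\ isreal y /\ req x y -> req (A ∙ x) (A ∙ y)).
Definition inj_on Y A := forall x y, mem_of A x /\ mem_of A y -> Y ∙ x = Y ∙ y -> req x y.
Definition surj_on Y A := forall n, exists x, mem_of A x /\ Y ∙ x = n.
Definition cnt A := exists Y, rfun Y /\ inj_on Y A.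
Definition scnt A := exists Y, rfun Y /\ inj_on Y A /\ surj_on Y A.
Definition closed_set A := forall x, isreal x /\ ~ mem_of A x ->
  exists r, isreal r /\ rlt (rcst 0) r /\
    forall y, isreal y /\ rlt (distr x y) r -> ~ mem_of A y.
Definition limpt x A := forall r, isreal r /\ rlt (rcst 0) r ->
  exists y, mem_of A y /\ ~ req y x /\ rlt (distr x y) r.
Definition perfect_set A := closed_set A /\ forall x, mem_of A x -> limpt x A.
Definition avoids (C : dom M ty11 -> Prop) := forall A, rset A /\ C A ->
  exists y, unit y /\ forall x, mem_of A x -> ~ req y x.
Definition imperfect (C : dom M ty11 -> Prop) := forall A,
  rset A /\ (forall x, mem_of A x -> unit x) /\ C A -> ~ perfect_set A.
Definition imperfect_inh (C : dom M ty11 -> Prop) := forall A,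
  rset A /\ (exists x, mem_of A x) /\ (forall x, mem_of A x -> unit x) /\ C A ->
  ~ perfect_set A.

Lemma eval_app V (e : env M V) s t (f : term V (s ~> t)) a :
  eval e (f @ a) = eval e f ∙ eval e a.
Proof. by []. Qed.

Lemma sat_lt V (e : env M V) (a b : term V N) :
  sat e (a ≺ b) <-> iota (eval e a : nn M) < iota (eval e b : nn M).
Proof. by rewrite iota_lt. Qed.

(** The formulas compare numerators over a common denominator; [c] is that denominator and cancels
    here. *)
Lemma scaled_lt (a c p : fld M) : 0 < c -> 0 < p -> (a * c * p < c) = (a < p^-1).
Proof. by move=> c0 p0; rewrite mulrAC gtr_pMl // -ltr_pdivlMr // div1r. Qed.

Lemma sat_is_real V (e : env M V) (x : term V ty1) : sat e (is_real x) <-> isreal (eval e x).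
Proof.
apply: all_iff => n; apply: all_iff => i; set xn := x↑↑ @ v1; set xni := x↑↑ @ (v1 ⊕ v0).
change (sat (econs i (econs n e)) (qabs xn xni ⊗ pow2 v1 ≺ qcden xn xni) <->
  `|apx (eval e x) n - apx (eval e x) ((n : nn M) + i)| < ee n).
rewrite sat_lt (eval_times _ (qabs xn xni)) eval_qabs eval_qcden eval_pow2 iotaM iota_qabs.
rewrite scaled_lt ?iota_qcden_gt0 ?pow2_gt0 //.
by rewrite /xn /xni !eval_app !eval_wk.
Qed.

Lemma sat_eqR V (e : env M V) (x y : term V ty1) : sat e (x =R y) <-> req (eval e x) (eval e y).
Proof.
apply: all_iff => n; set xn := x↑ @ v0; set yn := y↑ @ v0.
change (sat (econs n e) (qabs xn yn ⊗ pow2 v0 ≺ two ⊗ qcden xn yn) \/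
  eval (econs n e) (qabs xn yn ⊗ pow2 v0) = eval (econs n e) (two ⊗ qcden xn yn) <->
  `|apx (eval e x) n - apx (eval e y) n| <= 2 * ee n).
rewrite sat_lt (eval_times _ (qabs xn yn)) (eval_times _ two) eval_qabs eval_qcden eval_pow2.
set a := nqabs _ _ * _; set b := (eval _ two : nn M) * _.
have -> : (iota a < iota b \/ a = b) <-> iota a <= iota b.
  rewrite le_eqVlt; split=> [[->|->]|/orP [/eqP/iota_inj|]]; rewrite ?eqxx ?orbT //; by [left|right].
have e2 : iota (eval (econs n e) two : nn M) = 2.
  by rewrite /two eval_plus iotaD !iota1.
rewrite /a /b (iotaM _ (nqcden _ _)) (iotaM _ (npow2 _)) e2 iota_qabs mulrAC ler_pM2r ?iota_qcden_gt0 //.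
rewrite -ler_pdivlMr ?pow2_gt0 //.
by rewrite /xn /yn !eval_app !eval_wk.
Qed.

Lemma sat_ltR V (e : env M V) (x y : term V ty1) : sat e (x <R y) <-> rlt (eval e x) (eval e y).
Proof.
apply: ex_iff => n; set xn := x↑ @ v0; set yn := y↑ @ v0.
change (sat (econs n e) (two ⊗ qcden yn xn ≺ qdiff yn xn ⊗ pow2 v0) <->
  apx (eval e x) n + 2 * ee n < apx (eval e y) n).
rewrite sat_lt (eval_times _ (qdiff yn xn)) (eval_times _ two) eval_qdiff eval_qcden eval_pow2.
rewrite !(iotaM _ (nqcden _ _)) !(iotaM _ (npow2 _)) iota_qdiff.
have -> : iota (eval (econs n e) two : nn M) = 2.
  by rewrite /two eval_plus iotaD !iota1.
rewrite mulrAC ltr_pM2r ?iota_qcden_gt0 // -ltr_pdivrMr ?pow2_gt0 //.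
have -> : eval (econs n e) xn = eval e x ∙ n by rewrite /xn !eval_app !eval_wk.
have -> : eval (econs n e) yn = eval e y ∙ n by rewrite /yn !eval_app !eval_wk.
change (2 * ee n < Num.max (apx (eval e y) n - apx (eval e x) n) 0 <->
   apx (eval e x) n + 2 * ee n < apx (eval e y) n).
by have := ee_gt0 (n : nn M); rewrite lt_max => e0; split=> [/orP []|h]; [|lra|apply/orP; left]; lra.
Qed.

Lemma eval_oneR V (e : env M V) : eval e oneR = rcst (qone M).
Proof.
rewrite /oneR eval_app /rcst !eval_pair /qone mkq_def.
by rewrite -[X in npred X]add0r npredS.
Qed.

Lemma sat_in_unit V (e : env M V) (x : term V ty1) : sat e (in_unit x) <-> unit (eval e x).
Proof.
change (sat e (is_real x) /\ ~ sat e (x <R zeroR) /\ ~ sat e (oneR <R x) <-> unit (eval e x)).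
rewrite sat_is_real !sat_ltR eval_oneR rlt_rcst_l val_qone.
change (eval e zeroR) with (rcst (0 : nn M)); rewrite rlt_rcst_r val0.
by split=> [[h [/contrapT l /contrapT u]]|[h l u]]; split => //; split; apply.
Qed.

Lemma sat_mem V (e : env M V) (x : term V ty1) (A : term V ty11) : sat e (x ∈ A) <-> mem_of (eval e A) (eval e x).
Proof.
by change (sat e (is_real x) /\ sat e (zeroR <R A @ x) <-> mem_of (eval e A) (eval e x));
  rewrite sat_is_real sat_ltR.
Qed.

Lemma distr_app x y n : distr x y ∙ (n : dom M N) = nqdist (x ∙ (n + 1 : nn M)) (y ∙ (n + 1 : nn M)).
Proof. by rewrite /distr /distR eval_lam eval_qdist. Qed.

Lemma eval_distR V (e : env M V) (x y : term V ty1) : eval e (distR x y) = distr (eval e x) (eval e y).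
Proof.
apply: app_ext => n; rewrite distr_app /distR eval_lam eval_qdist.
by rewrite !eval_app !eval_wk.
Qed.

Lemma v_distr x y n : apx (distr x y) n = `|apx x (n + 1) - apx y (n + 1)|.
Proof. by rewrite /apx distr_app val_qdist. Qed.

End Meaning.

Section Leaves.
Variables (M : model) (V : ctx) (e : env M V).

Lemma leaf_is_real x x' : eval e x = x' -> sat e (is_real x) <-> isreal x'.
Proof. by move=> <-; exact: sat_is_real. Qed.
Lemma leaf_eqR x y x' y' : eval e x = x' -> eval e y = y' -> sat e (x =R y) <-> req x' y'.
Proof. by move=> <- <-; exact: sat_eqR. Qed.
Lemma leaf_ltR x y x' y' : eval e x = x' -> eval e y = y' -> sat e (x <R y) <-> rlt x' y'.
Proof. by move=> <- <-; exact: sat_ltR. Qed.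
Lemma leaf_in_unit x x' : eval e x = x' -> sat e (in_unit x) <-> unit x'.
Proof. by move=> <-; exact: sat_in_unit. Qed.
Lemma leaf_mem x A x' A' :
  eval e x = x' -> eval e A = A' -> sat e (x ∈ A) <-> mem_of A' x'.
Proof. by move=> <- <-; exact: sat_mem. Qed.
Lemma leaf_Eq (a b : term V N) a' b' :
  eval e a = a' -> eval e b = b' -> sat e (a == b) <-> a' = b'.
Proof. by move=> <- <-. Qed.

Lemma leaf_imp (p q : form V) P Q :
  (sat e p <-> P) -> (sat e q <-> Q) -> sat e (p ⇒ q) <-> (P -> Q).
Proof. exact: imp_iff. Qed.
Lemma leaf_neg (p : form V) P : (sat e p <-> P) -> sat e (¬ p) <-> ~ P.
Proof. by move=> h; apply: imp_iff. Qed.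
Lemma leaf_and (p q : form V) P Q :
  (sat e p <-> P) -> (sat e q <-> Q) -> sat e (p ∧ q) <-> P /\ Q.
Proof. exact: and_iff. Qed.
Lemma leaf_or (p q : form V) P Q :
  (sat e p <-> P) -> (sat e q <-> Q) -> sat e (p ∨ q) <-> P \/ Q.
Proof. by move=> /= -> ->. Qed.
Lemma leaf_all s (p : form (ext V s)) (P : dom M s -> Prop) :
  (forall d, sat (econs d e) p <-> P d) -> sat e (∀ s, p) <-> forall d, P d.
Proof. exact: all_iff. Qed.
Lemma leaf_ex s (p : form (ext V s)) (P : dom M s -> Prop) :
  (forall d, sat (econs d e) p <-> P d) -> sat e (∃ s, p) <-> exists d, P d.
Proof. exact: ex_iff. Qed.

End Leaves.

Ltac sat_leaf := first
  [ simple refine (leaf_in_unit _) | simple refine (leaf_is_real _)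
  | simple refine (leaf_mem _ _) | simple refine (leaf_eqR _ _)
  | simple refine (leaf_ltR _ _) | simple refine (leaf_Eq _ _) ];
  rewrite ?eval_distR ?eval_app ?eval_wk; reflexivity.
(** The recursion follows the semantic side, because the formula is hidden behind definitions and
    unfolds only by conversion. *)
Ltac sat_iff := cbv beta; lazymatch goal with
  | |- _ <-> ~ _ => simple refine (leaf_neg _); sat_iff
  | |- _ <-> (?A -> ?B) => simple refine (leaf_imp _ _); sat_iff
  | |- _ <-> (forall y, _) => simple refine (leaf_all _); intro; sat_iff
  | |- _ <-> (exists y, _) => simple refine (leaf_ex _); intro; sat_iff
  | |- _ <-> _ /\ _ => simple refine (leaf_and _ _); sat_iff
  | |- _ => sat_leaf end.

Section Meaning2.
Variable M : model.

Lemma sat_is_fun_unit_N V (e : env M V) Y : sat e (is_fun_unit_N Y) <-> ufun (eval e Y).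
Proof. by rewrite /ufun; sat_iff. Qed.

Lemma sat_is_fun_R_N V (e : env M V) Y : sat e (is_fun_R_N Y) <-> rfun (eval e Y).
Proof. by rewrite /rfun; sat_iff. Qed.

Lemma sat_collision V (e : env M V) Y : sat e (collision Y) <-> collides (eval e Y).
Proof. by rewrite /collides; sat_iff. Qed.

Lemma sat_is_set V (e : env M V) A : sat e (is_set A) <-> rset (eval e A).
Proof. by rewrite /rset; sat_iff. Qed.

Lemma sat_injective_on V (e : env M V) Y A :
  sat e (injective_on Y A) <-> inj_on (eval e Y) (eval e A).
Proof. by rewrite /inj_on; sat_iff. Qed.

Lemma sat_surjective_on V (e : env M V) Y A :
  sat e (surjective_on Y A) <-> surj_on (eval e Y) (eval e A).
Proof. by rewrite /surj_on; sat_iff. Qed.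

Lemma sat_countable V (e : env M V) A : sat e (countable A) <-> cnt (eval e A).
Proof.
apply: leaf_ex => Y; apply: leaf_and; first exact: sat_is_fun_R_N.
by have := sat_injective_on (econs Y e) v0 (A↑); rewrite eval_wk.
Qed.

Lemma sat_strongly_countable V (e : env M V) A :
  sat e (strongly_countable A) <-> scnt (eval e A).
Proof.
apply: leaf_ex => Y; apply: leaf_and; first exact: sat_is_fun_R_N.
apply: leaf_and.
  by have := sat_injective_on (econs Y e) v0 (A↑); rewrite eval_wk.
by have := sat_surjective_on (econs Y e) v0 (A↑); rewrite eval_wk.
Qed.

Lemma sat_limit_point V (e : env M V) x A :
  sat e (limit_point x A) <-> limpt (eval e x) (eval e A).
Proof. by rewrite /limpt; sat_iff. Qed.

Lemma sat_closed V (e : env M V) A : sat e (closed A) <-> closed_set (eval e A).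
Proof.
rewrite /closed_set; apply: leaf_all => x; apply: leaf_imp.
  by sat_iff.
apply: leaf_ex => r; apply: leaf_and; first by sat_leaf.
apply: leaf_and; first by sat_leaf.
apply: leaf_all => y; apply: leaf_imp; first by sat_iff.
apply: iff_trans (sat_fsub _ _ _) _; apply: leaf_neg; apply: leaf_mem => //.
by rewrite /twk eval_tsub.
Qed.

Lemma sat_perfect V (e : env M V) A : sat e (perfect A) <-> perfect_set (eval e A).
Proof.
apply: leaf_and; first exact: sat_closed.
apply: leaf_all => x; apply: leaf_imp; first by sat_leaf.
by have := sat_limit_point (econs x e) v0 (A↑); rewrite eval_wk.
Qed.

Lemma sat_NIN : sat (empty_env M) NIN <-> forall Y : dom M ty2, ufun Y -> collides Y.
Proof.
apply: leaf_all => Y; apply: leaf_imp; first exact: sat_is_fun_unit_N.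
exact: sat_collision.
Qed.

Lemma sat_NBI :
  sat (empty_env M) NBI <-> forall Y : dom M ty2, ufun Y -> collides Y \/ omits Y.
Proof.
apply: leaf_all => Y; apply: leaf_imp; first exact: sat_is_fun_unit_N.
suff h : sat (econs Y (empty_env M)) (∃ N, ∀ ty1, in_unit v0 ⇒ ¬ v2 @ v0 == v1) <-> omits Y.
  exact: (leaf_or (sat_collision _ _) h).
by rewrite /omits; sat_iff.
Qed.

Lemma sat_avoids (C : forall V, term V ty11 -> form V) (D : dom M ty11 -> Prop) :
  (forall V (e : env M V) A, sat e (C _ A) <-> D (eval e A)) ->
  sat (empty_env M) (avoids_point C) <-> avoids D.
Proof.
move=> CD; apply: leaf_all => A; apply: leaf_imp.
  by apply: leaf_and; [exact: sat_is_set|exact: CD].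
by sat_iff.
Qed.

Lemma sat_not_perfect (C : forall V, term V ty11 -> form V) (D : dom M ty11 -> Prop) :
  (forall V (e : env M V) A, sat e (C _ A) <-> D (eval e A)) ->
  sat (empty_env M) (not_perfect C) <-> imperfect D.
Proof.
move=> CD; apply: leaf_all => A; apply: leaf_imp; last first.
  by apply: leaf_imp => //; exact: sat_perfect.
apply: leaf_and; first exact: sat_is_set.
by apply: leaf_and; [apply: leaf_all => x; apply: leaf_imp; sat_leaf|exact: CD].
Qed.

Lemma sat_not_perfect_inh (C : forall V, term V ty11 -> form V) (D : dom M ty11 -> Prop) :
  (forall V (e : env M V) A, sat e (C _ A) <-> D (eval e A)) ->
  sat (empty_env M) (not_perfect_inh C) <-> imperfect_inh D.
Proof.
move=> CD; apply: leaf_all => A; apply: leaf_imp; last first.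
  by apply: leaf_imp => //; exact: sat_perfect.
apply: leaf_and; first exact: sat_is_set.
apply: leaf_and; first by apply: leaf_ex => x; sat_leaf.
by apply: leaf_and; [apply: leaf_all => x; apply: leaf_imp; sat_leaf|exact: CD].
Qed.

End Meaning2.

(** * The unit interval as a set, given an injection into the numbers *)

Section Definability.
Variable M : model.

(** Functionals of the model are obtained from the combinators, not by comprehension: a function of
    the metatheory counts only when an element represents it. *)
Definition dfn s t (f : dom M s -> dom M t) := exists F : dom M (s ~> t), forall x, F ∙ x = f x.

Lemma dfn_const s t (c : dom M t) : dfn (fun _ : dom M s => c).
Proof. by exists (kcomb M t s ∙ c) => x; exact: kcombE. Qed.

Lemma dfn_id s : dfn (fun x : dom M s => x).
Proof. by exists (scomb M s (s ~> s) s ∙ kcomb M s (s ~> s) ∙ kcomb M s s) => x; rewrite scombE kcombE. Qed.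

Lemma dfn_app s t u (f : dom M s -> dom M (t ~> u)) g : dfn f -> dfn g -> dfn (fun x => f x ∙ g x).
Proof. by move=> [F hF] [G hG]; exists (scomb M s t u ∙ F ∙ G) => x; rewrite scombE hF hG. Qed.

Lemma dfn_app1 s t u (F : dom M (t ~> u)) (g : dom M s -> dom M t) : dfn g -> dfn (fun x => F ∙ g x).
Proof. exact/dfn_app/dfn_const. Qed.

Lemma dfn_plus s (f g : dom M s -> nn M) :
  @dfn s N f -> @dfn s N g -> @dfn s N (fun x => f x + g x).
Proof. by move=> hf hg; exact: (dfn_app (dfn_app1 (plus M) hf) hg). Qed.

Lemma dfn_times s (f g : dom M s -> nn M) :
  @dfn s N f -> @dfn s N g -> @dfn s N (fun x => f x * g x).
Proof. by move=> hf hg; exact: (dfn_app (dfn_app1 (times M) hf) hg). Qed.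

Lemma dfn_eq s t (f g : dom M s -> dom M t) : (forall x, f x = g x) -> dfn f -> dfn g.
Proof. by move=> e [F h]; exists F => x; rewrite h e. Qed.

Lemma dfn_monus s (f g : dom M s -> nn M) :
  @dfn s N f -> @dfn s N g -> @dfn s N (fun x => nmonus (f x) (g x)).
Proof.
move=> hf hg; apply: dfn_eq (dfn_app (dfn_app1 (monus_el M) hf) hg) => x; exact: monus_elE.
Qed.

Lemma dfn_mkq s (f g h : dom M s -> nn M) :
  @dfn s N f -> @dfn s N g -> @dfn s N h -> @dfn s N (fun x => mkq (f x) (g x) (h x)).
Proof.
move=> hf hg hh; apply: dfn_eq (dfn_app (dfn_app (dfn_app1 (mkq_el M) hf) hg) hh) => x.
exact: mkq_elE.
Qed.

Lemma dfn_pow2 s (f : dom M s -> nn M) : @dfn s N f -> @dfn s N (fun x => npow2 (f x)).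
Proof. by move=> hf; apply: dfn_eq (dfn_app1 (pow2_el M) hf) => x; exact: pow2_elE. Qed.

Lemma dfn_pair s (f g : dom M s -> nn M) :
  @dfn s N f -> @dfn s N g -> @dfn s N (fun x => npair (f x) (g x)).
Proof.
move=> hf hg; apply: dfn_eq (dfn_app (dfn_app1 (pair_el M) hf) hg) => x; exact: pair_elE.
Qed.

Lemma dfn_fst s (f : dom M s -> nn M) : @dfn s N f -> @dfn s N (fun x => nfst (f x)).
Proof. by move=> hf; apply: dfn_eq (dfn_app1 (fst_el M) hf) => x; exact: fst_elE. Qed.

Lemma dfn_snd s (f : dom M s -> nn M) : @dfn s N f -> @dfn s N (fun x => nsnd (f x)).
Proof. by move=> hf; apply: dfn_eq (dfn_app1 (snd_el M) hf) => x; exact: snd_elE. Qed.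

Lemma dfn_aff s (p c d : dom M s -> nn M) (f : dom M s -> dom M ty1) :
  @dfn s N p -> @dfn s N c -> @dfn s N d -> dfn f ->
  dfn (fun x => aff (p x) (c x) (d x) (f x)).
Proof.
by move=> hp hc hd hf; exact: (dfn_app (dfn_app (dfn_app (dfn_app1 (aff_el M) hp) hc) hd) hf).
Qed.

Lemma dfn_clamp s (f : dom M s -> dom M ty1) : dfn f -> dfn (fun x => clamp (f x)).
Proof. exact: dfn_app1. Qed.

(** Truth is coded by the value 0, so that sums express conjunctions, products disjunctions, and
    [nnot] negation. *)
Definition neqn (a b : nn M) : nn M := nmonus a b + nmonus b a.

Lemma neqn_eq0 a b : neqn a b = 0 <-> a = b.
Proof.
split=> [h|->]; last first.
  by apply: iota_inj; rewrite /neqn iotaD iota_monus subrr maxxx addr0 iota0.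
have h1 := n_add0 h; rewrite /neqn addrC in h; have h2 := n_add0 h.
move/nmonus_eq0: h1 => h1; move/nmonus_eq0: h2 => h2.
by apply: iota_inj; apply/eqP; rewrite eq_le h1.
Qed.

Lemma dfn_neqn s (f g : dom M s -> nn M) :
  @dfn s N f -> @dfn s N g -> @dfn s N (fun x => neqn (f x) (g x)).
Proof. by move=> hf hg; apply: dfn_plus; apply: dfn_monus. Qed.

Definition nnot (a : nn M) : nn M := nmonus 1 a.

Lemma nnot_eq0 a : nnot a = 0 <-> a <> 0.
Proof.
rewrite /nnot nmonus_eq0 iota1; split=> [h e|h].
  by move: h; rewrite e iota0; lra.
have [e|k] := n0_or_pos a; first by case: h.
by move/iota_lt: k => /iota_discrete; rewrite iota0; lra.
Qed.

Lemma dfn_nnot s (f : dom M s -> nn M) : @dfn s N f -> @dfn s N (fun x => nnot (f x)).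
Proof. by move=> hf; apply: dfn_monus => //; exact: dfn_const. Qed.

Lemma nadd_eq0 (a b : nn M) : a + b = 0 <-> a = 0 /\ b = 0.
Proof.
split=> [h|[-> ->]]; last by rewrite addr0.
by have h1 := n_add0 h; split=> //; rewrite addrC in h; exact: n_add0 h.
Qed.

End Definability.

(** * [0,1] is perfect, and decidable under an injection *)

Section UnitInterval.
Variable M : model.
Implicit Types (n m k : nn M) (x y z r : dom M ty1) (A : dom M ty11).

Definition qee n : nn M := mkq 1 0 (npow2 n).
Definition qmee n : nn M := mkq 0 1 (npow2 n).

Lemma val_qee n : val (qee n) = ee n.
Proof. by rewrite val_mkq ?lt0r_neq0 ?pow2_gt0 // iota1 iota0 subr0 div1r. Qed.

Lemma val_qmee n : val (qmee n) = - ee n.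
Proof. by rewrite val_mkq ?lt0r_neq0 ?pow2_gt0 // iota1 iota0 sub0r mulN1r. Qed.

Lemma qone_small : `|val (qone M)| * ee (0 : nn M) <= 1.
Proof. by rewrite val_qone ee0 normr1 mulr1. Qed.

Lemma v_shift d x n : apx (aff 0 (qone M) d x) n = apx x n + val d.
Proof. by rewrite v_aff val_qone mul1r addr0. Qed.

(** Lying outside [0,1] is witnessed at one index [n] by a margin of [2 * ee n], and a point closer
    than [ee n] cannot make up for it. *)
Lemma unit_complement_open x : isreal x /\ ~ unit x ->
  exists r, isreal r /\ rlt (rcst 0) r /\
    forall y, isreal y /\ rlt (distr x y) r -> ~ unit y.
Proof.
move=> [hx nu].
suff [n h] : exists n, forall y m, isreal y -> apx (distr x y) m + 2 * ee m < ee n -> ~ unit y.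
  exists (rcst (qee n)); split; first exact: isreal_rcst.
  split; first by apply/rlt_rcst_l; rewrite ub_rcst val_qee val0; have := ee_gt0 n; lra.
  by move=> y [hy] /rlt_rcst_r/not_lb [m]; rewrite val_qee; exact: h.
(* The index [k] lies beyond both [n] and [m + 1]. The two Cauchy errors cost [ee m] in total and
   [2 * ee k] at most a quarter of [ee m], within the slack [2 * ee m] of the witness. *)
have key y m n : isreal y -> apx (distr x y) m + 2 * ee m < ee n ->
    let k := n + (m + 1 + 1 + 1) in `|apx x k - apx y k| + 2 * ee k < ee n /\ `|apx x k - apx x n| < ee n.
  move=> hy h k.
  have hk : k = m + 1 + (n + 1 + 1) by rewrite /k; ring.
  have := hx (m + 1) (n + 1 + 1); have := hy (m + 1) (n + 1 + 1); rewrite -hk.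
  have := hx n (m + 1 + 1 + 1); rewrite -/k distrC => -> hy' hx'; split=> //.
  have ek : ee k <= ee m / 8.
    have := ee_leD (m + 1 + 1 + 1) n; rewrite addrC -/k !eeS; lra.
  move: h; rewrite v_distr; have := ee_gt0 m; rewrite eeS in hx' hy'.
  have : `|apx x k - apx y k| <= `|apx x (m + 1) - apx x k| + `|apx x (m + 1) - apx y (m + 1)| + `|apx y (m + 1) - apx y k|.
    rewrite [`|apx x (m + 1) - apx x k|]distrC.
    apply: le_trans (lerD (ler_normD _ _) (lexx _)); apply: le_trans (ler_normD _ _).
    by rewrite le_eqVlt; apply/orP; left; apply/eqP; congr `|_|; ring.
  move: `|_ - apx y k| `|_ - apx x k| `|apx x (m + 1) - apx y (m + 1)| `|apx y (m + 1) - _| hx' hy' => a b c d *.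
  lra.
case: (pselect (lb x 0)) => [l|/not_lb [n hn]]; last first.
  exists n => y m hy /(key y m n hy) /= [h1 h2] [_ l _].
  have := l (n + (m + 1 + 1 + 1)); have := ee_gt0 n.
  move: h1 h2; rewrite -ltrBrDr !ltr_norml => /andP [? ?] /andP [? ?]; lra.
have /not_ub [n hn] : ~ ub x 1 by move=> u; apply: nu.
exists n => y m hy /(key y m n hy) /= [h1 h2] [_ _ u].
have := u (n + (m + 1 + 1 + 1)); have := ee_gt0 n.
move: h1 h2; rewrite -ltrBrDr !ltr_norml => /andP [? ?] /andP [? ?]; lra.
Qed.

(** The nearby point is a small translate: to the right if x is at most 1/2, to the left otherwise,
    so that it remains in [0,1]. *)
Lemma unit_limpt x : unit x -> forall r, isreal r /\ rlt (rcst 0) r ->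
  exists y, unit y /\ ~ req y x /\ rlt (distr x y) r.
Proof.
move=> [hx l u] r [hr /rlt_rcst_l/not_ub [n]]; rewrite val0 add0r => hn.
(* With a quarter, the distance plus the tolerance of [rlt] is 3/4 of [ee n], just below the term of
   [r] at [j0]; and a translation by at most 1/4 does not leave [0,1]. *)
have [j0 eN] : exists j, ee j = ee n / 4 by exists (n + 1 + 1); rewrite !eeS; lra.
have e0 := ee_gt0 n; have e1 := ee_le1 n.
have near d : `|val d| = ee j0 -> isreal (aff 0 (qone M) d x) /\
    ~ req (aff 0 (qone M) d x) x /\ rlt (distr x (aff 0 (qone M) d x)) r.
  move=> hd; split; first exact: isreal_aff qone_small hx.
  split=> [h|].
    have := h (j0 + 1 + 1); rewrite v_shift [apx x _ + _]addrC addrK hd !eeS eN; lra.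
  exists j0; rewrite v_distr v_shift opprD addNKr normrN hd eN.
  have := isreal2 n j0 hr; rewrite eN ltr_norml => /andP [_]; lra.
case: (pselect (ub x (1/2))) => [u2|/not_ub [k hk]].
  have [|h1 [h2 h3]] := near (qee j0); first by rewrite val_qee gtr0_norm ?ee_gt0.
  exists (aff 0 (qone M) (qee j0) x); split=> //; split=> // j; rewrite v_shift val_qee eN.
    by have := l j; lra.
  by have := u2 j; lra.
have [|h1 [h2 h3]] := near (qmee j0); first by rewrite val_qmee normrN gtr0_norm ?ee_gt0.
exists (aff 0 (qone M) (qmee j0) x); split=> //; split=> // j; rewrite v_shift val_qmee eN.
  have := isreal2 k j hx; rewrite ltr_norml => /andP [_].
  have := ee_gt0 k; have := ee_gt0 j; lra.
by have := u j; lra.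
Qed.

Lemma unit_perfect A : (forall x, mem_of A x <-> unit x) -> perfect_set A.
Proof.
move=> h; split=> [x [hx nx]|x /h/unit_limpt hx r /hx [y [hy [h1 h2]]]].
  have [|r [hr [r0 hy]]] := @unit_complement_open x; first by split=> // /h.
  by exists r; split=> //; split=> // y /hy nu /h.
by exists y; split=> //; apply/h.
Qed.

Section Injection.
Variable Y : dom M ty2.
Hypothesis Yfun : ufun Y.
Hypothesis Yinj : ~ collides Y.

Lemma Y_eq x y : unit x -> unit y -> Y ∙ x = Y ∙ y <-> req x y.
Proof.
move=> hx hy; split=> [e|e]; last exact: Yfun.
by apply: contrapT => n; apply: Yinj; exists x, y.
Qed.

Definition decide x : nn M := neqn (Y ∙ clamp x) (Y ∙ rcst 0).

Lemma decideP x : isreal x -> decide x = 0 <-> ub x 0.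
Proof.
move=> hx; rewrite neqn_eq0 -clamp_eq0 //.
by apply: Y_eq; [exact: unit_clamp|exact: unit0].
Qed.

Lemma dfn_decide s (f : dom M s -> dom M ty1) : dfn f -> @dfn M s N (fun w => decide (f w)).
Proof.
by move=> hf; apply: dfn_neqn; [apply/dfn_app1/dfn_clamp|exact: dfn_const].
Qed.

Lemma decide_req x y : isreal x -> isreal y -> req x y -> decide x = decide y.
Proof.
move=> hx hy h; rewrite /decide; congr neqn; apply: Yfun.
by split; [exact: unit_clamp|split; [exact: unit_clamp|exact: req_clamp]].
Qed.

(* [out x] vanishes iff x lies in the unit interval. *)
Definition out x : nn M := decide (aff 0 (qmee 0) 0 x) + decide (aff 0 (qone M) (qmee 0) x).

Lemma qmee_small : `|val (qmee 0)| * ee (0 : nn M) <= 1.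
Proof. by rewrite val_qmee ee0 normrN1 mulr1. Qed.

Lemma outP x : isreal x -> out x = 0 <-> unit x.
Proof.
move=> hx; have h1 := isreal_aff 0 qmee_small hx.
have h2 := isreal_aff (qmee 0) qone_small hx.
rewrite nadd_eq0 !decideP // ub_aff_neg ?qmee_small //; last by rewrite val_qmee ee0 ltrN10.
rewrite ub_aff ?qone_small //; last by rewrite val_qone.
rewrite val0 subrr mul0r val_qone val_qmee ee0 opprK add0r divr1.
by split=> [[]|[]].
Qed.

Lemma out_req x y : isreal x -> isreal y -> req x y -> out x = out y.
Proof.
move=> hx hy h; rewrite /out; congr (_ + _); apply: decide_req.
all: by [apply: isreal_aff qmee_small _|apply: isreal_aff qone_small _|
  apply: req_aff qmee_small _|apply: req_aff qone_small _].
Qed.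

(** The values are the constant reals 1 and 0; extensionality, which a set of reals requires, comes
    from [out_req]. *)
Lemma unit_set : exists A, rset A /\ forall x, mem_of A x <-> unit x.
Proof.
have [A hA] : @dfn M ty1 ty1 (fun x => rcst (mkq (nnot (out x)) 0 1)).
  apply/dfn_app1/dfn_mkq; try exact: dfn_const.
  by apply/dfn_nnot/dfn_plus; apply/dfn_decide/dfn_aff; try exact: dfn_const; exact: dfn_id.
exists A; split; first split.
- by move=> x hx; rewrite hA; exact: isreal_rcst.
- by move=> x y [hx [hy e]]; rewrite !hA (out_req hx hy e); exact: req_refl.
- move=> x; rewrite /mem_of hA rlt_rcst_l ub_rcst val0 val_mkq1 iota0 subr0.
  have ht : iota (nnot (out x)) <= 0 <-> out x <> 0.
    rewrite -nnot_eq0; split=> [h|->]; last by rewrite iota0.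
    by apply: iota_inj; apply/eqP; rewrite iota0 eq_le h iota_ge0.
  rewrite ht; split=> [[hx /contrapT/outP]|hu]; first by apply.
  by have [hx _ _] := hu; split=> // k; apply: k; apply/(outP hx).
Qed.

Lemma unit_set_countable A : (forall x, mem_of A x <-> unit x) ->
  exists Z, rfun Z /\ inj_on Z A /\ (~ omits Y -> surj_on Z A).
Proof.
move=> hA; have [Z hZ] : @dfn M ty1 N (fun x => Y ∙ clamp x).
  by apply/dfn_app1/dfn_clamp/dfn_id.
exists Z; split; [|split].
- move=> x y [hx [hy e]]; rewrite !hZ; apply: Yfun.
  by split; [exact: unit_clamp|split; [exact: unit_clamp|exact: req_clamp]].
- move=> x y [/hA hx /hA hy]; have [[rx _ _] [ry _ _]] := conj hx hy.
  rewrite !hZ Y_eq; try exact: unit_clamp.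
  move=> e; apply: req_trans (clamp_unit hy) => //.
  by apply: req_trans e => //; [exact: isreal_clamp|apply/req_sym/clamp_unit].
- move=> ho n; apply: contrapT => hn; apply: ho; exists n => x hx e; apply: hn.
  exists x; split; first exact/hA.
  rewrite hZ -e; apply: Yfun; have [rx _ _] := hx.
  by split; [exact: unit_clamp|split=> //; exact: clamp_unit].
Qed.

End Injection.

(** If every point of [0,1] equals a member of [A], extensionality of [A] puts all of [0,1] into
    [A], and NIN applies to the functional [Y] counting [A]. *)
Lemma NIN_avoids : (forall Y : dom M ty2, ufun Y -> collides Y) -> avoids (@cnt M).
Proof.
move=> nin A [[Ar Ae] [Y [Yr Yi]]]; apply: contrapT => no.
have inA y : unit y -> mem_of A y.
  move=> hy; apply: contrapT => ny; apply: no; exists y; split=> // x [hx xA] e.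
  apply: ny; have [ry _ _] := hy; split=> //.
  apply/rlt_rcst_l => /(ub_req (Ar _ hx) (Ae _ _ (conj ry (conj hx e)))) k.
  by move/rlt_rcst_l: xA.
have [x [y [hx [hy [ne e]]]]] : collides Y.
  by apply: nin => x y [[hx _ _] [[hy _ _] e]]; exact: Yr.
by apply: ne; apply: Yi e; split; exact: inA.
Qed.

Lemma avoids_NIN : avoids (@cnt M) -> forall Y : dom M ty2, ufun Y -> collides Y.
Proof.
move=> av Y Yf; apply: contrapT => Yi; have [A [As hA]] := unit_set Yf Yi.
have [Z [Zr [Zi _]]] := unit_set_countable Yf Yi hA.
have [|y [hy /(_ y)]] := av A; first by split=> //; exists Z.
by move/(_ ((hA y).2 hy))/(_ (req_refl y)).
Qed.

Lemma avoids_NBI : avoids (@scnt M) -> forall Y : dom M ty2, ufun Y -> collides Y \/ omits Y.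
Proof.
move=> av Y Yf; case: (pselect (collides Y)) => [|Yi]; [by left|right].
apply: contrapT => no; have [A [As hA]] := unit_set Yf Yi.
have [Z [Zr [Zi Zs]]] := unit_set_countable Yf Yi hA.
have [|y [hy /(_ y)]] := av A.
  by split=> //; exists Z; split=> //; split=> //; exact: Zs.
by move/(_ ((hA y).2 hy))/(_ (req_refl y)).
Qed.

(** The perfect set produced is [0,1], which contains 0, so the restriction to inhabited sets is
    harmless. *)
Lemma imperfect_inh_NIN : imperfect_inh (@cnt M) -> forall Y : dom M ty2, ufun Y -> collides Y.
Proof.
move=> imp Y Yf; apply: contrapT => Yi; have [A [As hA]] := unit_set Yf Yi.
have [Z [Zr [Zi _]]] := unit_set_countable Yf Yi hA.
apply: (imp A); last exact: unit_perfect.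
split=> //; split; first by exists (rcst 0); apply/hA; exact: unit0.
by split=> [x /hA //|]; exists Z.
Qed.

Lemma imperfect_NIN : imperfect (@cnt M) -> forall Y : dom M ty2, ufun Y -> collides Y.
Proof. by move=> imp; apply: imperfect_inh_NIN => A [h1 [_ h2]]; exact: imp. Qed.

Lemma imperfect_NBI : imperfect (@scnt M) ->
  forall Y : dom M ty2, ufun Y -> collides Y \/ omits Y.
Proof.
move=> imp Y Yf; case: (pselect (collides Y)) => [|Yi]; [by left|right].
apply: contrapT => no; have [A [As hA]] := unit_set Yf Yi.
have [Z [Zr [Zi Zs]]] := unit_set_countable Yf Yi hA.
apply: (imp A); last exact: unit_perfect.
by split=> //; split=> [x /hA //|]; exists Z; split=> //; split=> //; exact: Zs.
Qed.

End UnitInterval.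

(** * From NBI to a point outside a strongly countable set *)

Section Scaling.
Variable M : model.
Implicit Types (n m k p s c : nn M) (x y z b : dom M ty1) (A : dom M ty11) (r : fld M).
Local Notation pw k := (iota (npow2 k)).

(** Once a property has a characteristic functional in the model, induction for it is
    quantifier-free, with the functional as a parameter. *)
Lemma dfn_ind (f : nn M -> nn M) : @dfn M N N f ->
  f 0 = 0 -> (forall n, f n = 0 -> f (n + 1) = 0) -> forall n, f n = 0.
Proof.
move=> [F hF] f0 fS; apply: (nn_ind (A := Var (old F) @ v0 == Zero)) => // n.
by rewrite -hF.
Qed.

Lemma lb_req_iff x y r : isreal x -> isreal y -> req x y -> lb x r <-> lb y r.
Proof. by move=> hx hy h; split; apply: lb_req => //; exact: req_sym. Qed.

Lemma ub_req_iff x y r : isreal x -> isreal y -> req x y -> ub x r <-> ub y r.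
Proof. by move=> hx hy h; split; apply: ub_req => //; exact: req_sym. Qed.

Lemma unit_req x y : isreal y -> req x y -> unit x -> unit y.
Proof. by move=> hy h [hx l u]; split=> //; [exact: lb_req h l|exact: ub_req h u]. Qed.

Lemma not_lb_ub x r : isreal x -> ~ lb x r -> ub x r.
Proof.
move=> hx /not_lb [k hk]; apply: (ub_of_tail (k := k) (C := 1)) => // n.
have := isreal2 k (n + k) hx; rewrite ltr_norml => /andP [].
by have := ee_leD k n; rewrite [k + n]addrC; have := ee_gt0 k; have := ee_gt0 n; lra.
Qed.

Lemma lb_le x r r' : r' <= r -> lb x r -> lb x r'.
Proof. by move=> rs h n; have := h n; lra. Qed.

Lemma lb_aff_neg p c d x r : `|val c| * ee p <= 1 -> val c < 0 -> isreal x ->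
  lb (aff p c d x) r <-> ub x ((r - val d) / val c).
Proof.
move=> h c0 hx; have hy := isreal_aff d h hx; split=> u.
  apply: (ub_of_tail (k := p) (C := - 2 / val c)) => // n.
  have := u n; rewrite v_aff => k; rewrite mulrAC -mulrDl ler_ndivlMr // mulrC; lra.
apply: (lb_of_tail (k := 0) (C := - 2 * val c * ee p)) => // n; rewrite addr0 v_aff.
have := u (n + p); rewrite eeD => /(ler_wnM2l (ltW c0)).
rewrite mulrDr [val c * (_ / _)]mulrCA mulfV ?ltr0_neq0 //.
have -> : - 2 * val c * ee p * ee n = - (val c * (2 * (ee n * ee p))) by ring.
lra.
Qed.

Lemma req_aff_inj p c d x y : val c != 0 -> isreal x -> isreal y ->
  req (aff p c d x) (aff p c d y) -> req x y.
Proof.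
move=> c0 hx hy h; apply: (req_tail (k := p) (C := 2 / `|val c|)) => // n.
have := h n; rewrite !v_aff.
have -> : val c * apx x (n + p) + val d - (val c * apx y (n + p) + val d) =
  val c * (apx x (n + p) - apx y (n + p)) by ring.
by rewrite normrM => h2; rewrite mulrAC ler_pdivlMr ?normr_gt0 // mulrC.
Qed.

Lemma mem_req A x y : rset A -> isreal y -> req x y -> mem_of A x -> mem_of A y.
Proof.
move=> [Ar Ae] hy e [hx xA]; split=> //; apply/rlt_rcst_l => k.
move/rlt_rcst_l: xA; apply; apply: ub_req k; first exact: Ar.
by apply: Ae; split=> //; split=> //; exact: req_sym.
Qed.

Lemma pwD n m : pw (n + m) = pw n * pw m.
Proof. by rewrite npow2D iotaM. Qed.

Lemma pw_ge1 n : 1 <= pw n.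
Proof. by have := ee_le1 n; have := pow2_gt0 n; rewrite /ee => h; rewrite invf_le1. Qed.

Lemma n_total n m : n = m \/ (exists c, m = n + 1 + c) \/ exists c, n = m + 1 + c.
Proof.
have [/nlt_ex [c ->]|[->|/nlt_ex [c ->]]] := nlt_total n m; [right; left|by left|right; right];
  by exists c; rewrite [c + 1]addrC addrA.
Qed.

(* y lies in (2^-(m+1), 2^-m] *)
Definition dyadic y m := ub y (ee m) /\ ~ ub y (ee (m + 1)).

Lemma dyadic_uniq y m m' : dyadic y m -> dyadic y m' -> m = m'.
Proof.
move=> [h1 h2] [k1 k2]; have [//|[[c e]|[c e]]] := n_total m m'.
  by case: h2; apply: ub_le k1; rewrite e; exact: ee_leD.
by case: k2; apply: ub_le h1; rewrite e; exact: ee_leD.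
Qed.

Lemma dyadic_req y z m : isreal y -> isreal z -> req y z -> dyadic y m -> dyadic z m.
Proof. by move=> hy hz h [h1 h2]; split; rewrite -(ub_req_iff _ hy hz h). Qed.

Lemma dyadic_pos y m : dyadic y m -> ~ ub y 0.
Proof. by move=> [_ h] u; apply: h; apply: ub_le u; exact/ltW/ee_gt0. Qed.

Lemma dyadic_unit y m : isreal y -> dyadic y m -> unit y.
Proof.
move=> hy [h1 h2]; split=> //; last by apply: ub_le h1; exact: ee_le1.
by apply: lb_le (not_ub_lb hy h2); exact/ltW/ee_gt0.
Qed.

(** Multiplication by 2^p, which moves a dyadic interval up by [p] places. *)
Definition up p y : dom M ty1 := aff p (mkq (npow2 p) 0 1) 0 y.

Lemma val_up p : val (mkq (npow2 p) 0 1) = pw p.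
Proof. by rewrite val_mkq1 iota0 subr0. Qed.

Lemma up_small p : `|val (mkq (npow2 p) 0 1)| * ee p <= 1.
Proof. by rewrite val_up gtr0_norm ?pow2_gt0 // pow2_ee. Qed.

Lemma isreal_up p y : isreal y -> isreal (up p y).
Proof. exact/isreal_aff/up_small. Qed.

Lemma dyadic_up p y m : isreal y -> dyadic (up p y) m <-> dyadic y (m + p).
Proof.
have vp : 0 < val (mkq (npow2 p) 0 1) by rewrite val_up pow2_gt0.
move=> hy; rewrite /dyadic !(ub_aff 0 _ (up_small p) vp hy) val0 !subr0 val_up.
by rewrite addrAC !eeD.
Qed.

(* The code m = <n, <s, k>> of a dyadic piece (2^-(m+1), 2^-m]: it is a copy, of
   level n, of the piece (2^k, 2^(k+1)] if s = 0, and of the mirror image of that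
   piece under b |-> 1 - b if s = 1. *)
Definition sgn m : nn M := nfst (nsnd m).
Definition scl m : nn M := nsnd (nsnd m).
(** Scaling by the power [m + k + 1] of 2 takes (2^-(m+1), 2^-m] to (2^k, 2^(k+1)]; the sign of
    [bcoef] and the constant term of [base] add the reflection. *)
Definition bexp m : nn M := m + (scl m + 1).
Definition bcoef m : nn M := mkq (npow2 (bexp m) * nnot (sgn m)) (npow2 (bexp m) * sgn m) 1.
Definition base m y : dom M ty1 := aff (bexp m) (bcoef m) (mkq (sgn m) 0 1) y.

(** The pairing is not onto, so being the code of its own projections is a condition on a number. *)
Definition valid c := c = npair (nfst c) (nsnd c) /\ (nfst c = 0 \/ nfst c = 1).

Lemma nnot0 : nnot 0 = 1 :> nn M.
Proof. exact: nmonus0. Qed.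

Lemma nnotN n : n <> 0 -> nnot n = 0.
Proof. by move/nnot_eq0. Qed.

Lemma n1_neq0 : 1 <> 0 :> nn M.
Proof. by rewrite -[1]add0r; exact: nS_neq0. Qed.

Lemma sgn_pair n c : sgn (npair n c) = nfst c. Proof. by rewrite /sgn nsnd_pair. Qed.
Lemma scl_pair n c : scl (npair n c) = nsnd c. Proof. by rewrite /scl nsnd_pair. Qed.

Lemma val_bcoef0 m : sgn m = 0 -> val (bcoef m) = pw (bexp m).
Proof. by move=> e; rewrite val_mkq1 e nnot0 mulr1 mulr0 iota0 subr0. Qed.

Lemma val_bcoef1 m : sgn m = 1 -> val (bcoef m) = - pw (bexp m).
Proof. by move=> e; rewrite val_mkq1 e (nnotN n1_neq0) mulr1 mulr0 iota0 sub0r. Qed.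

Lemma bcoef_small m : sgn m = 0 \/ sgn m = 1 -> `|val (bcoef m)| * ee (bexp m) <= 1.
Proof.
by case=> e; [rewrite val_bcoef0|rewrite val_bcoef1 ?normrN] => //;
  rewrite gtr0_norm ?pow2_gt0 // pow2_ee.
Qed.

Lemma bcoef_neq0 m : sgn m = 0 \/ sgn m = 1 -> val (bcoef m) != 0.
Proof.
by case=> e; [rewrite val_bcoef0|rewrite val_bcoef1 ?oppr_eq0] => //;
  rewrite lt0r_neq0 ?pow2_gt0.
Qed.

Lemma sgn_valid n c : valid c -> sgn (npair n c) = 0 \/ sgn (npair n c) = 1.
Proof. by move=> [_]; rewrite sgn_pair. Qed.

Lemma isreal_base n c y : valid c -> isreal y -> isreal (base (npair n c) y).
Proof. by move=> vc; apply/isreal_aff/bcoef_small/sgn_valid. Qed.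

Definition piece c b :=
  (nfst c = 0 /\ ~ ub b (pw (nsnd c)) /\ ub b (pw (nsnd c + 1))) \/
  (nfst c = 1 /\ ~ lb b (1 - pw (nsnd c)) /\ lb b (1 - pw (nsnd c + 1))).

(** Dividing the ends of the piece by 2^(bexp m) gives exactly [ee (m + 1)] and [ee m]. Reflection
    reverses the order, hence the lower bounds in the second case of [piece]. *)
Lemma piece_base n c y : valid c -> isreal y ->
  dyadic y (npair n c) <-> piece c (base (npair n c) y).
Proof.
move=> vc hy; have sm := bcoef_small (sgn_valid n vc); set m := npair n c in sm *.
have pg := pow2_gt0 (bexp m); have eb : bexp m = m + (nsnd c + 1) by rewrite /bexp scl_pair.
have [g1 g2 g3] := And3 (pow2_gt0 m) (pow2_gt0 (nsnd c)) (pow2_gt0 (nsnd c + 1)).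
have q1 : pw (nsnd c + 1) / pw (bexp m) = ee m.
  by rewrite eb (pwD m) invfM mulrCA mulfV ?mulr1 // lt0r_neq0.
have q2 : pw (nsnd c) / pw (bexp m) = ee (m + 1).
  rewrite eb [nsnd c + 1]addrC addrA (pwD (m + 1)) invfM mulrCA mulfV ?mulr1 // lt0r_neq0 //.
have n10 := n1_neq0.
case: vc => _ [] e; rewrite /piece e.
- have sg : sgn m = 0 by rewrite sgn_pair.
  rewrite /base !ub_aff //; [|by rewrite val_bcoef0..].
  rewrite sg val_mkq1 iota0 subrr !subr0 val_bcoef0 // q1 q2.
  by split=> [[h1 h2]|[[_ [h1 h2]]|[/esym]//]]; [left|].
- have sg : sgn m = 1 by rewrite sgn_pair.
  have vn : val (bcoef m) < 0 by rewrite val_bcoef1 // oppr_lt0.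
  rewrite /base !lb_aff_neg // sg val_mkq1 iota0 iota1 subr0 val_bcoef1 //.
  rewrite ![1 - _ - 1]addrAC !subrr !sub0r !invrN !mulrNN q1 q2.
  by split=> [[h1 h2]|[[/n10]//|[_ [h1 h2]]]]; [right|].
Qed.

Lemma piece_req c x y : isreal x -> isreal y -> req x y -> piece c x -> piece c y.
Proof.
move=> hx hy h; rewrite /piece.
by rewrite !(ub_req_iff _ hx hy h) !(lb_req_iff _ hx hy h).
Qed.

Lemma piece_not_unit c b : isreal b -> piece c b -> ~ unit b.
Proof.
move=> hb [[_ [h _]]|[_ [h _]]] [_ l u]; apply: h.
  by apply: ub_le u; exact: pw_ge1.
by apply: lb_le l; have := pw_ge1 (nsnd c); lra.
Qed.

(** Pieces of equal sign are disjoint as dyadic intervals; those of sign 0 lie at or above 1, those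
    of sign 1 at or below 0. *)
Lemma piece_uniq c c' b : isreal b -> valid c -> valid c' -> piece c b -> piece c' b -> c = c'.
Proof.
move=> hb [ec _] [ec' _] h h'.
have mono k l : pw (k + 1) <= pw (k + 1 + l).
  by rewrite (pwD (k + 1)) ler_peMr ?pw_ge1 // ltW ?pow2_gt0.
rewrite ec ec'; case: h h' => [[s [h1 h2]]|[s [h1 h2]]] [[s' [k1 k2]]|[s' [k1 k2]]]; rewrite s s'.
- congr npair; have [//|[[d e]|[d e]]] := n_total (nsnd c) (nsnd c').
    by case: k1; apply: ub_le h2; rewrite e.
  by case: h1; apply: ub_le k2; rewrite e.
- exfalso; move: (lb_ub_le (not_ub_lb hb h1) (not_lb_ub hb k1)) (pw_ge1 (nsnd c)) (pw_ge1 (nsnd c')).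
  by clear; lra.
- exfalso; move: (lb_ub_le (not_ub_lb hb k1) (not_lb_ub hb h1)) (pw_ge1 (nsnd c)) (pw_ge1 (nsnd c')).
  by clear; lra.
- congr npair; have [//|[[d e]|[d e]]] := n_total (nsnd c) (nsnd c').
    by case: k1; apply: lb_le h2; rewrite e lerD2l lerN2.
  by case: h1; apply: lb_le k2; rewrite e lerD2l lerN2.
Qed.

(* The inverse of [base m]. *)
Definition base_inv m b : dom M ty1 :=
  aff 0 (mkq (nnot (sgn m)) (sgn m) (npow2 (bexp m))) (mkq (sgn m) 0 (npow2 (bexp m))) b.

Lemma base_invP n c b : valid c -> isreal b ->
  isreal (base_inv (npair n c) b) /\ req (base (npair n c) (base_inv (npair n c) b)) b.
Proof.
move=> vc hb; set m := npair n c; have sg := sgn_valid n vc; rewrite -/m in sg.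
have p0 := pow2_gt0 (bexp m); have pn := lt0r_neq0 p0.
have e1 := ee_le1 (bexp m); have e0 := ee_gt0 (bexp m).
have small : `|val (mkq (nnot (sgn m)) (sgn m) (npow2 (bexp m)))| * ee (0 : nn M) <= 1.
  rewrite ee0 mulr1 val_mkq //; case: sg => ->; rewrite ?nnot0 ?(nnotN n1_neq0) iota0 iota1.
    by rewrite subr0 div1r gtr0_norm.
  by rewrite sub0r mulN1r normrN gtr0_norm.
have hi : isreal (base_inv m b) by exact: isreal_aff.
split=> // j; rewrite /base v_aff /base_inv v_aff addr0.
have -> : val (bcoef m) * (val (mkq (nnot (sgn m)) (sgn m) (npow2 (bexp m))) *
   apx b (j + bexp m) + val (mkq (sgn m) 0 (npow2 (bexp m)))) + val (mkq (sgn m) 0 1) =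
   apx b (j + bexp m).
  rewrite !val_mkq1 !val_mkq // !iotaM.
  by case: sg => ->; rewrite ?nnot0 ?(nnotN n1_neq0) iota0 iota1; field.
by have := hb j (bexp m); rewrite distrC; have := ee_gt0 j; lra.
Qed.

(** The difference [2 * (n + c) + 2] between the codes of (n + 1, c) and (n, c), as the pairing is
    quadratic. *)
Definition lift_exp n c : nn M := (n + c) + (n + c) + 1 + 1.

Lemma npair_lift n c : npair (n + 1) c = npair n c + lift_exp n c.
Proof. by rewrite !npair_def /lift_exp; ring. Qed.

(** Passing to level [n + 1] raises the code, and with it [bexp], by [lift_exp n c]; scaling by that
    power therefore moves a copy one level up towards 1 without changing the point it represents. *)
Lemma base_up n c y : valid c -> isreal y ->
  req (base (npair n c) (up (lift_exp n c) y)) (base (npair (n + 1) c) y).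
Proof.
move=> vc hy j; rewrite /base /up !v_aff val_up val0 addr0 !sgn_pair.
have eb : bexp (npair (n + 1) c) = bexp (npair n c) + lift_exp n c.
  by rewrite /bexp !scl_pair npair_lift; ring.
have ec : val (bcoef (npair (n + 1) c)) = val (bcoef (npair n c)) * pw (lift_exp n c).
  by rewrite !val_mkq1 !sgn_pair eb npow2D !iotaM; ring.
rewrite ec eb [j + (_ + _)]addrA mulrA subrr normr0; have := ee_gt0 j; lra.
Qed.

(** If no dyadic interval contained y, induction would give y at most 2^-m for every m, hence y at
    most 0. The induction is available because [decide] makes its statement quantifier-free. *)
Lemma dyadic_ex_of (Y : dom M ty2) y : ufun Y -> ~ collides Y -> isreal y ->
  ub y 1 -> ~ ub y 0 -> exists m, dyadic y m.
Proof.
move=> Yf Yi hy y1 y0; apply: contrapT => no; apply: y0.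
have sh m : decide Y (aff 0 (qone M) (qmee m) y) = 0 <-> ub y (ee m).
  rewrite decideP //; last exact: isreal_aff (qone_small M) hy.
  rewrite ub_aff ?qone_small ?val_qone ?ltr01 // val_qmee sub0r opprK divr1.
  exact: iff_refl.
have all_le : forall m, decide Y (aff 0 (qone M) (qmee m) y) = 0.
  apply: dfn_ind.
  - apply/dfn_decide/dfn_aff; try exact: dfn_const.
    by apply: dfn_mkq; try exact: dfn_const; apply/dfn_pow2/dfn_id.
  - by apply/sh; rewrite ee0.
  - by move=> m /sh h; apply/sh; apply: contrapT => k; apply: no; exists m.
move=> n; apply: (@ee_lim M _ _ 1) => m.
by have /sh := all_le m => /(_ n); lra.
Qed.

(** To the right of 1 the powers of two are climbed until one bounds the point; points to the left
    of 0 are reflected first. *)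
Lemma piece_ex (Y : dom M ty2) b : ufun Y -> ~ collides Y -> isreal b ->
  ~ unit b -> exists2 c, valid c & piece c b.
Proof.
move=> Yf Yi hb nu.
have big z : isreal z -> ~ ub z 1 -> exists k, ~ ub z (pw k) /\ ub z (pw (k + 1)).
  move=> hz z1; apply: contrapT => no.
  have sh k : decide Y (aff 0 (qone M) (mkq 0 (npow2 k) 1) z) = 0 <-> ub z (pw k).
    rewrite decideP //; last exact: isreal_aff (qone_small M) hz.
    rewrite ub_aff ?qone_small ?val_qone ?ltr01 // val_mkq1 iota0 !sub0r opprK divr1.
    exact: iff_refl.
  (* The induction statement is the negation: the point lies above every 2^k. *)
  have all_gt : forall k, nnot (decide Y (aff 0 (qone M) (mkq 0 (npow2 k) 1) z)) = 0.
    apply: dfn_ind.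
    - apply/dfn_nnot/dfn_decide/dfn_aff; try exact: dfn_const.
      by apply: dfn_mkq; try exact: dfn_const; apply/dfn_pow2/dfn_id.
    - by apply/nnot_eq0 => /sh; rewrite npow2_0 iota1.
    - move=> k /nnot_eq0 h; apply/nnot_eq0 => /sh h2; apply: no; exists k; split=> // h3.
      by apply: h; apply/sh.
  (* A real stays within 1 of its term at 0, hence below some [K], and [K] is below 2^K. *)
  have [K hK] := fld_bound (apx z 0 + 1).
  have /nnot_eq0 := all_gt K; apply; apply/sh => n.
  have /iota_lt := npow2_gt K; have := hz 0 n; rewrite add0r ee0 ltr_norml => /andP [? ?].
  by have := ee_gt0 n; lra.
case: (pselect (ub b 1)) => [b1|/(big _ hb) [k [h1 h2]]]; last first.
  exists (npair 0 k); first by split; rewrite nfst_pair ?nsnd_pair //; left.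
  by left; rewrite nfst_pair nsnd_pair.
have b0 : ~ lb b 0 by move=> l; apply: nu.
have sm := qmee_small M; have vn : val (qmee (0 : nn M)) < 0 by rewrite val_qmee ee0 ltrN10.
(* This real is 1 - b, the coefficient being [- ee 0], that is -1. *)
have hz : isreal (aff 0 (qmee 0) (qone M) b) by exact: isreal_aff.
have flip r : ub (aff 0 (qmee 0) (qone M) b) r <-> lb b (1 - r).
  rewrite ub_aff_neg // val_qone val_qmee ee0 invrN invr1 mulrN1 opprB; exact: iff_refl.
have [|k] := big _ hz; first by rewrite flip subrr.
rewrite !flip => -[h1 h2]; exists (npair 1 k).
  by split; rewrite nfst_pair ?nsnd_pair //; right.
by right; rewrite nfst_pair nsnd_pair.
Qed.

End Scaling.

(** * The Hilbert hotel *)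

Section Hotel.
Variable M : model.
Implicit Types (n m k p c : nn M) (x y z b : dom M ty1) (r : fld M).
Variables (A : dom M ty11) (Y : dom M ty2).
Hypothesis As : rset A.
Hypothesis Yr : rfun Y.
Hypothesis Yi : inj_on Y A.
Hypothesis Ys : surj_on Y A.
Hypothesis inA : forall y, unit y -> mem_of A y.

Let unit_real y : unit y -> isreal y. Proof. by case. Qed.

Let Yf : ufun Y.
Proof. by move=> x y [/unit_real hx [/unit_real hy e]]; exact: Yr. Qed.

Let Yn : ~ collides Y.
Proof. by move=> [x [y [hx [hy [ne e]]]]]; apply: ne; apply: Yi e; split; exact: inA. Qed.

Let eqY x y : mem_of A x -> mem_of A y -> Y ∙ x = Y ∙ y <-> req x y.
Proof.
move=> hx hy; split; first exact: Yi.
by move=> e; apply: Yr; case: hx hy => hx _ [hy _].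
Qed.

(** Choice demands a witness for every sequence of type 1, including non-reals and reals outside
    (0,1]. The formula is therefore weakened by disjuncts that cover these; for a non-real the
    chosen number codes a pair of indices where fast convergence fails. *)
Lemma dyadic_index : exists Phi : dom M ty2, forall y m, isreal y -> dyadic y m -> Phi ∙ y = m.
Proof.
have [D hD] : @dfn M ty1 N (fun y => decide Y y) by apply/dfn_decide/dfn_id.
have [L hL] : @dfn M N (ty1 ~> ty1) (fun m => aff_el M ∙ (0 : nn M) ∙ qone M ∙ qmee m).
  apply: dfn_app1; apply: dfn_mkq; try exact: dfn_const.
  exact/dfn_pow2/dfn_id.
pose c s (d : dom M s) : term (ext (ext (dom M) ty1) N) s := Var (old (old d)).
pose le1 (m : term (ext (ext (dom M) ty1) N) N) := c _ D @ (c _ L @ m @ v1) == Zero.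
pose xn : term (ext (ext (dom M) ty1) N) N := v1 @ fst v0.
pose xni : term (ext (ext (dom M) ty1) N) N := v1 @ (fst v0 ⊕ snd v0).
(* The four alternatives: y is at most 0; y exceeds 1; [v0] is the dyadic index; y violates fast
   convergence at the pair coded by [v0]. *)
pose B := c _ D @ v1 == Zero ∨ ¬ le1 (c _ (zero M)) ∨ (le1 v0 ∧ ¬ le1 (v0 ⊕ One)) ∨
  ¬ qabs xn xni ⊗ pow2 (fst v0) ≺ qcden xn xni.
pose P y m := sat (econs (m : dom M N) (econs y (@own_env M))) B.
have realP y m : sat (econs (m : dom M N) (econs y (@own_env M)))
    (qabs xn xni ⊗ pow2 (fst v0) ≺ qcden xn xni) <->
    `|apx y (nfst m) - apx y (nfst m + nsnd m)| < ee (nfst m).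
  rewrite sat_lt (eval_times _ (qabs xn xni)) eval_qabs eval_qcden eval_pow2.
  rewrite iotaM iota_qabs scaled_lt ?iota_qcden_gt0 ?pow2_gt0 //.
  have -> : eval (econs (m : dom M N) (econs y (@own_env M))) xn = y ∙ nfst m.
    by rewrite /xn eval_app eval_fst.
  have -> : eval (econs (m : dom M N) (econs y (@own_env M))) xni = y ∙ (nfst m + nsnd m).
    by rewrite /xni eval_app eval_plus eval_fst eval_snd.
  by rewrite eval_fst.
have leP y m : isreal y -> D ∙ (L ∙ (m : dom M N) ∙ y) = zero M <-> ub y (ee m).
  move=> hy; rewrite hD hL -/(aff 0 (qone M) (qmee m) y).
  apply: iff_trans (decideP Yf Yn (isreal_aff (qmee m) (qone_small M) hy)) _.
  rewrite ub_aff ?qone_small ?val_qone ?ltr01 // val_qmee sub0r opprK divr1.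
  exact: iff_refl.
have PE y m : P y m <-> decide Y y = 0 \/ ~ D ∙ (L ∙ zero M ∙ y) = zero M \/
    (D ∙ (L ∙ (m : dom M N) ∙ y) = zero M /\ ~ D ∙ (L ∙ (m + 1) ∙ y) = zero M) \/
    ~ `|apx y (nfst m) - apx y (nfst m + nsnd m)| < ee (nfst m).
  by rewrite -hD -realP; exact: iff_refl.
have ex y : exists m, P y m.
  case: (pselect (isreal y)) => [hy|/existsNP [n /existsNP [i h]]]; last first.
    by exists (npair n i); apply/PE; right; right; right; rewrite nfst_pair nsnd_pair.
  case: (pselect (ub y 0)) => [y0|y0].
    by exists 0; apply/PE; left; apply/decideP.
  case: (pselect (ub y 1)) => [y1|y1]; last first.
    by exists 0; apply/PE; right; left => /(leP _ 0 hy); rewrite ee0.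
  have [m [h1 h2]] := dyadic_ex_of Yf Yn hy y1 y0.
  exists m; apply/PE; right; right; left; split; first exact/leP.
  by move=> /(leP _ _ hy).
have qB : quantifier_free B = true by [].
have [Phi hPhi] := @qf_choice M P B qB (fun _ _ => iff_refl _) ex.
exists Phi => y m hy hm; have [h0 h1] := conj (dyadic_pos hm) hm.1.
have /PE := hPhi y; case=> [/decideP h|[h|[[h2 h3]|h]]].
- by case: h0; apply: h.
- by case: h; apply/(leP _ 0 hy); rewrite ee0; apply: ub_le h1; exact: ee_le1.
- apply: dyadic_uniq hm; split; first exact/leP.
  by move=> h; apply: h3; apply/(leP _ _ hy).
- by case: h; apply: hy.
Qed.

(* [copy_of y n c]: y is the copy of level n of the point [base <n, c> y] of A outside [0, 1]. *)
Definition copy_of y n c := [/\ valid c, dyadic y (npair n c) & mem_of A (base (npair n c) y)].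

Lemma copy_of_req y z n c : isreal y -> isreal z -> req y z -> copy_of y n c -> copy_of z n c.
Proof.
move=> hy hz h [vc h1 h2]; split=> //; first exact: dyadic_req h1.
apply: mem_req h2 => //; first exact: isreal_base.
exact: req_aff (bcoef_small (sgn_valid n vc)) h.
Qed.

Lemma copy_of_up y n c : valid c -> isreal y -> copy_of (up (lift_exp n c) y) n c <-> copy_of y (n + 1) c.
Proof.
move=> vc hy; have e := base_up n vc hy; have hu := isreal_up (lift_exp n c) hy.
have hI := dyadic_up (lift_exp n c) (npair n c) hy; rewrite -npair_lift in hI.
split=> -[_ h1 h2]; split=> //; try exact/hI.
  by apply: mem_req e h2 => //; exact: isreal_base.
by apply: mem_req (req_sym e) h2 => //; exact: isreal_base.
Qed.

Lemma npair_inj n n' c c' : npair n c = npair n' c' -> n = n' /\ c = c'.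
Proof.
move=> e; have := congr1 (@nsnd M) e; have := congr1 (@nfst M) e.
by rewrite !nfst_pair !nsnd_pair.
Qed.

(* The bijection y |-> x from [0, 1] onto A. *)
Inductive image y x : Prop :=
| Leave c of copy_of y 0 c & x = base (npair 0 c) y & ~ unit x
| Shift n c of copy_of y (n + 1) c & x = up (lift_exp n c) y & copy_of x n c
| Stay of x = y & forall n c, ~ copy_of y n c.

Lemma image_ex y : unit y -> exists x, image y x.
Proof.
move=> /unit_real hy.
case: (pselect (exists n c, copy_of y n c)) => [[n [c h]]|h]; last first.
  by exists y; apply: Stay => // n c k; apply: h; exists n, c.
have [vc h1 _] := h; have [e|e] := npredK n; rewrite e in h h1.
  exists (base (npair 0 c) y); apply: (Leave h) => //.
  by apply: (@piece_not_unit _ c); [exact: isreal_base|exact/(piece_base _ vc hy)].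
by exists (up (lift_exp (npred n) c) y); apply: (Shift h) => //; apply/copy_of_up.
Qed.

Lemma copy_of_unit y n c : isreal y -> copy_of y n c -> unit y.
Proof. by move=> hy [_ h _]; exact: dyadic_unit h. Qed.

Lemma image_mem y x : unit y -> image y x -> mem_of A x.
Proof.
move=> hy; case=> [c [_ _ h] -> _ //|n c h e hx|-> _]; last exact: inA.
by apply/inA/(copy_of_unit _ hx); rewrite e; apply/isreal_up/unit_real.
Qed.

(** The kinds of image are disjoint: [Leave] ends outside [0,1], [Shift] at a copy, [Stay] at a
    point of [0,1] that is no copy. Within a kind other than [Stay], the image determines the affine
    map, which is injective. *)
Lemma image_inj y1 y2 x1 x2 : unit y1 -> unit y2 -> image y1 x1 -> image y2 x2 ->
  req x1 x2 -> req y1 y2.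
Proof.
wlog suff main : y1 y2 x1 x2 / unit y1 -> unit y2 -> image y1 x1 -> image y2 x2 ->
  req x1 x2 -> req y1 y2 \/ (forall n c, copy_of y1 n c -> False) /\ (exists n c, copy_of y2 n c).
  move=> u1 u2 i1 i2 e; have [//|[h [n [c k]]]] := main _ _ _ _ u1 u2 i1 i2 e.
  by have [/req_sym//|[h' _]] := main _ _ _ _ u2 u1 i2 i1 (req_sym e); case: (h' n c).
move=> u1 u2 i1 i2 e.
have [[r1 _ ] [r2 _]] := conj (image_mem u1 i1) (image_mem u2 i2).
have [hy1 hy2] := conj (unit_real u1) (unit_real u2).
have back x y n c : isreal x -> isreal y -> req x y -> copy_of y n c -> unit x.
  by move=> hx hy h k; apply: unit_req (req_sym h) _ => //; exact: copy_of_unit k.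
case: i1 => [c1 h1 e1 nu1|n1 c1 h1 e1 k1|e1 n1]; case: i2 => [c2 h2 e2 nu2|n2 c2 h2 e2 k2|e2 n2].
- left; have [[v1 j1 _] [v2 j2 _]] := conj h1 h2.
  have ec : c1 = c2.
    apply: (@piece_uniq _ c1 c2 x2) => //; last by rewrite e2; apply/piece_base.
    by apply: piece_req e _ => //; rewrite e1; apply/piece_base.
  subst c2 x1 x2; apply: req_aff_inj e => //; exact/bcoef_neq0/sgn_valid.
- by case: nu1; exact: back e k2.
- by case: nu1; apply: unit_req (req_sym e) _ => //; rewrite e2.
- by case: nu2; exact: back (req_sym e) k1.
- left; have [[v1 j1 _] [v2 j2 _]] := conj k1 k2.
  have /npair_inj [en ec] := dyadic_uniq (dyadic_req r1 r2 e j1) j2.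
  subst n2 c2 x1 x2; apply: req_aff_inj e => //.
  by rewrite val_up lt0r_neq0 ?pow2_gt0.
- by exfalso; apply: (n2 n1 c1); rewrite -e2; exact: copy_of_req e k1.
- by case: nu2; apply: unit_req e _ => //; rewrite e1.
- by exfalso; apply: (n1 n2 c2); rewrite -e1; exact: copy_of_req (req_sym e) k2.
- by left; rewrite -e1 -e2.
Qed.

(** A point outside [0,1] comes from its copy of level 0, a copy from the copy of the next level,
    any other point from itself. Dividing and multiplying back returns the point only up to [=R],
    hence the intermediate [z]. *)
Lemma image_surj x : mem_of A x -> exists y z, [/\ unit y, image y z & req z x].
Proof.
move=> xA; have [hx _] := xA; case: (pselect (unit x)) => [ux|nu]; last first.
  have [c vc pc] := piece_ex Yf Yn hx nu.
  have [hy e] := base_invP 0 vc hx; set y := base_inv _ x in hy e.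
  have hb := isreal_base 0 vc hy.
  have h : dyadic y (npair 0 c) by apply/piece_base => //; apply: piece_req pc => //; exact: req_sym.
  exists y, (base (npair 0 c) y); split=> //; first exact: dyadic_unit h.
  apply: (@Leave _ _ c) => //; last by move=> k; apply: nu; exact: unit_req e k.
  by split=> //; apply: mem_req xA => //; exact: req_sym.
case: (pselect (exists n c, copy_of x n c)) => [[n [c h]]|h]; last first.
  exists x, x; split=> //; last exact: req_refl.
  by apply: Stay => // n c k; apply: h; exists n, c.
have [vc _ _] := h; set p := lift_exp n c.
have small : `|val (qee p)| * ee (0 : nn M) <= 1.
  by rewrite ee0 mulr1 val_qee gtr0_norm ?ee_gt0 ?ee_le1.
have hy : isreal (aff 0 (qee p) 0 x) by exact: isreal_aff.
have e : req (up p (aff 0 (qee p) 0 x)) x.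
  move=> j; rewrite /up !v_aff val_up val_qee val0 !addr0 mulrA pow2_ee mul1r.
  by have := hx j p; rewrite distrC; have := ee_gt0 j; lra.
have hu := isreal_up p hy.
have hC : copy_of (up p (aff 0 (qee p) 0 x)) n c by apply: copy_of_req (req_sym e) h.
exists (aff 0 (qee p) 0 x), (up p (aff 0 (qee p) 0 x)); split=> //.
  by apply: (@copy_of_unit _ (n + 1) c) => //; apply/copy_of_up.
by apply: (@Shift _ _ n c) => //; apply/copy_of_up.
Qed.

Lemma image_fun y1 y2 x1 x2 : unit y1 -> unit y2 -> req y1 y2 ->
  image y1 x1 -> image y2 x2 -> req x1 x2.
Proof.
move=> u1 u2 e; have [hy1 hy2] := conj (unit_real u1) (unit_real u2).
have uniq n c n' c' : copy_of y1 n c -> copy_of y2 n' c' -> n = n' /\ c = c'.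
  by move=> [_ h _] [_ h' _]; apply: npair_inj; apply: dyadic_uniq h'; exact: dyadic_req h.
case=> [c1 h1 -> _|n1 c1 h1 -> _|-> n1]; case=> [c2 h2 -> _|n2 c2 h2 -> _|-> n2] //.
- have [_ <-] := uniq _ _ _ _ h1 h2; have [vc _ _] := h1.
  exact: req_aff (bcoef_small (sgn_valid 0 vc)) e.
- by have [/esym/nS_neq0] := uniq _ _ _ _ h1 h2.
- by case: (n2 _ _ (copy_of_req hy1 hy2 e h1)).
- by have [/nS_neq0] := uniq _ _ _ _ h1 h2.
- have [/n_addI <- <-] := uniq _ _ _ _ h1 h2; exact: req_aff (up_small _) e.
- by case: (n2 _ _ (copy_of_req hy1 hy2 e h1)).
- by case: (n1 _ _ (copy_of_req hy2 hy1 (req_sym e) h2)).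
- by case: (n1 _ _ (copy_of_req hy2 hy1 (req_sym e) h2)).
Qed.

Lemma nmul_eq0 n m : n * m = 0 <-> n = 0 \/ m = 0.
Proof.
split=> [h|[->|->]]; rewrite ?mul0r ?mulr0 //.
have /eqP := congr1 (@iota M) h; rewrite iotaM iota0 mulf_eq0 => /orP [] /eqP e.
  by left; apply: iota_inj; rewrite e iota0.
by right; apply: iota_inj; rewrite e iota0.
Qed.

Definition ifz n (a a' : nn M) : nn M := nnot n * a + nnot (nnot n) * a'.

Lemma ifz0 a a' : ifz 0 a a' = a.
Proof. by rewrite /ifz nnot0 (nnotN (@n1_neq0 M)) mul1r mul0r addr0. Qed.

Lemma ifzN n a a' : n <> 0 -> ifz n a a' = a'.
Proof. by move=> h; rewrite /ifz (nnotN h) nnot0 mul1r mul0r add0r. Qed.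

Lemma dfn_ifz t (f g h : dom M t -> nn M) :
  @dfn M t N f -> @dfn M t N g -> @dfn M t N h -> @dfn M t N (fun w => ifz (f w) (g w) (h w)).
Proof.
move=> hf hg hh; apply: dfn_plus; apply: dfn_times => //; apply: dfn_nnot => //.
exact: dfn_nnot.
Qed.

(** Only [Y] of the image is defined, not the image: the cases then select between numbers, which
    [ifz] can do, instead of between reals. *)
Lemma image_dfn : exists W : dom M ty2, forall y x, unit y -> image y x -> W ∙ y = Y ∙ x.
Proof.
have [Phi hPhi] := dyadic_index.
pose m y : nn M := Phi ∙ y.
(* [dn y] has the same piece one level lower, so at a copy of level n + 1 the difference [p y] is
   [lift_exp]. *)
pose dn y : nn M := npair (npred (nfst (m y))) (nsnd (m y)).
pose p y : nn M := nmonus (m y) (dn y).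
(* Zero exactly if [m y] is a triple code whose sign s satisfies s = 0 or s = 1, the latter written
   as a product. *)
pose ok y : nn M := neqn (npair (nfst (m y)) (npair (sgn (m y)) (scl (m y)))) (m y) +
  sgn (m y) * neqn (sgn (m y)) 1.
(* [Phi] is arbitrary at points without a dyadic index, so everything is checked: y is positive, at
   most 2^-m, above 2^-(m+1), the code is valid, and the represented point belongs to [A]. *)
pose out_ y : nn M := nnot (decide Y y) + decide Y (aff 0 (qone M) (qmee (m y)) y) +
  nnot (decide Y (aff 0 (qone M) (qmee (m y + 1)) y)) + ok y + nnot (decide Y (A ∙ base (m y) y)).
have dm : @dfn M ty1 N m by apply/dfn_app1/dfn_id.
have dsgn : @dfn M ty1 N (fun y => sgn (m y)) by apply/dfn_fst/dfn_snd.
have dscl : @dfn M ty1 N (fun y => scl (m y)) by apply/dfn_snd/dfn_snd.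
have dc t (d : dom M t) : @dfn M ty1 t (fun _ => d) by exact: dfn_const.
have dbexp : @dfn M ty1 N (fun y => bexp (m y)) by apply: dfn_plus => //; apply: dfn_plus.
have dbb : @dfn M ty1 ty1 (fun y => base (m y) y).
  apply: dfn_aff => //; last exact: dfn_id.
    apply: dfn_mkq => //; apply: dfn_times => //; try exact: dfn_pow2.
    exact: dfn_nnot.
  exact: dfn_mkq.
have dqm (f : dom M ty1 -> nn M) : @dfn M ty1 N f ->
    @dfn M ty1 N (fun y => decide Y (aff 0 (qone M) (qmee (f y)) y)).
  move=> df; apply/dfn_decide/dfn_aff => //; last exact: dfn_id.
  by apply: dfn_mkq => //; exact: dfn_pow2.
have dp : @dfn M ty1 N p.
  apply: dfn_monus => //; apply: dfn_pair; last exact: dfn_snd.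
  apply: dfn_eq (dfn_app1 (eval (@own_env M) (lam (pred v0))) (dfn_fst dm)) => y.
  by rewrite eval_lam eval_pred.
have dout : @dfn M ty1 N out_.
  apply: dfn_plus; last by apply/dfn_nnot/dfn_decide/dfn_app1.
  apply: dfn_plus.
    apply: dfn_plus; last by apply/dfn_nnot/dqm/dfn_plus.
    by apply: dfn_plus; [apply/dfn_nnot/dfn_decide/dfn_id|exact: dqm].
  apply: dfn_plus; last by apply: dfn_times => //; apply: dfn_neqn.
  apply: dfn_neqn => //; apply: dfn_pair; first exact: dfn_fst.
  exact: dfn_pair.
have [W hW] : @dfn M ty1 N (fun y => ifz (out_ y)
    (ifz (nfst (m y)) (Y ∙ base (m y) y) (Y ∙ up (p y) y)) (Y ∙ y)).
  apply: dfn_ifz => //; last by apply/dfn_app1/dfn_id.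
  apply: dfn_ifz; [exact: dfn_fst|exact: dfn_app1|apply: dfn_app1].
  apply: dfn_aff => //; last exact: dfn_id.
  by apply: dfn_mkq => //; exact: dfn_pow2.
have okP y : ok y = 0 <-> valid (nsnd (m y)) /\ m y = npair (nfst (m y)) (nsnd (m y)).
  rewrite nadd_eq0 nmul_eq0 !neqn_eq0 /valid -/(sgn (m y)) -/(scl (m y)); split.
    move=> [e h]; have e2 : nsnd (m y) = npair (sgn (m y)) (scl (m y)).
      by have := congr1 (@nsnd M) e; rewrite nsnd_pair.
    by split=> //; rewrite e2.
  by move=> [[e h] e']; rewrite -e -e'.
have leP y k : isreal y -> decide Y (aff 0 (qone M) (qmee k) y) = 0 <-> ub y (ee k).
  move=> hy; apply: iff_trans (decideP Yf Yn (isreal_aff (qmee k) (qone_small M) hy)) _.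
  rewrite ub_aff ?qone_small ?val_qone ?ltr01 // val_qmee sub0r opprK divr1.
  exact: iff_refl.
have memP b : isreal b -> decide Y (A ∙ b) <> 0 <-> mem_of A b.
  move=> hb; rewrite /mem_of rlt_rcst_l val0 decideP //; last exact: As.1.
  by split=> [h|[]].
have outP1 y n c : isreal y -> copy_of y n c -> m y = npair n c /\ out_ y = 0.
  move=> hy [vc h1 h2]; have em : m y = npair n c by exact: hPhi.
  have ok0 : ok y = 0 by apply/okP; rewrite em nfst_pair nsnd_pair.
  have hb := isreal_base n vc hy; split=> //.
  rewrite /out_ em; apply/nadd_eq0; split; last by apply/nnot_eq0/memP.
  apply/nadd_eq0; split=> //; apply/nadd_eq0; split.
    apply/nadd_eq0; split; last by apply/leP => //; exact: h1.1.
    by apply/nnot_eq0 => /decideP k; case: (dyadic_pos h1); exact: k.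
  by apply/nnot_eq0 => /leP k; apply: h1.2; exact: k.
have outP2 y : isreal y -> out_ y = 0 -> copy_of y (nfst (m y)) (nsnd (m y)).
  move=> hy /nadd_eq0 [/nadd_eq0 [/nadd_eq0 [/nadd_eq0 [_ h1] h2] /okP [vc e]] h3].
  have hb := isreal_base (nfst (m y)) vc hy; split=> //; rewrite -e in hb *.
    split; first exact/leP.
    by move/nnot_eq0: h2 => h2 k; apply: h2; apply/leP.
  by apply/memP => //; apply/nnot_eq0.
exists W => y x /unit_real hy; rewrite hW; case=> [c h -> _|n c h -> _|-> h].
- by have [-> ->] := outP1 _ _ _ hy h; rewrite ifz0 nfst_pair ifz0.
- have [em ->] := outP1 _ _ _ hy h; rewrite ifz0 em nfst_pair ifzN; last exact: nS_neq0.
  congr (_ ∙ up _ y); rewrite /p /dn em nfst_pair nsnd_pair npredS npair_lift.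
  apply: iota_inj; rewrite iota_monus iotaD max_l; first by lra.
  by have := iota_ge0 (lift_exp n c); lra.
- by rewrite ifzN // => /(outP2 _ hy) /h.
Qed.

(** [W] is [Y] composed with the bijection, so it inherits from [Y] both injectivity and
    ontoness. *)
Lemma hotel : exists W : dom M ty2, ufun W /\ ~ collides W /\ ~ omits W.
Proof.
have [W hW] := image_dfn; exists W; split; [|split].
- move=> y1 y2 [u1 [u2 e]].
  have [[x1 i1] [x2 i2]] := conj (image_ex u1) (image_ex u2).
  rewrite (hW _ _ u1 i1) (hW _ _ u2 i2); apply/eqY; [exact: image_mem i1|exact: image_mem i2|].
  exact: image_fun e i1 i2.
- move=> [y1 [y2 [u1 [u2 [ne]]]]].
  have [[x1 i1] [x2 i2]] := conj (image_ex u1) (image_ex u2).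
  rewrite (hW _ _ u1 i1) (hW _ _ u2 i2) => e; apply: ne.
  apply: (image_inj u1 u2 i1 i2); apply/eqY => //; [exact: image_mem i1|exact: image_mem i2].
- move=> [n no]; have [x [xA e]] := Ys n.
  have [y [z [uy iz zx]]] := image_surj xA.
  apply: (no y uy); rewrite (hW _ _ uy iz) -e; apply/eqY => //; exact: image_mem iz.
Qed.

End Hotel.

Lemma NBI_avoids (M : model) :
  (forall Y : dom M ty2, ufun Y -> collides Y \/ omits Y) -> avoids (@scnt M).
Proof.
move=> nbi A [As [Y [Yr [Yi Ys]]]]; apply: contrapT => no.
have inA y : unit y -> mem_of A y.
  move=> hy; apply: contrapT => ny; apply: no; exists y; split=> // x xA e.
  by apply: ny; apply: mem_req (req_sym e) xA => //; case: hy.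
have [W [Wf [Wc Wo]]] := hotel As Yr Yi Ys inA.
by have [/Wc|/Wo] := nbi W Wf.
Qed.

Theorem theorem3p10 :
  (RCA0w ⊢ NIN ⇔ avoids_point (@countable)) /\
  (RCA0w ⊢ not_perfect (@countable) ⇒ NIN) /\
  (RCA0w ⊢ not_perfect_inh (@countable) ⇒ NIN) /\
  (RCA0w ⊢ NBI ⇔ avoids_point (@strongly_countable)) /\
  (RCA0w ⊢ not_perfect (@strongly_countable) ⇒ NBI).
Proof.
have hc M := sat_avoids (sat_countable (M := M)).
have hs M := sat_avoids (sat_strongly_countable (M := M)).
do !split; apply: completeness => M; [split| | |split|].
- by move=> /sat_NIN h; apply/hc/NIN_avoids.
- by move=> /hc h; apply/sat_NIN/avoids_NIN.
- by move=> /(sat_not_perfect (sat_countable (M := M))) h; apply/sat_NIN/imperfect_NIN.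
- by move=> /(sat_not_perfect_inh (sat_countable (M := M))) h; apply/sat_NIN/imperfect_inh_NIN.
- by move=> /sat_NBI h; apply/hs/NBI_avoids.
- by move=> /hs h; apply/sat_NBI/avoids_NBI.
- by move=> /(sat_not_perfect (sat_strongly_countable (M := M))) h; apply/sat_NBI/imperfect_NBI.
Qed.
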